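(* Let $d_1$ and $d_2$ be distinct squarefree integers not equal to one. Let $K=\mathbb{Q}(\sqrt{d_1},\sqrt{d_2})$, and let $K_i=\mathbb{Q}(\sqrt{d_i})$ ($i=1,2$), with discriminant $\Delta_{K_i}$. Let $p$ and $q$ be two positive primes. Then the quaternion algebra $H_K(p,q)$ is a division algebra if and only if, after possibly interchanging the names of $p$ and $q$, one of the following conditions holds: (1) $p$ and $q$ are odd and distinct, and $\left(\frac{p}{q}\right)=-1$, and ($p\equiv 1 \pmod 4$ or $q\equiv 1\pmod 4$), and ($\left(\frac{\Delta_{K_1}}{p}\right)=\left(\frac{\Delta_{K_2}}{p}\right)=1$ or $\left(\frac{\Delta_{K_1}}{q}\right)=\left(\frac{\Delta_{K_2}}{q}\right)=1$); (2) $q=2$, and ($p\equiv 3\pmod 8$ or $p\equiv 5\pmod 8$), and ($\left(\frac{\Delta_{K_1}}{p}\right)=\left(\frac{\Delta_{K_2}}{p}\right)=1$ or $d_1\equiv d_2\equiv 1\pmod 8$); (3) $p$ and $q$ are odd with $p\equiv q\equiv 3\pmod 4$, and at least one of the following holds: (a) $\left(\frac{q}{p}\right)\neq 1$ and ($\left(\frac{\Delta_{K_1}}{p}\right)=\left(\frac{\Delta_{K_2}}{p}\right)=1$ or $d_1\equiv d_2\equiv 1\pmod 8$); (b) $\left(\frac{p}{q}\right)\neq 1$ and ($\left(\frac{\Delta_{K_1}}{q}\right)=\left(\frac{\Delta_{K_2}}{q}\right)=1$ or $d_1\equiv d_2\equiv 1\pmod 8$).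
   Context: For a field $F$ of characteristic $\neq 2$ and $a,b\in F\setminus\{0\}$, $H_F(a,b)$ denotes the generalized quaternion algebra over $F$ with basis $1,i,j,k$ and relations $i^2=a$, $j^2=b$, $ij=-ji=k$. Squarefree integers are nonzero and may be negative. $\left(\frac{m}{\ell}\right)$ is the Legendre symbol for an odd prime $\ell$, equal to $0$ if $\ell\mid m$. The discriminant of $\mathbb{Q}(\sqrt d)$ is $d$ if $d\equiv 1\pmod 4$ and $4d$ otherwise. *)

(* Defs.v *)
From HB Require Import structures.
From mathcomp Require Import all_boot all_order all_algebra all_field.
From mathcomp Require Import ring.

Set Implicit Arguments.
Unset Strict Implicit.
Unset Printing Implicit Defensive.

Import Order.TTheory GRing.Theory Num.Theory.
Local Open Scope ring_scope.

(* [Quat x0 x1 x2 x3 : quaternion a b] is x0 + x1 i + x2 j + x3 k in H_F(a, b),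
   where i^2 = a, j^2 = b and ij = - ji = k, hence k^2 = - ab,
   ik = - ki = a j and kj = - jk = b i.  The definition makes sense for all
   a and b and in all characteristics; H_F(a, b) is a generalized quaternion
   algebra when a, b != 0 and F has characteristic different from 2. *)
Record quaternion (F : fieldType) (a b : F) :=
  Quat { q_re : F; q_i : F; q_j : F; q_k : F }.

Section QuaternionAlgebra.
Variables (F : fieldType) (a b : F).
Local Notation H := (quaternion a b).
Implicit Types x y z : H.

Definition tuple_of_quat x := (q_re x, q_i x, q_j x, q_k x).
Definition quat_of_tuple (t : F * F * F * F) : H :=
  let: (x0, x1, x2, x3) := t in Quat a b x0 x1 x2 x3.

Lemma tuple_of_quatK : cancel tuple_of_quat quat_of_tuple.
Proof. by case. Qed.

HB.instance Definition _ := Equality.copy H (can_type tuple_of_quatK).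
HB.instance Definition _ := Choice.copy H (can_type tuple_of_quatK).

Definition addq x y : H :=
  Quat a b (q_re x + q_re y) (q_i x + q_i y) (q_j x + q_j y) (q_k x + q_k y).
Definition oppq x : H := Quat a b (- q_re x) (- q_i x) (- q_j x) (- q_k x).
Definition scaleq (c : F) x : H :=
  Quat a b (c * q_re x) (c * q_i x) (c * q_j x) (c * q_k x).
Definition mulq x y : H :=
  let: Quat x0 x1 x2 x3 := x in
  let: Quat y0 y1 y2 y3 := y in
  Quat a b
    (x0 * y0 + a * (x1 * y1) + b * (x2 * y2) - a * b * (x3 * y3))
    (x0 * y1 + x1 * y0 - b * (x2 * y3) + b * (x3 * y2))
    (x0 * y2 + x2 * y0 + a * (x1 * y3) - a * (x3 * y1))
    (x0 * y3 + x3 * y0 + x1 * y2 - x2 * y1).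

Fact addqA : associative addq.
Proof. by move=> [? ? ? ?] [? ? ? ?] [? ? ? ?]; congr Quat; rewrite /= addrA. Qed.
Fact addqC : commutative addq.
Proof. by move=> [? ? ? ?] [? ? ? ?]; congr Quat; rewrite /= addrC. Qed.
Fact add0q : left_id (Quat a b 0 0 0 0) addq.
Proof. by move=> [? ? ? ?]; congr Quat; rewrite /= add0r. Qed.
Fact addNq : left_inverse (Quat a b 0 0 0 0) oppq addq.
Proof. by move=> [? ? ? ?]; congr Quat; rewrite /= addNr. Qed.
HB.instance Definition _ := GRing.isZmodule.Build H addqA addqC add0q addNq.

Fact mulqA : associative mulq.
Proof. by move=> [? ? ? ?] [? ? ? ?] [? ? ? ?]; congr Quat; ring. Qed.
Fact mul1q : left_id (Quat a b 1 0 0 0) mulq.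
Proof. by move=> [? ? ? ?]; congr Quat; ring. Qed.
Fact mulq1 : right_id (Quat a b 1 0 0 0) mulq.
Proof. by move=> [? ? ? ?]; congr Quat; ring. Qed.
Fact mulqDl : left_distributive mulq addq.
Proof. by move=> [? ? ? ?] [? ? ? ?] [? ? ? ?]; congr Quat => /=; ring. Qed.
Fact mulqDr : right_distributive mulq addq.
Proof. by move=> [? ? ? ?] [? ? ? ?] [? ? ? ?]; congr Quat => /=; ring. Qed.
Fact oneq_neq0 : Quat a b 1 0 0 0 != 0.
Proof. by apply/eqP => -[/eqP]; rewrite oner_eq0. Qed.
HB.instance Definition _ :=
  GRing.Zmodule_isNzRing.Build H mulqA mul1q mulq1 mulqDl mulqDr oneq_neq0.

Fact scaleqA c d x : scaleq c (scaleq d x) = scaleq (c * d) x.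
Proof. by congr Quat; rewrite /= mulrA. Qed.
Fact scale1q : left_id 1 scaleq.
Proof. by move=> [? ? ? ?]; congr Quat; rewrite /= mul1r. Qed.
Fact scaleqDr : right_distributive scaleq +%R.
Proof. by move=> c [? ? ? ?] [? ? ? ?]; congr Quat; rewrite /= mulrDr. Qed.
Fact scaleqDl x : {morph scaleq^~ x : c d / c + d}.
Proof. by move=> c d; congr Quat; rewrite /= mulrDl. Qed.
HB.instance Definition _ :=
  GRing.Zmodule_isLmodule.Build F H scaleqA scale1q scaleqDr scaleqDl.

Fact scaleqAl c x y : c *: (x * y) = c *: x * y.
Proof. by case: x y => [? ? ? ?] [? ? ? ?]; congr Quat => /=; ring. Qed.
HB.instance Definition _ := GRing.Lmodule_isLalgebra.Build F H scaleqAl.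

Fact scaleqAr c x y : c *: (x * y) = x * (c *: y).
Proof. by case: x y => [? ? ? ?] [? ? ? ?]; congr Quat => /=; ring. Qed.
HB.instance Definition _ := GRing.Lalgebra_isAlgebra.Build F H scaleqAr.

Definition quat_i : H := Quat a b 0 1 0 0.
Definition quat_j : H := Quat a b 0 0 1 0.
Definition quat_k : H := Quat a b 0 0 0 1.

Lemma quat_ii : quat_i * quat_i = a%:A.
Proof. by congr Quat => /=; ring. Qed.
Lemma quat_jj : quat_j * quat_j = b%:A.
Proof. by congr Quat => /=; ring. Qed.
Lemma quat_ij : quat_i * quat_j = quat_k.
Proof. by congr Quat => /=; ring. Qed.
Lemma quat_ji : quat_j * quat_i = - quat_k.
Proof. by congr Quat => /=; ring. Qed.
Lemma quat_basisE (x0 x1 x2 x3 : F) :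
  Quat a b x0 x1 x2 x3
    = x0%:A + x1 *: quat_i + x2 *: quat_j + x3 *: quat_k.
Proof. by congr Quat => /=; ring. Qed.

End QuaternionAlgebra.

Definition division_ring (A : nzRingType) : Prop :=
  forall x : A, x != 0 -> exists y : A, x * y = 1 /\ y * x = 1.

Definition squarefreez (d : int) : Prop :=
  d != 0 /\ forall x : int, (x ^+ 2 %| d)%Z -> `|x| = 1.

(* Legendre symbol (m / l), meaningful for an odd prime l. *)
Definition legendre (m : int) (l : nat) : int :=
  if (l %| m)%Z then 0
  else if [exists x : 'I_l, (x%:Z ^+ 2 == m %[mod l])%Z] then 1 else -1.

(* Discriminant of Q(sqrt d), for d squarefree and d != 1. *)
Definition quad_disc (d : int) : int :=
  if (d == 1 %[mod 4])%Z then d else 4 * d.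

(* K is Q(sqrt d1, sqrt d2), with s1 and s2 as the two square roots. *)
Definition is_biquadratic (d1 d2 : int) (K : fieldExtType rat) (s1 s2 : K) :=
  [/\ s1 ^+ 2 = d1%:~R, s2 ^+ 2 = d2%:~R & <<1 & [:: s1; s2]>>%VS = fullv].

Lemma biquadratic_exists (d1 d2 : int) :
  exists (K : fieldExtType rat) (s1 s2 : K), is_biquadratic d1 d2 s1 s2.
Proof.
have [K [f [s def_s genK]]] :=
  num_field_exists [:: sqrtC (d1%:~R : algC); sqrtC (d2%:~R : algC)].
case: s def_s genK => [|s1 [|s2 [|? ?]]] //= [fs1 fs2] genK.
exists K, s1, s2; split=> //; apply: (fmorph_inj f).
  by rewrite rmorphXn /= fs1 sqrtCK rmorph_int.
by rewrite rmorphXn /= fs2 sqrtCK rmorph_int.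
Qed.

Section Conditions.
Variables (d1 d2 : int) (p q : nat).

Definition both_disc_residues (l : nat) : Prop :=
  legendre (quad_disc d1) l = 1 /\ legendre (quad_disc d2) l = 1.

Definition both_1_mod_8 : Prop :=
  (d1 = 1 %[mod 8])%Z /\ (d2 = 1 %[mod 8])%Z.

Definition condition1 : Prop :=
  [/\ odd p, odd q & p <> q] /\
  [/\ legendre p q = -1,
      (p = 1 %[mod 4])%N \/ (q = 1 %[mod 4])%N
    & both_disc_residues p \/ both_disc_residues q].

Definition condition2 : Prop :=
  [/\ q = 2%N,
      (p = 3 %[mod 8])%N \/ (p = 5 %[mod 8])%N
    & both_disc_residues p \/ both_1_mod_8].

Definition condition3 : Prop :=
  [/\ odd p, odd q, (p = 3 %[mod 4])%N, (q = 3 %[mod 4])%N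
    & (legendre q p <> 1 /\ (both_disc_residues p \/ both_1_mod_8))
      \/ (legendre p q <> 1 /\ (both_disc_residues q \/ both_1_mod_8))].

Definition conditions : Prop := [\/ condition1, condition2 | condition3].

End Conditions.

(* Main.v *)
(* The theorem follows from a local criterion: H_K(p, q) is a division algebra if
   and only if some prime v ramified in H_Q(p, q) splits completely in K, that is,
   d1 and d2 are squares in Q_v.  If there is such a v, the norm form of H_Q(p, q)
   is anisotropic over Q_v, hence over K, which embeds into Q_v; concretely, a zero
   over K is reduced modulo all powers of v by the Hensel approximations of
   sqrt d1 and sqrt d2.  Otherwise reciprocity leaves at most two ramified primes,
   and one of d1, d2, d1 d2, say d, is a nonsquare at both.  Then Q(sqrt d) splits
   the algebra: Legendre's theorem reduces this to finding an integer u such that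
   (p u, q) and (u, d q) have trivial Hilbert symbols everywhere, and u comes from
   the existence of a prime with prescribed quadratic characters.  The last fact is
   Dirichlet's theorem for real characters only, which needs just the nonvanishing
   of L(1, chi) for real chi and Mertens' estimates. *)
Require Import Defs.
From mathcomp Require Import all_boot all_order all_algebra all_field.
From mathcomp Require Import cyclic Rstruct ring lra zify.

Set Implicit Arguments.
Unset Strict Implicit.
Unset Printing Implicit Defensive.

Import Order.TTheory GRing.Theory Num.Theory.
Local Open Scope ring_scope.

(** * Sums and the series L(1, chi) *)

(** Why such a u works: triviality of (p u, q) identifies (p, q) with (u, q), and over Q(sqrt d) the
    slots q and d q agree up to a square, so triviality of (u, d q) splits (u, q). In terms of
    symbols, (u, q) and (u, d) must both agree with (p, q) at every prime. At a ramified prime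
    neither q nor d is a local square, so these are two nonzero F_2-linear forms in the class of u,
    and they take the value 1 together. Only classes modulo squares are prescribed for u, and real
    characters detect these; for a real character the divisor sums are nonnegative, which yields the
    nonvanishing of L(1, chi) by elementary inequalities.

    No completion Q_v is constructed. A symbol is a Boolean expression in the square classes, so
    bilinearity and nondegeneracy are finite checks. Solvability enters through a descent over the
    integers, anisotropy through divisibility by a fixed power of v. A zero over K is tested under
    all sign choices for the approximate roots, since one evaluation does not separate its four
    coordinates. *)

Section Sums.
Variable F : rcfType.
Implicit Types (w f : nat -> F) (a b n N : nat).

Lemma abel_bound (c w : nat -> F) (M : F) a b : (a <= b)%N ->
  (forall n, (a <= n)%N -> `|\sum_(a <= i < n) c i| <= M) ->
  (forall n, (a <= n < b)%N -> w n.+1 <= w n) -> 0 <= w b ->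
  `|\sum_(a <= i < b) c i * w i| <= M * w a.
Proof.
move=> leab cM; elim: b leab => [|b IHb].
  rewrite leqn0 => /eqP -> _ w0; rewrite big_geq // normr0 mulr_ge0 //.
  by apply: le_trans (cM _ (leqnn _)).
rewrite leq_eqVlt => /orP[/eqP <- _ w0|ltab w_mono w0].
  by rewrite big_geq // normr0 mulr_ge0 //; apply: le_trans (cM _ (leqnn _)).
(* The induction needs the boundary term subtracted: the rest is at most [M] times the drop of [w],
   and the drops telescope. *)
suff main n : (a <= n <= b.+1)%N ->
  `|\sum_(a <= i < n) c i * w i - (\sum_(a <= i < n) c i) * w n|
    <= M * (w a - w n).
  have lea : (a <= b.+1)%N by lia.
  have /main : (a <= b.+1 <= b.+1)%N by lia.
  have := cM _ lea; set S := \sum_(a <= i < b.+1) c i; set T := \sum_(_ <= i < _) _.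
  move=> SM TM; rewrite -(subrK (S * w b.+1) T).
  apply: le_trans (ler_normD _ _) _.
  rewrite normrM (ger0_norm w0); have := ler_wpM2r w0 SM; lra.
elim: n => [|n IHn] /andP[].
  by rewrite leqn0 => /eqP -> _; rewrite !big_geq // mul0r subrr normr0 subrr mulr0.
rewrite leq_eqVlt => /orP[/eqP <- _|lean ltnb].
  by rewrite !big_geq // mul0r subrr normr0 subrr mulr0.
have {}lean : (a <= n)%N by [].
have /IHn {}IHn : (a <= n <= b.+1)%N by lia.
have := cM _ (leqW lean); rewrite !big_nat_recr //=.
set S := \sum_(a <= i < n) c i in IHn *; set T := \sum_(a <= i < n) c i * w i in IHn *.
move=> SM.
have -> : T + c n * w n - (S + c n) * w n.+1 =
          (T - S * w n) + (S + c n) * (w n - w n.+1) by ring.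
apply: le_trans (ler_normD _ _) _.
have dw : 0 <= w n - w n.+1 by rewrite subr_ge0 w_mono; lia.
rewrite normrM (ger0_norm dw); have := ler_wpM2r dw SM; lra.
Qed.

Lemma sum_multiples (f : nat -> F) b N : (0 < b)%N ->
  \sum_(1 <= n < N.+1 | (b %| n)%N) f n = \sum_(1 <= a < (N %/ b).+1) f (a * b)%N.
Proof.
move=> b_gt0; elim: N => [|N IHN]; first by rewrite div0n !big_geq.
rewrite big_mkcond big_nat_recr //= -big_mkcond IHN divnS //.
case: ifP => bN; last by rewrite addr0.
rewrite add1n [RHS]big_nat_recr //=; congr (_ + f _).
by rewrite -[(N %/ b).+1]add1n -[1%N]/(nat_of_bool true) -bN -divnS // divnK.
Qed.

Lemma sum_le_div (f : nat -> F) b N M : (0 < b)%N -> (N <= M)%N ->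
  \sum_(1 <= a < M.+1 | (a * b <= N)%N) f a = \sum_(1 <= a < (N %/ b).+1) f a.
Proof.
move=> b_gt0 leNM.
rewrite [RHS](big_nat_widen _ _ M.+1); last first.
  by rewrite ltnS; apply: leq_trans (leq_div _ _) leNM.
by apply: eq_bigl => a /=; rewrite ltnS leq_divRL.
Qed.

Lemma sum_divisors (f : nat -> nat -> F) N :
  \sum_(1 <= n < N.+1) \sum_(1 <= b < N.+1 | (b %| n)%N) f b (n %/ b)%N =
  \sum_(1 <= b < N.+1) \sum_(1 <= a < (N %/ b).+1) f b a.
Proof.
rewrite (exchange_big_dep_nat xpredT) //=; apply: eq_big_nat => b /andP[b_gt0 _].
rewrite (sum_multiples (fun n => f b (n %/ b)%N)) //; apply: eq_bigr => a _.
by rewrite mulnK.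
Qed.

(** Both sides run over the pairs with [K < b] and [a * b <= N]. *)
Lemma sum_hyperbola (f : nat -> nat -> F) N K : (K <= N)%N ->
  \sum_(K.+1 <= b < N.+1) \sum_(1 <= a < (N %/ b).+1) f b a =
  \sum_(1 <= a < N.+1) \sum_(K.+1 <= b < (N %/ a).+1) f b a.
Proof.
move=> leKN.
transitivity (\sum_(K.+1 <= b < N.+1) \sum_(1 <= a < N.+1 | (a * b <= N)%N) f b a).
  by apply: eq_big_nat => b /andP[b_gt0 _]; rewrite sum_le_div //; lia.
rewrite (exchange_big_dep_nat xpredT) //=; apply: eq_big_nat => a /andP[a_gt0 _].
rewrite [RHS](big_nat_widen _ _ N.+1); last by rewrite ltnS leq_div.
by apply: eq_bigl => b /=; rewrite ltnS leq_divRL // mulnC.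
Qed.

Lemma sum_sub_le (f : nat -> F) (g : nat -> nat) K N :
  (forall n, (1 <= n <= N)%N -> 0 <= f n) ->
  {in [pred k | (1 <= k <= K)%N] &, injective g} ->
  (forall k, (1 <= k <= K)%N -> (1 <= g k <= N)%N) ->
  \sum_(1 <= k < K.+1) f (g k) <= \sum_(1 <= n < N.+1) f n.
Proof.
move=> f_ge0 g_inj gN.
rewrite -(big_map g xpredT f).
have uK : uniq (map g (index_iota 1 K.+1)).
  rewrite map_inj_in_uniq ?iota_uniq // => x y; rewrite !mem_index_iota !ltnS.
  exact: g_inj.
have sub : {subset map g (index_iota 1 K.+1) <= index_iota 1 N.+1}.
  move=> _ /mapP[k kK ->]; move: kK; rewrite !mem_index_iota !ltnS; exact: gN.
rewrite [leRHS](bigID (mem (map g (index_iota 1 K.+1)))) /= -[leLHS]addr0.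
apply: lerD; last first.
  rewrite big_seq_cond; apply: sumr_ge0 => n; rewrite mem_index_iota ltnS.
  by move=> /andP[/f_ge0].
rewrite -[leRHS]big_filter le_eqVlt; apply/orP; left; apply/eqP; apply: perm_big.
apply: uniq_perm => //; first by rewrite filter_uniq // iota_uniq.
by move=> n; rewrite mem_filter; case: (boolP (n \in _)) => // /sub ->.
Qed.

End Sums.

Section DivisorSum.
Variables (F : rcfType) (chi : nat -> F).
Hypothesis chiM : forall a b, chi (a * b)%N = chi a * chi b.
Hypothesis chi_val : forall n, [\/ chi n = 0, chi n = 1 | chi n = -1].
Hypothesis chi1 : chi 1 = 1.

(** The Dirichlet convolution of [chi] with 1. It is applied later also to [mangoldt], which is not
    multiplicative. *)
Definition divsum (n : nat) : F := \sum_(1 <= b < n.+1 | (b %| n)%N) chi b.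

Lemma divsum_widen n N : (0 < n <= N)%N ->
  \sum_(1 <= b < N.+1 | (b %| n)%N) chi b = divsum n.
Proof.
move=> /andP[n_gt0 lenN]; rewrite [RHS](big_nat_widen _ _ N.+1) //.
by apply: eq_bigl => b; case: (boolP (b %| n)%N) => //= /(dvdn_leq n_gt0); rewrite ltnS => ->.
Qed.

(** The divisors prime to [r] are those of [n]; the others are [r] times the divisors of
    [r ^ k * n]. *)
Lemma divsum_prime_rec r k n : prime r -> (0 < n)%N -> ~~ (r %| n)%N ->
  divsum (r ^ k.+1 * n) = divsum n + chi r * divsum (r ^ k * n).
Proof.
move=> r_pr n_gt0 rn; have r_gt0 := prime_gt0 r_pr.
have rkn : (0 < r ^ k * n)%N by rewrite muln_gt0 expn_gt0 r_gt0.
rewrite {1}/divsum (bigID (fun b => r %| b)%N) /= addrC; congr (_ + _).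
  rewrite -(@divsum_widen n (r ^ k.+1 * n)) ?n_gt0 ?leq_pmull ?expn_gt0 ?r_gt0 //.
  apply: eq_bigl => b; apply/idP/idP => [/andP[bn rb]|bn].
    have cop : coprime b (r ^ k.+1) by rewrite coprimeXr // coprime_sym prime_coprime.
    by move: bn; rewrite Gauss_dvdr.
  apply/andP; split; first by rewrite dvdn_mull.
  by move: rn; apply: contra => rb; apply: dvdn_trans rb bn.
rewrite expnS -mulnA; set M := (_ * n)%N.
transitivity (\sum_(1 <= b < (r * M).+1 | (r %| b)%N) (if (b %| r * M)%N then chi b else 0)).
  rewrite [LHS]big_mkcond [RHS]big_mkcond; apply: eq_bigr => b _.
  by case: (b %| r * M)%N; case: (r %| b)%N.
rewrite sum_multiples // mulKn // mulr_sumr big_mkcond [RHS]big_mkcond /=.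
apply: eq_bigr => c _; rewrite mulnC dvdn_pmul2l //; case: ifP => //.
Qed.

Lemma divsum_prime_pow r k n : prime r -> (0 < n)%N -> ~~ (r %| n)%N ->
  divsum (r ^ k * n) = (\sum_(i < k.+1) chi r ^+ i) * divsum n.
Proof.
move=> r_pr n_gt0 rn; elim: k => [|k IHk].
  by rewrite expn0 mul1n big_ord1 expr0 mul1r.
rewrite divsum_prime_rec // IHk [in RHS]big_ord_recl expr0 mulrDl mul1r; congr (_ + _).
rewrite mulrA; congr (_ * _); rewrite mulr_sumr; apply: eq_bigr => i _.
by rewrite lift0 exprS.
Qed.

(** These are the local factors of [divsum]. Only the value -1 can push the sum below 1: it then
    alternates between 1 for even [k] and 0 for odd [k], which is why squares are the safe
    arguments. *)
Lemma geom_sum_ge r k :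
  0 <= \sum_(i < k.+1) chi r ^+ i /\ (~~ odd k -> 1 <= \sum_(i < k.+1) chi r ^+ i).
Proof.
case: (chi_val r) => ->.
- rewrite big_ord_recl expr0 big1 ?addr0 ?ler01 // => i _.
  by rewrite lift0 exprS mul0r.
- rewrite (eq_bigr (fun=> 1)) => [|i _]; last by rewrite expr1n.
  by rewrite sumr_const card_ord ler0n -[X in X <= _]/(1%:R) ler_nat.
- suff -> : \sum_(i < k.+1) (-1 : F) ^+ i = (~~ odd k)%:R.
    by split; [rewrite ler0n | move=> ->].
  elim: k => [|k IHk]; first by rewrite big_ord1 expr0.
  rewrite big_ord_recr /= IHk -signr_odd /=.
  by case: (odd k); rewrite /= ?expr0 ?expr1 ?add0r ?subrr.
Qed.

Lemma divsum1 : divsum 1 = 1.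
Proof. by rewrite /divsum big_mkcond big_nat1 dvd1n chi1. Qed.

Lemma split_prime_part n : (1 < n)%N -> exists r k n',
  [/\ prime r, (0 < k)%N, ~~ (r %| n')%N, (0 < n')%N & n = (r ^ k * n')%N].
Proof.
move=> n_gt1; have n_gt0 : (0 < n)%N by lia.
have r_pr := pdiv_prime n_gt1.
have [n' rn' def_n] := pfactor_coprime r_pr n_gt0.
exists (pdiv n), (logn (pdiv n) n), n'; split=> //; last by rewrite mulnC.
- by rewrite logn_gt0 mem_primes r_pr n_gt0 pdiv_dvd.
- by rewrite -prime_coprime.
- by move: n_gt0; rewrite {1}def_n muln_gt0 => /andP[].
Qed.

Lemma split_lt r k n' : prime r -> (0 < k)%N -> (0 < n')%N -> (n' < r ^ k * n')%N.
Proof.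
move=> r_pr k_gt0 n'_gt0; rewrite -[X in (X < _)%N]mul1n ltn_pmul2r //.
by rewrite -(exp1n k) ltn_exp2r // prime_gt1.
Qed.

Lemma divsum_ge0 n : (0 < n)%N -> 0 <= divsum n.
Proof.
elim/ltn_ind: n => n IHn n_gt0; have [n_gt1|] := ltnP 1 n; last first.
  by move=> n1; have -> : n = 1%N by [lia]; rewrite divsum1.
have [r [k [n' [r_pr k_gt0 rn' n'_gt0 def_n]]]] := split_prime_part n_gt1.
rewrite def_n divsum_prime_pow // mulr_ge0 ?(geom_sum_ge r k).1 // IHn //.
by rewrite def_n split_lt.
Qed.

Lemma divsum_square_ge1 n : (0 < n)%N -> 1 <= divsum (n ^ 2).
Proof.
elim/ltn_ind: n => n IHn n_gt0; have [n_gt1|] := ltnP 1 n; last first.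
  by move=> n1; have -> : n = 1%N by [lia]; rewrite exp1n divsum1.
have [r [k [n' [r_pr k_gt0 rn' n'_gt0 def_n]]]] := split_prime_part n_gt1.
rewrite def_n expnMn -expnM divsum_prime_pow ?expn_gt0 ?n'_gt0 //; last first.
  by rewrite Euclid_dvdX // negb_and rn'.
rewrite -[1]mulr1; apply: ler_pM => //; last by rewrite IHn // def_n split_lt.
by apply: (geom_sum_ge r (k * 2)).2; rewrite oddM andbF.
Qed.

End DivisorSum.

(** * Sums of 1/k and of 1/sqrt k *)

Section Harmonic.
Variable F : rcfType.

(** Oresme's grouping: each dyadic block contributes at least 1/2. *)
Lemma harmonic_pow2 k : k%:R / 2 <= \sum_(1 <= j < (2 ^ k).+1) (j%:R^-1 : F).
Proof.
elim: k => [|k IHk]; first by rewrite mul0r big_nat1 invr1 ler01.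
have lt2 : (2 ^ k <= 2 ^ k.+1)%N by rewrite leq_exp2l.
rewrite (big_cat_nat (n := (2 ^ k).+1)) //=.
suff: 2^-1 <= \sum_((2 ^ k).+1 <= j < (2 ^ k.+1).+1) (j%:R^-1 : F).
  by move: IHk; rewrite -[k.+1%:R]natr1; lra.
have p_gt0 : (0 < 2 ^ k)%N by rewrite expn_gt0.
apply: le_trans (_ : \sum_((2 ^ k).+1 <= j < (2 ^ k.+1).+1) ((2 ^ k.+1)%:R^-1 : F) <= _).
  rewrite sumr_const_nat subSS expnS mul2n -addnn addnK addnn -mul2n natrM invfM.
  by rewrite -[leRHS]mulr_natr mulfVK // pnatr_eq0; lia.
apply: ler_sum_nat => j /andP[j1 j2].
by rewrite lef_pV2 ?ler_nat // posrE ltr0n; lia.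
Qed.

Lemma harmonic_unbounded (C : F) (n : nat) : C <= n%:R ->
  exists2 B, (0 < B)%N & C <= \sum_(1 <= j < B.+1) (j%:R^-1 : F).
Proof.
move=> Cn; exists (2 ^ (2 * n))%N; first by rewrite expn_gt0.
by apply: le_trans (harmonic_pow2 _); rewrite natrM mulrC mulKf // pnatr_eq0.
Qed.

Definition sqrt_harmonic (n : nat) : F := \sum_(1 <= k < n.+1) (Num.sqrt k%:R)^-1.
(** This sequence decreases to zeta(1/2); only its monotonicity and explicit bounds on its variation
    are used. *)
Definition sqrt_excess (n : nat) : F := sqrt_harmonic n - 2 * Num.sqrt n%:R.

Lemma le_of_sqr (x y : F) : 0 <= y -> x ^+ 2 <= y ^+ 2 -> x <= y.
Proof. by move=> y0 xy; rewrite leNgt; apply/negP => yx; nra. Qed.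

Lemma sqrt_nat_gt0 k : (0 < k)%N -> 0 < Num.sqrt k%:R :> F.
Proof. by move=> k_gt0; rewrite sqrtr_gt0 ltr0n. Qed.

Lemma sqr_sqrt_nat k : Num.sqrt k%:R ^+ 2 = k%:R :> F.
Proof. by rewrite sqr_sqrtr // ler0n. Qed.

(** With [u] and [v] the square roots of k and k+1, the identity [(v - u) * (v + u) = 1] puts
    [2 * (v - u)] between [v^-1] and [u^-1]. *)
Lemma sqrt_excess_step k : (0 < k)%N ->
  sqrt_excess k - ((Num.sqrt k%:R)^-1 - (Num.sqrt k.+1%:R)^-1)
    <= sqrt_excess k.+1 <= sqrt_excess k.
Proof.
move=> k_gt0; rewrite /sqrt_excess /sqrt_harmonic [\sum_(1 <= _ < k.+2) _]big_nat_recr //=.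
set S := \sum_(_ <= _ < _) _.
have := sqr_sqrt_nat k.+1; have := sqr_sqrt_nat k; rewrite -[k.+1%:R]natr1.
have := sqrt_nat_gt0 k_gt0; have := @sqrt_nat_gt0 k.+1 isT; rewrite -[k.+1%:R]natr1.
set u := Num.sqrt k%:R; set v := Num.sqrt (k%:R + 1) => v0 u0 u2 v2.
have uv : v ^+ 2 = u ^+ 2 + 1 by rewrite u2.
have e1 : (v - u) * (v + u) = 1 by rewrite -subr_sqr uv addrAC subrr add0r.
have vu : u <= v by apply: le_of_sqr; [exact: ltW | rewrite uv; lra].
have a1 : v^-1 <= 2 * (v - u).
  by rewrite -[v^-1]mul1r ler_pdivrMr // -[X in X <= _]e1; nra.
have a2 : 2 * (v - u) <= u^-1.
  by rewrite -[u^-1]mul1r ler_pdivlMr // -[X in _ <= X]e1; nra.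
by apply/andP; split; lra.
Qed.

Lemma sqrt_excess_close y z : (0 < y <= z)%N ->
  sqrt_excess y - ((Num.sqrt y%:R)^-1 - (Num.sqrt z%:R)^-1) <= sqrt_excess z <= sqrt_excess y.
Proof.
move=> /andP[y_gt0]; elim: z => [|z IHz]; first by rewrite leqNgt y_gt0.
rewrite leq_eqVlt => /orP[/eqP <-|]; first by rewrite subrr subr0 lexx.
rewrite ltnS => leyz; have /andP[h1 h2] := IHz leyz.
have z_gt0 : (0 < z)%N by lia.
by have /andP[h3 h4] := sqrt_excess_step z_gt0; apply/andP; split; lra.
Qed.

Lemma sqrt_excess_bounds n : (0 < n)%N -> - 2 <= sqrt_excess n <= - 1.
Proof.
move=> n_gt0; have /andP[] := @sqrt_excess_close 1 n n_gt0.
have : 0 < (Num.sqrt n%:R : F)^-1 by rewrite invr_gt0 sqrt_nat_gt0.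
have -> : sqrt_excess 1 = - 1.
  by rewrite /sqrt_excess /sqrt_harmonic big_nat1 sqrtr1 invr1; lra.
by rewrite sqrtr1 invr1 => *; apply/andP; split; lra.
Qed.

(** The cutoff is a square so that the root of [B ^ 2 / b] is exactly [X = B / sqrt b]. Rounding the
    quotient down to [y] moves [2 * sqrt y] by at most [2 / X], and the excess by at most
    [1 / sqrt y <= 2 / X]. *)
Lemma sqrt_harmonic_approx b B : (0 < b <= B)%N ->
  `|sqrt_harmonic (B ^ 2 %/ b) - (2 * (B%:R / Num.sqrt b%:R) + sqrt_excess (B ^ 2))|
    <= 4 * (Num.sqrt b%:R / B%:R).
Proof.
move=> /andP[b_gt0 lebB]; have B_gt0 : (0 < B)%N by lia.
set y := (B ^ 2 %/ b)%N.
have y_gt0 : (0 < y)%N by rewrite divn_gt0 // expnS expn1; nia.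
have leyN : (y <= B ^ 2)%N by apply: leq_div.
have /andP[h1 h2] : sqrt_excess y - (Num.sqrt y%:R)^-1 <= sqrt_excess (B ^ 2) <= sqrt_excess y.
  have : 0 < (Num.sqrt (B ^ 2)%:R : F)^-1 by rewrite invr_gt0 sqrt_nat_gt0 // expn_gt0 B_gt0.
  have /andP[] := @sqrt_excess_close y (B ^ 2) (introT andP (conj y_gt0 leyN)).
  by move=> *; apply/andP; split; lra.
set t : F := Num.sqrt b%:R; have t0 : 0 < t by exact: sqrt_nat_gt0.
have Bp : 0 < B%:R :> F by rewrite ltr0n.
set X := B%:R / t; have X0 : 0 < X by rewrite divr_gt0.
have -> : t / B%:R = X^-1 by rewrite invf_div.
have X2 : X ^+ 2 * b%:R = (B ^ 2)%:R.
  by rewrite natrX expr_div_n sqr_sqrt_nat mulfVK // pnatr_eq0; lia.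
have bp : 0 < b%:R :> F by rewrite ltr0n.
set s := Num.sqrt y%:R in h1 h2 *; have s0 : 0 < s by exact: sqrt_nat_gt0.
have s2 : s ^+ 2 = y%:R by exact: sqr_sqrt_nat.
have ylow : s ^+ 2 <= X ^+ 2.
  by rewrite -(ler_pM2r bp) X2 s2 -natrM ler_nat leq_divM.
have yup : X ^+ 2 <= s ^+ 2 + 1.
  by rewrite -(ler_pM2r bp) X2 s2 natr1 -natrM ler_nat ltnW // ltn_ceil.
have s1 : 1 <= s ^+ 2 by rewrite s2 -[1]/(1%:R) ler_nat.
have sX : s <= X by apply: le_of_sqr; first exact: ltW.
have Xs : X - s <= X^-1.
  have e : (X - s) * (X + s) <= 1 by rewrite -subr_sqr; lra.
  rewrite -[X^-1]mul1r ler_pdivlMr //; apply: le_trans e.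
  by apply: ler_wpM2l; lra.
have sV : s^-1 <= 2 * X^-1.
  have : X <= 2 * s by apply: le_of_sqr; [lra | have -> : (2 * s) ^+ 2 = 4 * s ^+ 2 by [ring]; lra].
  by move=> X2s; rewrite -[s^-1]mul1r ler_pdivrMr // mulrAC ler_pdivlMr // mul1r.
have XV : 0 < X^-1 by rewrite invr_gt0.
have -> : sqrt_harmonic y = sqrt_excess y + 2 * s by rewrite /sqrt_excess subrK.
by rewrite ler_norml; apply/andP; split; lra.
Qed.

End Harmonic.

(** * Nonvanishing of L(1, chi) for a real nonprincipal character *)

Section NonPrincipal.
Variables (F : rcfType) (chi : nat -> F) (m : nat).
Hypothesis chiM : forall a b, chi (a * b)%N = chi a * chi b.
Hypothesis chi_val : forall n, [\/ chi n = 0, chi n = 1 | chi n = -1].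
Hypothesis chi1 : chi 1 = 1.
Hypothesis m_gt0 : (0 < m)%N.
Hypothesis chi_per : forall n, chi (n + m) = chi n.
Hypothesis chi_sum : \sum_(0 <= n < m) chi n = 0.

Lemma chi_le1 n : `|chi n| <= 1.
Proof. by case: (chi_val n) => ->; rewrite ?normr0 ?normrN ?normr1. Qed.

Lemma chi_prefix_bound n : `|\sum_(0 <= i < n) chi i| <= m%:R.
Proof.
elim/ltn_ind: n => n IHn; have [lenm|ltmn] := leqP n m.
  apply: le_trans (ler_norm_sum _ _ _) _.
  apply: le_trans (_ : \sum_(0 <= i < n) 1 <= _).
    by apply: ler_sum => i _; apply: chi_le1.
  by rewrite sumr_const_nat subn0 ler_nat.
have -> : \sum_(0 <= i < n) chi i = \sum_(0 <= i < n - m) chi i.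
  rewrite (big_cat_nat (n := m)) //= ?(ltnW ltmn) // chi_sum add0r.
  rewrite -{1}[m]add0n big_addn; apply: eq_bigr => i _; exact: chi_per.
by apply: IHn; lia.
Qed.

Lemma chi_sum_bound a n : (a <= n)%N -> `|\sum_(a <= i < n) chi i| <= (2 * m)%:R.
Proof.
move=> lean; have := chi_prefix_bound n; have := chi_prefix_bound a.
rewrite (big_cat_nat (n := a) (p := n)) //=.
set A := \sum_(0 <= i < a) chi i; set T := \sum_(_ <= _ < n) _ => hA hAT.
rewrite (_ : T = A + T - A); last by ring.
by apply: le_trans (ler_normB _ _) _; rewrite natrM; lra.
Qed.

Lemma chi_abel (w : nat -> F) a n :
  (forall k, (a <= k)%N -> w k.+1 <= w k) -> (forall k, 0 <= w k) ->
  `|\sum_(a <= i < n) chi i * w i| <= (2 * m)%:R * w a.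
Proof.
move=> w_mono w_ge0; have [lean|ltna] := leqP a n; last first.
  by rewrite big_geq ?(ltnW ltna) // normr0 mulr_ge0.
by apply: abel_bound => // [k|k /andP[ak _]]; [apply: chi_sum_bound | apply: w_mono].
Qed.

Definition chi_series (n : nat) : F := \sum_(1 <= b < n.+1) chi b / b%:R.

Lemma chi_series_close y N : (y <= N)%N ->
  `|chi_series N - chi_series y| <= (2 * m)%:R / y.+1%:R.
Proof.
move=> leyN; rewrite /chi_series (big_cat_nat (n := y.+1)) //= addrAC subrr add0r.
apply: (chi_abel (w := fun b => b%:R^-1)) => [k yk|k]; last by rewrite invr_ge0 ler0n.
by rewrite lef_pV2 ?ler_nat // posrE ltr0n; lia.
Qed.

Lemma sqrt_inv_mono k : (0 < k)%N ->
  (Num.sqrt k.+1%:R)^-1 <= (Num.sqrt k%:R)^-1 :> F.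
Proof.
move=> k_gt0; have s1 := sqrt_nat_gt0 F k_gt0; have s2 := @sqrt_nat_gt0 F k.+1 isT.
by rewrite lef_pV2 //; apply: ler_wsqrtr; rewrite ler_nat.
Qed.

Lemma sqrt_inv_ge0 k : 0 <= (Num.sqrt k%:R)^-1 :> F.
Proof. by rewrite invr_ge0 sqrtr_ge0. Qed.

(** First half of the hyperbola method, where L(1, chi) appears. The constant [h], of size at most
    2, multiplies a character sum of size at most [2 * m], which gives [4 * m]; each of the [B]
    approximation errors is at most [4 / B], which gives 4. *)
Lemma small_divisor_sum B : (0 < B)%N ->
  `|\sum_(1 <= b < B.+1) chi b / Num.sqrt b%:R * sqrt_harmonic F (B ^ 2 %/ b)
     - 2 * B%:R * chi_series B| <= 4 * m%:R + 4.
Proof.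
move=> B_gt0; set h := sqrt_excess F (B ^ 2).
pose e b := sqrt_harmonic F (B ^ 2 %/ b) - (2 * (B%:R / Num.sqrt b%:R) + h).
have -> : \sum_(1 <= b < B.+1) chi b / Num.sqrt b%:R * sqrt_harmonic F (B ^ 2 %/ b)
     - 2 * B%:R * chi_series B =
  h * \sum_(1 <= b < B.+1) chi b * (Num.sqrt b%:R)^-1 +
  \sum_(1 <= b < B.+1) chi b * ((Num.sqrt b%:R)^-1 * e b).
  rewrite /chi_series !mulr_sumr -sumrB -big_split /=; apply: eq_big_nat => b /andP[b_gt0 _].
  have sb := sqrt_nat_gt0 F b_gt0; rewrite /e -(sqr_sqrt_nat F b) sqrtr_sqr gtr0_norm //.
  by field; rewrite gt_eqF.
apply: le_trans (ler_normD _ _) _; apply: lerD.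
  rewrite normrM; have hb : `|h| <= 2.
    have B2 : (0 < B ^ 2)%N by rewrite expn_gt0 B_gt0.
    by have := sqrt_excess_bounds F B2; rewrite -/h => /andP[h1 h2];
      rewrite ler_norml; apply/andP; split; lra.
  have := @chi_abel (fun b => (Num.sqrt b%:R)^-1) 1 B.+1 sqrt_inv_mono sqrt_inv_ge0.
  rewrite sqrtr1 invr1 natrM => hs.
  have := normr_ge0 h; have := ler0n F m; set s := `|_| in hs *; have := ler_pM (normr_ge0 h) (normr_ge0 _) hb hs.
  rewrite -/s; lra.
apply: le_trans (ler_norm_sum _ _ _) _.
apply: le_trans (_ : \sum_(1 <= b < B.+1) 4 / B%:R <= _); last first.
  by rewrite sumr_const_nat subSS subn0 -[leLHS]mulr_natr mulfVK // pnatr_eq0; lia.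
apply: ler_sum_nat => b /andP[b_gt0 bB].
have /(sqrt_harmonic_approx F) : (0 < b <= B)%N by lia.
rewrite -/h -/(e b) => eb; rewrite !normrM; have sb := sqrt_nat_gt0 F b_gt0.
rewrite (ger0_norm (sqrt_inv_ge0 b)) mulrA.
have c1 : `|chi b| / Num.sqrt b%:R <= (Num.sqrt b%:R)^-1.
  by rewrite -[leRHS]mul1r ler_wpM2r ?sqrt_inv_ge0 ?chi_le1.
apply: le_trans (ler_pM _ (normr_ge0 _) c1 eb) _; first by rewrite mulr_ge0 ?sqrt_inv_ge0.
rewrite le_eqVlt; apply/orP; left; apply/eqP.
have Bn : B%:R != 0 :> F by rewrite pnatr_eq0; lia.
by field; rewrite Bn gt_eqF.
Qed.

(** After exchanging the sums only [a <= B] survives. Abel summation bounds each inner sum over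
    [b > B] by [2 * m / sqrt (B + 1)], and [sqrt_harmonic B] is at most [2 * sqrt (B + 1)]. *)
Lemma large_divisor_sum B : (0 < B)%N ->
  `|\sum_(B.+1 <= b < (B ^ 2).+1) chi b / Num.sqrt b%:R * sqrt_harmonic F (B ^ 2 %/ b)|
    <= 4 * m%:R.
Proof.
move=> B_gt0.
have leB : (B <= B ^ 2)%N by rewrite expnS expn1; nia.
have -> : \sum_(B.+1 <= b < (B ^ 2).+1) chi b / Num.sqrt b%:R * sqrt_harmonic F (B ^ 2 %/ b)
  = \sum_(B.+1 <= b < (B ^ 2).+1) \sum_(1 <= a < (B ^ 2 %/ b).+1)
      (Num.sqrt a%:R)^-1 * (chi b * (Num.sqrt b%:R)^-1).
  apply: eq_bigr => b _; rewrite mulr_sumr; apply: eq_bigr => a _; rewrite mulrC; ring.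
rewrite (sum_hyperbola (fun b a => (Num.sqrt a%:R)^-1 * (chi b * (Num.sqrt b%:R)^-1))) //.
rewrite (big_cat_nat (n := B.+1)) //= [X in _ + X]big_nat_cond [X in _ + X]big1 ?addr0; last first.
  move=> a /andP[/andP[Ba _] _]; rewrite big_geq // ltnS.
  by rewrite -ltnS ltn_divLR; [rewrite expnS expn1; nia | lia].
apply: le_trans (ler_norm_sum _ _ _) _.
apply: le_trans (_ : \sum_(1 <= a < B.+1)
   (Num.sqrt a%:R)^-1 * ((2 * m)%:R * (Num.sqrt B.+1%:R)^-1) <= _).
  apply: ler_sum => a _; rewrite -mulr_sumr normrM (ger0_norm (sqrt_inv_ge0 a)).
  apply: ler_wpM2l; first exact: sqrt_inv_ge0.
  apply: (chi_abel (w := fun b => (Num.sqrt b%:R)^-1)) => [k Bk|k]; last exact: sqrt_inv_ge0.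
  by apply: sqrt_inv_mono; lia.
rewrite -mulr_suml -/(sqrt_harmonic F B).
have /(sqrt_excess_bounds F) /andP[_] := B_gt0; rewrite /sqrt_excess.
have : Num.sqrt B%:R <= Num.sqrt B.+1%:R :> F by apply: ler_wsqrtr; rewrite ler_nat.
have s0 : 0 < Num.sqrt B.+1%:R :> F by exact: sqrt_nat_gt0.
set s := Num.sqrt B.+1%:R in s0 *; set H := sqrt_harmonic F B => s1 s2.
rewrite mulrA ler_pdivrMr // natrM; have := ler0n F m; set M : F := m%:R => M0.
have : H <= 2 * s by lra.
by move=> /(ler_wpM2r M0); lra.
Qed.

(* The divisor sum [\sum_(b %| n) chi b] is nonnegative and at least 1 on
   squares, so weighting it by [n^(-1/2)] gives a harmonic lower bound. *)
Lemma chi_series_lower B : (0 < B)%N ->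
  \sum_(1 <= j < B.+1) (j%:R^-1 : F) - (8 * m%:R + 4) <= 2 * B%:R * chi_series B.
Proof.
move=> B_gt0; have leB : (B <= B ^ 2)%N by rewrite expnS expn1; nia.
have [P1 P2] := (small_divisor_sum B_gt0, large_divisor_sum B_gt0).
pose D := \sum_(1 <= n < (B ^ 2).+1) divsum chi n * (Num.sqrt n%:R)^-1.
have defD : D = \sum_(1 <= b < (B ^ 2).+1)
     chi b / Num.sqrt b%:R * sqrt_harmonic F (B ^ 2 %/ b).
  transitivity (\sum_(1 <= b < (B ^ 2).+1) \sum_(1 <= a < (B ^ 2 %/ b).+1)
      (chi b * (Num.sqrt b%:R)^-1 * (Num.sqrt a%:R)^-1)); last first.
    by apply: eq_bigr => b _; rewrite mulr_sumr.
  rewrite -(sum_divisors (fun b a => chi b * (Num.sqrt b%:R)^-1 * (Num.sqrt a%:R)^-1)).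
  apply: eq_big_nat => n /andP[n_gt0 nN].
  rewrite -(@divsum_widen _ _ n (B ^ 2)) ?n_gt0 // mulr_suml.
  apply: eq_bigr => b bn; rewrite -mulrA -invfM -sqrtrM ?ler0n // -natrM.
  by rewrite mulnC divnK.
have : \sum_(1 <= j < B.+1) (j%:R^-1 : F) <= D.
  pose f n := divsum chi n * (Num.sqrt n%:R)^-1.
  apply: le_trans (@sum_sub_le F f (fun k => k ^ 2)%N B (B ^ 2) _ _ _).
  - apply: ler_sum_nat => k /andP[k_gt0 _].
    rewrite /f natrX sqrtr_sqr ger0_norm ?ler0n // -[leLHS]mul1r ler_wpM2r ?invr_ge0 ?ler0n //.
    exact: divsum_square_ge1.
  - move=> n /andP[n_gt0 _]; rewrite /f mulr_ge0 ?sqrt_inv_ge0 //; exact: divsum_ge0.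
  - by move=> x y _ _ /eqP; rewrite eqn_exp2r // => /eqP.
  - by move=> k /andP[k_gt0 kB]; rewrite expn_gt0 k_gt0 leq_exp2r.
rewrite defD [X in _ <= X -> _](big_cat_nat (n := B.+1)) //=.
move: P1 P2; rewrite !ler_norml => /andP[_ P1] /andP[_ P2]; lra.
Qed.

(** Nonvanishing is stated for the late partial sums, so the value L(1, chi) never has to exist as a
    limit. With harmonic sum at least [12 * m + 5], [2 * B * chi_series B] is at least [4 * m + 1];
    the tail beyond [B] costs at most [4 * m] and leaves 1. *)
Lemma chi_series_away0 : exists2 d : F, 0 < d &
  exists N0, forall N, (N0 <= N)%N -> d <= chi_series N.
Proof.
have hC : 12 * m%:R + 5 <= (12 * m + 5)%:R :> F by rewrite natrD natrM.
have [B B_gt0 hB] := harmonic_unbounded hC.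
have Bp : 0 < B%:R :> F by rewrite ltr0n.
exists (2 * B%:R)^-1; first by rewrite invr_gt0 mulr_gt0.
exists B => N leBN; rewrite -[leLHS]mul1r ler_pdivrMr ?mulr_gt0 //.
have := chi_series_close leBN; rewrite ler_norml => /andP[h1 _].
have : (2 * m)%:R / B.+1%:R <= 2 * m%:R / B%:R :> F.
  rewrite natrM ler_wpM2l ?mulr_ge0 ?ler0n // lef_pV2 ?posrE ?ltr0n // ler_nat //.
have low := chi_series_lower B_gt0.
have e : 2 * m%:R / B%:R * B%:R = 2 * m%:R :> F by rewrite mulfVK // gt_eqF.
set q := _ / _ in h1 *; move=> h2.
have h3 : chi_series B - 2 * m%:R / B%:R <= chi_series N by lra.
have := ler_wpM2r (ltW Bp) h3; rewrite mulrBl e; lra.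
Qed.

End NonPrincipal.

(** * Chebyshev and Mertens estimates for an abstract logarithm *)

Section Mangoldt.
Variables (F : rcfType) (lg : nat -> F).
Hypothesis lgM : forall a b, (0 < a)%N -> (0 < b)%N -> lg (a * b)%N = lg a + lg b.
Hypothesis lg_incr : forall n, (0 < n)%N -> n.+1%:R^-1 <= lg n.+1 - lg n <= n%:R^-1.

Lemma lg1 : lg 1 = 0.
Proof. by have := lgM (isT : 0 < 1)%N (isT : 0 < 1)%N; rewrite muln1; lra. Qed.

Lemma lg_mono n : (0 < n)%N -> lg n <= lg n.+1.
Proof.
move=> /lg_incr /andP[h _]; rewrite -subr_ge0; apply: le_trans h.
by rewrite invr_ge0 ler0n.
Qed.

Lemma lg_ge0 n : (0 < n)%N -> 0 <= lg n.
Proof.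
elim: n => // n IHn _; have [->|n_gt0] := posnP n; first by rewrite lg1.
by apply: le_trans (IHn n_gt0) (lg_mono n_gt0).
Qed.

Lemma lg_le n : (0 < n)%N -> lg n <= n%:R - 1.
Proof.
elim: n => // n IHn _; have [->|n_gt0] := posnP n; first by rewrite lg1 subrr.
have /andP[_ h] := lg_incr n_gt0; rewrite -natr1.
have : n%:R^-1 <= 1 :> F by rewrite invf_le1 ?ltr0n // ler1n.
have := IHn n_gt0; lra.
Qed.

Lemma lg_le_mono a b : (0 < a <= b)%N -> lg a <= lg b.
Proof.
move=> /andP[a_gt0]; elim: b => [|b IHb]; first by rewrite leqNgt a_gt0.
rewrite leq_eqVlt => /orP[/eqP -> //|]; rewrite ltnS => leab.
by apply: le_trans (IHb leab) (lg_mono _); lia.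
Qed.

(** The increments give only 5/6 at 3, so 4 is the first integer where they guarantee the value 1;
    from there [lg n / n] decreases. *)
Lemma lg4_ge1 : 1 <= lg 4.
Proof.
have := @lgM 2 2 isT isT; rewrite -[(2 * 2)%N]/4%N => ->.
by have /andP[h _] := @lg_incr 1 isT; rewrite lg1 in h; lra.
Qed.

Lemma lgX r k : (0 < r)%N -> lg (r ^ k) = k%:R * lg r.
Proof.
move=> r_gt0; elim: k => [|k IHk]; first by rewrite expn0 lg1 mul0r.
by rewrite expnS lgM ?expn_gt0 ?r_gt0 // IHk -natr1; ring.
Qed.

Definition mangoldt (n : nat) : F :=
  if (1 < n)%N && (n == pdiv n ^ logn (pdiv n) n)%N then lg (pdiv n) else 0.

Lemma mangoldt_ge0 n : 0 <= mangoldt n.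
Proof. by rewrite /mangoldt; case: ifP => // _; rewrite lg_ge0 // pdiv_gt0. Qed.

Lemma mangoldt_prime_pow r k : prime r -> (0 < k)%N -> mangoldt (r ^ k) = lg r.
Proof.
case: k => // k r_pr _; rewrite /mangoldt pdiv_pfactor // pfactorK // eqxx andbT.
by rewrite -{1}(exp1n k.+1) ltn_exp2r // prime_gt1.
Qed.

Lemma mangoldt_neq0 n : mangoldt n != 0 ->
  exists r k, [/\ prime r, (0 < k)%N & n = (r ^ k)%N].
Proof.
rewrite /mangoldt; case: ifP => [/andP[n_gt1 /eqP def_n] _|]; last by rewrite eqxx.
exists (pdiv n), (logn (pdiv n) n); split=> //; first exact: pdiv_prime.
by rewrite logn_gt0 mem_primes pdiv_prime // pdiv_dvd; lia.
Qed.

Lemma mangoldt1 : mangoldt 1 = 0. Proof. by []. Qed.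

Lemma mangoldt_le n : (0 < n)%N -> mangoldt n <= lg n.
Proof.
move=> n_gt0; have [->|/mangoldt_neq0[r [k [r_pr k_gt0 ->]]]] := eqVneq (mangoldt n) 0.
  exact: lg_ge0.
have r_gt0 := prime_gt0 r_pr; rewrite mangoldt_prime_pow // lg_le_mono // r_gt0.
by rewrite -{1}[r]expn1 leq_exp2l // prime_gt1.
Qed.

(** Passing from [M] to [r * M] creates exactly one new prime power divisor, [r] to the power
    [logn r M + 1]. *)
Lemma divsum_mangoldt_prime r M : prime r -> (0 < M)%N ->
  divsum mangoldt (r * M) = divsum mangoldt M + lg r.
Proof.
move=> r_pr M_gt0; have r_gt0 := prime_gt0 r_pr.
rewrite {1}/divsum (bigID (fun b => b %| M)%N) /=; congr (_ + _).
  rewrite -(@divsum_widen _ _ M (r * M)) ?M_gt0 ?leq_pmull //.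
  by apply: eq_bigl => b; case: (boolP (b %| M)%N) => bM; rewrite ?andbF // andbT dvdn_mull.
set e := logn r M; pose b0 := (r ^ e.+1)%N.
have b0_gt0 : (0 < b0)%N by rewrite expn_gt0 r_gt0.
have b0rM : (b0 %| r * M)%N by rewrite /b0 expnS dvdn_pmul2l // pfactor_dvdnn.
have b0M : ~~ (b0 %| M)%N by rewrite pfactor_dvdn // -ltnNge ltnSn.
rewrite big_mkcond (bigD1_seq b0) ?iota_uniq //=; last first.
  by rewrite mem_index_iota b0_gt0 ltnS dvdn_leq // muln_gt0 r_gt0.
rewrite b0rM b0M /= mangoldt_prime_pow // big1 ?addr0 // => b b_neq.
case: ifP => // /andP[brM bM]; apply/eqP; apply: contraNT b_neq.
move=> /mangoldt_neq0[s [k [s_pr k_gt0 def_b]]].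
have rM_gt0 : (0 < r * M)%N by rewrite muln_gt0 r_gt0.
move: brM bM; rewrite def_b !pfactor_dvdn // lognM // logn_prime //.
case: eqVneq => [->|_] /=; last by rewrite add0n => ->.
by rewrite /b0 -/e => h1 h2; apply/eqP; congr (_ ^ _)%N; lia.
Qed.

Lemma divsum_mangoldt n : (0 < n)%N -> divsum mangoldt n = lg n.
Proof.
elim/ltn_ind: n => n IHn n_gt0; have [n_gt1|n_le1] := ltnP 1 n; last first.
  have -> : n = 1%N by lia.
  by rewrite /divsum big_mkcond big_nat1 dvd1n mangoldt1 lg1.
have r_pr := pdiv_prime n_gt1; have r_gt1 := prime_gt1 r_pr.
have def_n : n = (pdiv n * (n %/ pdiv n))%N by rewrite mulnC divnK // pdiv_dvd.
have M_gt0 : (0 < n %/ pdiv n)%N by rewrite divn_gt0 ?pdiv_gt0 // pdiv_leq.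
rewrite {1}def_n divsum_mangoldt_prime // IHn //; last by rewrite ltn_Pdiv.
by rewrite [in RHS]def_n lgM // addrC.
Qed.

Definition lgfact N : F := \sum_(1 <= n < N.+1) lg n.

(** Legendre's formula for the logarithm of N!, from [divsum_mangoldt] by exchanging the sums. *)
Lemma lgfactE N : lgfact N = \sum_(1 <= a < N.+1) mangoldt a * (N %/ a)%:R.
Proof.
transitivity (\sum_(1 <= b < N.+1) \sum_(1 <= a < (N %/ b).+1) mangoldt b).
  rewrite -(sum_divisors (fun b _ => mangoldt b)); apply: eq_big_nat => n /andP[n_gt0 nN].
  by rewrite divsum_widen ?n_gt0 // divsum_mangoldt.
by apply: eq_bigr => b _; rewrite sumr_const_nat subn1 mulr_natr.
Qed.

Lemma lgfact_bounds N : (0 < N)%N ->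
  N%:R * lg N - N%:R <= lgfact N <= N%:R * lg N - N%:R + lg N + 1.
Proof.
elim: N => // N IHN _; have [->|N_gt0] := posnP N.
  by rewrite /lgfact big_nat1 lg1; apply/andP; split; lra.
have := IHN N_gt0; rewrite /lgfact [\sum_(1 <= n < N.+2) _]big_nat_recr //= -natr1.
set T := \sum_(_ <= _ < _) _ => /andP[h1 h2].
have /andP[l1 l2] := lg_incr N_gt0; have N0 : 0 < N%:R :> F by rewrite ltr0n.
have N1 : 0 < N%:R + 1 :> F by lra.
have u1 : N%:R * (lg N.+1 - lg N) <= 1.
  by have := ler_wpM2l (ltW N0) l2; rewrite mulfV // gt_eqF.
have u2 : 1 <= (N%:R + 1) * (lg N.+1 - lg N).
  by have := ler_wpM2l (ltW N1) l1; rewrite natr1 mulfV // pnatr_eq0.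
by apply/andP; split; lra.
Qed.

(** Replacing the floors in [lgfactE] by exact quotients enlarges the sum, because [mangoldt] is
    nonnegative. *)
Lemma mertens_lower N : (0 < N)%N ->
  lg N - 1 <= \sum_(1 <= a < N.+1) mangoldt a / a%:R.
Proof.
move=> N_gt0; have N0 : 0 < N%:R :> F by rewrite ltr0n.
have /andP[h _] := lgfact_bounds N_gt0; rewrite -(ler_pM2l N0) mulrBr mulr1.
apply: le_trans h _; rewrite lgfactE mulr_sumr; apply: ler_sum_nat => a /andP[a_gt0 _].
rewrite mulrCA ler_wpM2l ?mangoldt_ge0 // ler_pdivlMr ?ltr0n // -natrM ler_nat.
exact: leq_divM.
Qed.

Definition chebyshev N : F := \sum_(1 <= a < N.+1) mangoldt a.

(** The comparison is with [lgfact (2 * n) - 2 * lgfact n], the logarithm of the central binomial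
    coefficient: there each [a] in (n, 2n] has coefficient 1 and no coefficient is negative. The
    bounds on [lgfact] leave [2 * n * lg 2 + lg (2 * n) + 1]. *)
Lemma chebyshev_double n : (0 < n)%N -> chebyshev (2 * n) - chebyshev n <= 4 * n%:R.
Proof.
move=> n_gt0.
have le2n : (n <= 2 * n)%N by lia.
have -> : chebyshev (2 * n) - chebyshev n = \sum_(n.+1 <= a < (2 * n).+1) mangoldt a.
  by rewrite /chebyshev (big_cat_nat (n := n.+1)) //= addrAC subrr add0r.
have T1 : lgfact n = \sum_(1 <= a < (2 * n).+1) mangoldt a * (n %/ a)%:R.
  rewrite lgfactE [RHS](big_cat_nat (n := n.+1)) //= [X in _ + X]big_nat_cond.
  rewrite [X in _ + X]big1 ?addr0 // => a /andP[/andP[na _] _].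
  by rewrite divn_small // mulr0.
apply: le_trans (_ : lgfact (2 * n) - 2 * lgfact n <= _).
  rewrite T1 lgfactE mulr_sumr -sumrB [leRHS](big_cat_nat (n := n.+1)) //=.
  rewrite -[leLHS]add0r; apply: lerD.
    rewrite big_nat_cond; apply: sumr_ge0 => a /andP[/andP[a_gt0 _] _];
      rewrite mulrCA -mulrBr mulr_ge0 ?mangoldt_ge0 //.
    by rewrite subr_ge0 -natrM ler_nat leq_divRL // -mulnA leq_mul2l leq_divM.
  apply: ler_sum_nat => a /andP[na an]; rewrite [(n %/ a)%N]divn_small // !mulr0 subr0.
  rewrite -[leLHS]mulr1 ler_wpM2l ?mangoldt_ge0 // ler1n divn_gt0; lia.
have n2_gt0 : (0 < 2 * n)%N by lia.
have /andP[_ h1] := lgfact_bounds n2_gt0; have /andP[h2 _] := lgfact_bounds n_gt0.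
have := lg_le n2_gt0; have := @lg_le 2 isT; move: h1; rewrite lgM // natrM.
have n0 : 0 < n%:R :> F by rewrite ltr0n.
by move=> h1 h3 h4; have := ler_wpM2l (ltW n0) h3; lra.
Qed.

(** Induction by halving. The constant 6 absorbs [4 * n] from the doubling and, for odd [N], up to
    [2 * n] from the last term. *)
Lemma chebyshev_le N : chebyshev N <= 6 * N%:R.
Proof.
elim/ltn_ind: N => N IHN; have [N_gt1|N_le1] := ltnP 1 N; last first.
  case: N N_le1 {IHN} => [|[|//]] _; first by rewrite /chebyshev big_geq ?mulr0.
  by rewrite /chebyshev big_nat1 mangoldt1 mulr1 ler0n.
pose n := (N./2)%N; have n_gt0 : (0 < n)%N by rewrite /n; lia.
have /IHN {}IHN : (n < N)%N by rewrite /n; lia.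
have := chebyshev_double n_gt0.
have n1 : 1 <= n%:R :> F by rewrite ler1n.
have [oddN|evenN] := boolP (odd N).
  have def_N : N = (2 * n).+1 by rewrite /n; lia.
  rewrite def_N /chebyshev [\sum_(1 <= a < (2 * n).+2) _]big_nat_recr //=.
  have l0 : (0 < (2 * n).+1)%N by [].
  have := le_trans (mangoldt_le l0) (lg_le l0); rewrite -natr1 natrM.
  rewrite /chebyshev in IHN *; lra.
have def_N : N = (2 * n)%N by rewrite /n; lia.
by rewrite {1 2}def_N natrM; lra.
Qed.

End Mangoldt.

(** * Mertens' estimate twisted by a real character *)

Section MertensCharacter.
Variables (F : rcfType) (lg : nat -> F) (chi : nat -> F) (m : nat).
Hypothesis lgM : forall a b, (0 < a)%N -> (0 < b)%N -> lg (a * b)%N = lg a + lg b.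
Hypothesis lg_incr : forall n, (0 < n)%N -> n.+1%:R^-1 <= lg n.+1 - lg n <= n%:R^-1.
Hypothesis chiM : forall a b, chi (a * b)%N = chi a * chi b.
Hypothesis chi_val : forall n, [\/ chi n = 0, chi n = 1 | chi n = -1].
Hypothesis chi1 : chi 1 = 1.
Hypothesis m_gt0 : (0 < m)%N.
Hypothesis chi_per : forall n, chi (n + m) = chi n.
Hypothesis chi_sum : \sum_(0 <= n < m) chi n = 0.

Lemma lg_ratio_decr n : (4 <= n)%N -> lg n.+1 / n.+1%:R <= lg n / n%:R.
Proof.
move=> n4; have n_gt0 : (0 < n)%N by lia.
have n0 : 0 < n%:R :> F by rewrite ltr0n.
have n1 : 0 < n.+1%:R :> F by rewrite ltr0n.
have /andP[_ h] := lg_incr n_gt0; have := ler_wpM2l (ltW n0) h.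
rewrite mulfV ?gt_eqF // => h1.
have h2 : 1 <= lg n by apply: le_trans (lg4_ge1 lgM lg_incr) (lg_le_mono lg_incr _).
rewrite ler_pdivrMr // mulrAC ler_pdivlMr // -natr1; lra.
Qed.

(** The three terms before 4 give the 3; from 4 on the weights decrease, and Abel summation gives
    [2 * m]. *)
Lemma chi_lg_sum_bound N :
  `|\sum_(1 <= n < N.+1) chi n * (lg n / n%:R)| <= 2 * m%:R + 3.
Proof.
have lgn_le1 n : (0 < n)%N -> `|chi n * (lg n / n%:R)| <= 1.
  move=> n_gt0; have n0 : 0 < n%:R :> F by rewrite ltr0n.
  have h0 := lg_ge0 lgM lg_incr n_gt0; have h1 := lg_le lgM lg_incr n_gt0.
  rewrite normrM -[leRHS]mulr1; apply: ler_pM => //; first exact: chi_le1.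
  by rewrite ger0_norm ?divr_ge0 ?ler0n // ler_pdivrMr // mul1r; lra.
have small K : (K <= 4)%N -> `|\sum_(1 <= n < K) chi n * (lg n / n%:R)| <= 3.
  move=> K4; apply: le_trans (ler_norm_sum _ _ _) _.
  apply: le_trans (_ : \sum_(1 <= n < K) 1 <= _).
    by apply: ler_sum_nat => n /andP[n_gt0 _]; apply: lgn_le1.
  by rewrite sumr_const_nat ler_nat; lia.
have m0 := ler0n F m.
have [N3|N4] := leqP N 3; first by apply: le_trans (small _ _) _; [lia | lra].
rewrite (big_cat_nat (n := 4)) //= ?(leqW N4) //; apply: le_trans (ler_normD _ _) _.
rewrite addrC; apply: lerD; last exact: small.
apply: le_trans (@chi_abel F chi m chi_val m_gt0 chi_per chi_sum
   (fun n => lg n / n%:R) 4 N.+1 lg_ratio_decr _) _.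
  case=> [|k]; first by rewrite invr0 mulr0.
  by rewrite divr_ge0 ?ler0n // (lg_ge0 lgM lg_incr).
rewrite natrM -[leRHS]mulr1 ler_wpM2l ?mulr_ge0 //.
by have := @lg_le F lg lgM lg_incr 4 isT; lra.
Qed.

Definition chi_mangoldt N : F := \sum_(1 <= a < N.+1) chi a * (mangoldt lg a / a%:R).

(** Expanding [lg] as a divisor sum of [mangoldt] gives the bounded sum of [chi_lg_sum_bound] with
    factors [chi_series (N %/ b)]. Replacing these by [chi_series N] costs at most [2 * m * b / N]
    each, in total [12 * m] by [chebyshev_le]. *)
Lemma chi_mangoldt_series_bound N : (0 < N)%N ->
  `|chi_series chi N * chi_mangoldt N| <= 14 * m%:R + 3.
Proof.
move=> N_gt0; have N0 : 0 < N%:R :> F by rewrite ltr0n.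
have := chi_lg_sum_bound N.
have -> : \sum_(1 <= n < N.+1) chi n * (lg n / n%:R) =
   \sum_(1 <= b < N.+1) chi b * (mangoldt lg b / b%:R) * chi_series chi (N %/ b).
  transitivity (\sum_(1 <= b < N.+1) \sum_(1 <= a < (N %/ b).+1)
     chi b * (mangoldt lg b / b%:R) * (chi a / a%:R)); last first.
    by apply: eq_bigr => b _; rewrite mulr_sumr.
  rewrite -(sum_divisors (fun b a => chi b * (mangoldt lg b / b%:R) * (chi a / a%:R))).
  apply: eq_big_nat => n /andP[n_gt0 nN].
  rewrite -(divsum_mangoldt lgM n_gt0) -(@divsum_widen _ _ n N) ?n_gt0 //.
  rewrite mulr_suml mulr_sumr; apply: eq_bigr => b bn.
  rewrite -{1 2}(divnK bn) chiM natrM invfM; ring.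
set T := \sum_(_ <= _ < _) _ => hT.
suff hD : `|chi_series chi N * chi_mangoldt N - T| <= 12 * m%:R.
  rewrite -(subrK T (_ * _)); apply: le_trans (ler_normD _ _) _; lra.
rewrite /T /chi_mangoldt mulr_sumr -sumrB; apply: le_trans (ler_norm_sum _ _ _) _.
apply: le_trans (_ : \sum_(1 <= b < N.+1) 2 * m%:R / N%:R * mangoldt lg b <= _).
  apply: ler_sum_nat => b /andP[b_gt0 bN].
  have b0 : 0 < b%:R :> F by rewrite ltr0n.
  rewrite mulrC -mulrBr !normrM (ger0_norm (mangoldt_ge0 lgM lg_incr b)).
  rewrite (@ger0_norm _ b%:R^-1) ?invr_ge0 ?ler0n //.
  have := @chi_series_close F chi m chi_val m_gt0 chi_per chi_sum _ _ (leq_div N b).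
  have : (2 * m)%:R / (N %/ b).+1%:R <= 2 * m%:R / N%:R * b%:R :> F.
    rewrite natrM -[leRHS]mulrA ler_wpM2l ?mulr_ge0 ?ler0n // mulrC.
    rewrite ler_pdivlMr // ler_pdivrMl ?ltr0Sn // -natrM ler_nat.
    by rewrite ltnW // ltn_ceil.
  set q : F := _ / _; set X : F := `|_ - _| => hq /le_trans/(_ hq) hX.
  have M0 := mangoldt_ge0 lgM lg_incr b; have X0 : 0 <= X by exact: normr_ge0.
  apply: le_trans (_ : 1 * (mangoldt lg b / b%:R) * (2 * m%:R / N%:R * b%:R) <= _).
    rewrite -[leLHS]mulrA -[leRHS]mulrA; apply: ler_pM; rewrite ?normr_ge0 ?mulr_ge0 ?invr_ge0 ?ler0n //.
      exact: chi_le1.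
    by apply: ler_wpM2l => //; rewrite divr_ge0 // ler0n.
  rewrite le_eqVlt; apply/orP; left; apply/eqP; field.
  by rewrite !gt_eqF.
rewrite -mulr_sumr -/(chebyshev lg N) mulrAC ler_pdivrMr //.
have h := chebyshev_le lgM lg_incr N.
have m0 : 0 <= 2 * m%:R :> F by rewrite mulr_ge0 ?ler0n.
by have := ler_wpM2l m0 h; lra.
Qed.

Lemma chi_mangoldt_bounded :
  exists C N0, forall N, (N0 <= N)%N -> `|chi_mangoldt N| <= C.
Proof.
have [d d_gt0 [N0 hN0]] := chi_series_away0 chiM chi_val chi1 m_gt0 chi_per chi_sum.
exists ((14 * m%:R + 3) / d), N0.+1 => N leN.
rewrite ler_pdivlMr //.
have /chi_mangoldt_series_bound : (0 < N)%N by lia.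
have /hN0 hd : (N0 <= N)%N by lia.
rewrite normrM (ger0_norm (le_trans (ltW d_gt0) hd)).
by apply: le_trans; rewrite mulrC ler_wpM2r.
Qed.

End MertensCharacter.

(** * Real characters *)

Section RealCharacters.
Variable m' : nat.
Local Notation m := m'.+1.

(* A real character modulo [m], written additively: [f x] is true when the
   character takes the value [-1] at the unit [x]; non-units get [false]. *)
Definition real_char : {set {ffun 'I_m -> bool}} :=
  [set f : {ffun 'I_m -> bool} | [forall x : 'I_m, ~~ coprime x m ==> ~~ f x] &&
   [forall x : 'I_m, forall y : 'I_m, coprime x m ==> coprime y m ==>
      (f (inZp (x * y)) == f x (+) f y)]].

Lemma coprime_inZp n : coprime (inZp n : 'I_m) m = coprime n m.
Proof. by rewrite /= coprime_modl. Qed.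

Lemma inZpM a b : inZp ((inZp a : 'I_m) * (inZp b : 'I_m)) = inZp (a * b) :> 'I_m.
Proof. by apply: val_inj; rewrite /= modnMm. Qed.

Lemma real_char0 (f : {ffun 'I_m -> bool}) n : f \in real_char ->
  ~~ coprime n m -> f (inZp n) = false.
Proof.
rewrite inE => /andP[/forallP /(_ (inZp n)) + _] nm.
by rewrite coprime_inZp nm /= => /negbTE.
Qed.

Lemma real_charM (f : {ffun 'I_m -> bool}) a b : f \in real_char ->
  coprime a m -> coprime b m -> f (inZp (a * b)) = f (inZp a) (+) f (inZp b).
Proof.
rewrite inE => /andP[_ /forallP /(_ (inZp a)) /forallP /(_ (inZp b)) +] am bm.
by rewrite !coprime_inZp am bm /= inZpM => /eqP.
Qed.

Lemma real_char1 (f : {ffun 'I_m -> bool}) : f \in real_char -> f (inZp 1) = false.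
Proof.
move=> fX; have := real_charM fX (coprime1n m) (coprime1n m).
by rewrite muln1; case: (f _).
Qed.

Lemma real_charX (f : {ffun 'I_m -> bool}) a k : f \in real_char ->
  coprime a m -> f (inZp (a ^ k)) = odd k && f (inZp a).
Proof.
move=> fX am; elim: k => [|k IHk]; first by rewrite expn0 real_char1.
by rewrite expnS real_charM // ?coprimeXl // IHk /=; case: odd; case: (f _).
Qed.

(** The entry point for concrete symbols: residues modulo 4 and 8, and quadratic characters at prime
    divisors of [m]. Masking by coprimality supplies the convention at non-units. *)
Lemma mem_real_char (g : nat -> bool) :
  (forall n, g (n %% m)%N = g n) ->
  (forall a b, coprime a m -> coprime b m -> g (a * b)%N = g a (+) g b) ->
  [ffun x : 'I_m => coprime x m && g x] \in real_char.
Proof.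
move=> g_per gM; rewrite inE; apply/andP; split.
  by apply/forallP => x; apply/implyP => /negbTE xm; rewrite ffunE xm.
apply/forallP => x; apply/forallP => y; apply/implyP => xm; apply/implyP => ym.
by rewrite !ffunE /= g_per coprime_modl coprimeMl xm ym /= gM.
Qed.

Section Values.
Variable F : rcfType.

Definition char_val (f : {ffun 'I_m -> bool}) (n : nat) : F :=
  if coprime n m then (-1) ^+ f (inZp n) else 0.

Variable f : {ffun 'I_m -> bool}.
Hypothesis fX : f \in real_char.

Lemma char_valM a b : char_val f (a * b) = char_val f a * char_val f b.
Proof.
rewrite /char_val coprimeMl; case: (boolP (coprime a m)) => am; last by rewrite mul0r.
case: (boolP (coprime b m)) => bm; last by rewrite mulr0.
by rewrite /= real_charM // signr_addb.
Qed.

Lemma char_val_cases n :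
  [\/ char_val f n = 0, char_val f n = 1 | char_val f n = -1].
Proof.
rewrite /char_val; case: ifP => _; last by constructor 1.
by case: (f _); [constructor 3 | constructor 2].
Qed.

Lemma char_val1 : char_val f 1 = 1.
Proof. by rewrite /char_val coprime1n real_char1. Qed.

Lemma char_val_per n : char_val f (n + m) = char_val f n.
Proof.
rewrite /char_val -coprime_modl modnDr coprime_modl.
by congr (if _ then _ ^+ f _ else _); apply: val_inj; rewrite /= modnDr.
Qed.

(** Multiplication by a unit of value -1 permutes the residues and negates the sum. *)
Lemma char_val_sum : f != [ffun=> false] -> \sum_(0 <= n < m) char_val f n = 0.
Proof.
move=> f_neq0; have [x fx] : exists x, f x.
  apply/existsP; apply: contraNT f_neq0; rewrite negb_exists => /forallP f0.
  by apply/eqP/ffunP => x; rewrite ffunE; apply/negbTE.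
have xm : coprime x m.
  by apply: contraLR fx; move/(real_char0 fX); rewrite valZpK => ->.
rewrite big_mkord; set S := \sum_(_ < _) _.
pose h (y : 'I_m) : 'I_m := inZp (x * y).
have h_inj : injective h.
  move=> y z /(congr1 val) /= /eqP.
  wlog lezy : y z / (z <= y)%N => [th|].
    by case/orP: (leq_total z y) => ?; last rewrite eq_sym => ?; [|apply/esym]; apply: th.
  rewrite eqn_mod_dvd ?leq_mul2l ?lezy ?orbT // -mulnBr Gauss_dvdr 1?coprime_sym //.
  have [yz|yz] := posnP (y - z); last by move/(dvdn_leq yz); have := ltn_ord y; lia.
  by move=> _; apply: val_inj => /=; lia.
suff: S = - S by move/eqP; rewrite -addr_eq0 -mulr2n mulrn_eq0 => /eqP.
rewrite {1}/S (reindex_inj h_inj) -sumrN; apply: eq_bigr => y _.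
have -> : char_val f (h y) = char_val f (x * y).
  rewrite /char_val coprime_inZp; congr (if _ then _ ^+ f _ else _).
  by apply: val_inj; rewrite /= modn_mod.
by rewrite char_valM {1}/char_val xm valZpK fx expr1 mulN1r.
Qed.
End Values.

(** Orthogonality on the dual side: adding a character [g] with value -1 at [b] is an involution of
    [real_char] that negates the sum. *)
Lemma real_char_sum (F : rcfType) (b : nat) : coprime b m ->
  \sum_(f in real_char) (-1) ^+ f (inZp b) =
    (if [forall f in real_char, ~~ f (inZp b)] then #|real_char|%:R else 0) :> F.
Proof.
move=> bm; case: ifPn => [/forall_inP fb|].
  rewrite (eq_bigr (fun=> 1)) ?sumr_const // => f fX.
  by rewrite (negbTE (fb f fX)).
rewrite negb_forall_in => /exists_inP[g gX]; rewrite negbK => gb.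
set S := \sum_(_ in _) _.
suff: S = - S by move/eqP; rewrite -addr_eq0 -mulr2n mulrn_eq0 => /eqP.
pose h (f : {ffun 'I_m -> bool}) := [ffun x => f x (+) g x].
have hK : involutive h by move=> f; apply/ffunP => x; rewrite !ffunE addbK.
have hX f : f \in real_char -> h f \in real_char.
  move=> fX; move: (fX) (gX); rewrite !inE => /andP[/forallP f0 /forallP fM].
  move=> /andP[/forallP g0 /forallP gM]; apply/andP; split.
    apply/forallP => x; apply/implyP => xm; move: (f0 x) (g0 x); rewrite xm ffunE.
    by move=> /negbTE -> /negbTE ->.
  apply/forallP => x; apply/forallP => y; apply/implyP => xm; apply/implyP => ym.
  move: (fM x) (gM x) => /forallP /(_ y) + /forallP /(_ y); rewrite xm ym /= !ffunE.
  by move=> /eqP -> /eqP ->; case: (f x) (f y) (g x) (g y) => [] [] [] [].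
rewrite {1}/S (reindex_inj (inv_inj hK)) -sumrN; apply: eq_big => [f|f _].
  by apply/idP/idP => /hX //; rewrite hK.
by rewrite ffunE gb signr_addb expr1 mulrN1.
Qed.

End RealCharacters.

(** * Primes with prescribed values of all real characters *)

Section PrimePattern.
Variables (F : archiRcfType) (lg : nat -> F).
Hypothesis lgM : forall a b, (0 < a)%N -> (0 < b)%N -> lg (a * b)%N = lg a + lg b.
Hypothesis lg_incr : forall n, (0 < n)%N -> n.+1%:R^-1 <= lg n.+1 - lg n <= n%:R^-1.

Lemma lg_unbounded (C : F) N0 : exists2 N, (N0 < N)%N & C < lg N.
Proof.
pose k := (2 * Num.bound `|C| + N0)%N; exists (2 ^ k)%N.
  by apply: leq_ltn_trans (ltn_expl k _); rewrite // /k leq_addl.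
rewrite (lgX lgM) //; have h := archi_boundP (normr_ge0 C).
apply: le_lt_trans (ler_norm C) _; apply: lt_le_trans h _.
have /andP[l2 _] := @lg_incr 1 isT; rewrite (lg1 lgM) subr0 in l2.
apply: le_trans (_ : k%:R * 2^-1 <= _); last by rewrite ler_wpM2l ?ler0n.
by rewrite /k natrD natrM mulrDl mulrAC mulfV ?pnatr_eq0 // mul1r lerDl mulr_ge0 ?invr_ge0 ?ler0n.
Qed.

Lemma sum_lg_over_square K : \sum_(1 <= s < K.+1) lg s / s%:R ^+ 2 <= 2.
Proof.
(* A discrete form of the antiderivative -(log x + 1)/x of log x / x^2; with 2 in place of 1 the
   discrete step goes through, and the case [n = 0] is an equality. *)
suff main n : \sum_(1 <= s < n.+2) lg s / s%:R ^+ 2 <= 2 - (lg n.+1 + 2) / n.+1%:R.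
  case: K => [|n]; first by rewrite big_geq.
  apply: le_trans (main n) _; rewrite gerBl divr_ge0 ?ler0n // addr_ge0 //.
  exact: (lg_ge0 lgM lg_incr).
elim: n => [|n IHn]; first by rewrite big_nat1 (lg1 lgM) mul0r; lra.
rewrite big_nat_recr //=; apply: le_trans (lerD IHn (lexx _)) _.
have /andP[_ h] := @lg_incr n.+1 isT.
have l0 := lg_ge0 lgM lg_incr (isT : 0 < n.+2)%N.
set x : F := n.+1%:R in h *; have x1 : 1 <= x by rewrite ler1n.
have -> : n.+2%:R = x + 1 :> F by rewrite natr1.
clearbody x.
have x0 : 0 < x by lra.
have y0 : 0 < x + 1 by lra.
move: h l0; set a := lg n.+1; set b := lg n.+2 => h l0.
have h1 : x * (b - a) <= 1.
  by have := ler_wpM2l (ltW x0) h; rewrite mulfV // gt_eqF.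
rewrite -subr_ge0.
have -> : 2 - (b + 2) / (x + 1) - (2 - (a + 2) / x + b / (x + 1) ^+ 2) =
   (((a + 2) * (x + 1) - (b + 2) * x) * (x + 1) - b * x) / (x * (x + 1) ^+ 2).
  by field; rewrite !gt_eqF.
apply: divr_ge0; last by rewrite mulr_ge0 ?exprn_ge0 ?ltW.
have h2 : b - a <= 1 by nra.
have : b <= (a + 2) * (x + 1) - (b + 2) * x by nra.
move=> h3; have := ler_wpM2r (ltW y0) h3; nra.
Qed.

Lemma sum_geometric r N : (2 <= r)%N -> \sum_(1 <= k < N.+1) (r%:R ^+ k)^-1 <= 1 :> F.
Proof.
move=> r2; have r0 : 0 < r%:R :> F by rewrite ltr0n; lia.
have r2' : 2 <= r%:R :> F by rewrite ler_nat.
suff main : \sum_(1 <= k < N.+1) (r%:R ^+ k)^-1 <= 1 - (r%:R ^+ N)^-1 :> F.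
  by apply: le_trans main _; rewrite gerBl invr_ge0 exprn_ge0 ?ler0n.
elim: N => [|N IHN]; first by rewrite big_geq // expr0 invr1 subrr.
rewrite big_nat_recr //=; apply: le_trans (lerD IHN (lexx _)) _.
rewrite exprS invfM; set q := (_ ^+ N)^-1.
have q0 : 0 <= q by rewrite invr_ge0 exprn_ge0 ?ler0n.
have : r%:R^-1 <= 2^-1 :> F by rewrite lef_pV2 ?posrE //; lra.
by move=> h; have := ler_wpM2r q0 h; lra.
Qed.

Local Notation vM := (mangoldt lg).

(** A prime power not prime to the modulus has its base [r] among the divisors of [m.+1], and the
    powers of one [r] contribute at most [lg r] by the geometric series. Summing over all
    [r <= m.+1] gives [lgfact]. *)
Lemma mangoldt_noncoprime_bound m N :
  \sum_(1 <= n < N.+1 | ~~ coprime n m.+1) vM n / n%:R <= lgfact lg m.+1.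
Proof.
pose G r k n : F := if (n == r ^ k)%N then lg r / r%:R ^+ k else 0.
have G0 r k n : (0 < r)%N -> 0 <= G r k n.
  move=> r_gt0; rewrite /G; case: ifP => // _.
  by rewrite divr_ge0 ?exprn_ge0 ?ler0n ?(lg_ge0 lgM lg_incr).
apply: le_trans (_ : \sum_(1 <= n < N.+1) \sum_(1 <= r < m.+2) \sum_(1 <= k < N.+1)
    (if prime r then G r k n else 0) <= _).
  rewrite big_mkcond; apply: ler_sum_nat => n /andP[n_gt0 nN].
  have sum0 : 0 <= \sum_(1 <= r < m.+2) \sum_(1 <= k < N.+1) (if prime r then G r k n else 0).
    apply: sumr_ge0 => r _; apply: sumr_ge0 => k _; case: ifP => // r_pr.
    by rewrite G0 // prime_gt0.
  case: ifP => // nm; have [->|] := eqVneq (vM n) 0; first by rewrite mul0r.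
  move=> /mangoldt_neq0[r [k [r_pr k_gt0 def_n]]].
  have r_gt1 := prime_gt1 r_pr; have r_gt0 := prime_gt0 r_pr.
  have rm : (r %| m.+1)%N.
    by move: nm; rewrite def_n coprime_pexpl // prime_coprime // negbK.
  have lerm : (0 < r < m.+2)%N by rewrite r_gt0 ltnS dvdn_leq.
  have lekN : (0 < k < N.+1)%N.
    rewrite k_gt0 ltnS; apply: leq_trans (ltnW (ltn_expl k r_gt1)) _.
    by rewrite -def_n; lia.
  rewrite (bigD1_seq r) ?iota_uniq ?mem_index_iota //= (bigD1_seq k) ?iota_uniq ?mem_index_iota //=.
  rewrite r_pr {1}/G -def_n eqxx -natrX -def_n {1}def_n (mangoldt_prime_pow lg) // -addrA lerDl.
  apply: addr_ge0; apply: sumr_ge0 => i _; first by rewrite G0.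
  by apply: sumr_ge0 => j _; case: ifP => // i_pr; rewrite G0 // prime_gt0.
rewrite exchange_big_nat /=; apply: ler_sum_nat => r /andP[r_gt0 _].
have lr0 := lg_ge0 lgM lg_incr r_gt0.
have [r_pr|r_npr] := boolP (prime r); last first.
  by rewrite big1 // => n _; rewrite big1.
rewrite exchange_big_nat /=.
apply: le_trans (_ : \sum_(1 <= k < N.+1) lg r / r%:R ^+ k <= _).
  apply: ler_sum => k _; rewrite /G.
  have [rkN|rkN] := leqP (r ^ k) N.
    rewrite (bigD1_seq (r ^ k)%N) ?iota_uniq ?mem_index_iota ?expn_gt0 ?r_gt0 ?ltnS //=.
    by rewrite eqxx big1 ?addr0 // => n /negbTE ->.
  rewrite big_nat_cond big1 ?divr_ge0 ?exprn_ge0 ?ler0n // => n /andP[/andP[_ nN] _].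
  by case: eqP => // def_n; lia.
rewrite -mulr_sumr -[leRHS]mulr1 ler_wpM2l // sum_geometric //.
exact: prime_gt1.
Qed.

(** Bounds the noise of even prime powers: the term at [s ^ 2] is at most [2 * lg s / s ^ 2], and
    [sum_lg_over_square] gives 2 for the series. *)
Lemma mangoldt_square_bound (P : pred nat) N :
  (forall n, (n <= N)%N -> P n -> vM n != 0 -> exists s, n = (s ^ 2)%N) ->
  \sum_(1 <= n < N.+1 | P n) vM n / n%:R <= 4.
Proof.
move=> sqP.
pose G s n : F := if (n == s ^ 2)%N then vM n / n%:R else 0.
have v0 n : 0 <= vM n / n%:R by rewrite divr_ge0 ?ler0n // (mangoldt_ge0 lgM lg_incr).
have G0 s n : 0 <= G s n by rewrite /G; case: ifP.
apply: le_trans (_ : \sum_(1 <= n < N.+1) \sum_(1 <= s < N.+1) G s n <= _).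
  rewrite big_mkcond; apply: ler_sum_nat => n /andP[n_gt0 nN].
  have sum0 : 0 <= \sum_(1 <= s < N.+1) G s n by apply: sumr_ge0.
  case: ifP => // Pn; have [->|vn] := eqVneq (vM n) 0; first by rewrite mul0r.
  have [s def_n] := sqP n nN Pn vn.
  have sN : (0 < s < N.+1)%N by move: n_gt0 nN; rewrite def_n expnS expn1; nia.
  rewrite (bigD1_seq s) ?iota_uniq ?mem_index_iota //= {1}/G -def_n eqxx lerDl.
  by apply: sumr_ge0.
rewrite exchange_big_nat /=.
apply: le_trans (_ : \sum_(1 <= s < N.+1) 2 * (lg s / s%:R ^+ 2) <= _); last first.
  by rewrite -mulr_sumr; have := sum_lg_over_square N; lra.
apply: ler_sum_nat => s /andP[s_gt0 _].
have ls0 := lg_ge0 lgM lg_incr s_gt0.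
have [sN|sN] := leqP (s ^ 2) N; last first.
  rewrite big_nat_cond big1 ?mulr_ge0 ?invr_ge0 ?exprn_ge0 ?ler0n //.
  by move=> n /andP[/andP[_ nN] _]; rewrite /G; case: eqP => // ?; lia.
rewrite (bigD1_seq (s ^ 2)%N) ?iota_uniq ?mem_index_iota ?expn_gt0 ?s_gt0 ?ltnS //=.
rewrite {1}/G eqxx big1 ?addr0 => [|n /negbTE ns]; last by rewrite /G ns.
rewrite natrX mulrA ler_wpM2r ?invr_ge0 ?exprn_ge0 ?ler0n //.
have s2 : (0 < s ^ 2)%N by rewrite expn_gt0 s_gt0.
by apply: le_trans (mangoldt_le lgM lg_incr s2) _; rewrite (lgX lgM).
Qed.

(** Weight the sums [A f N] by the values of [f] at [a]. The trivial character contributes [lg N] up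
    to a constant and the others stay bounded, so [T] grows. By orthogonality [T] is [#|X|] times
    the sum over the [n] on which all real characters agree with [a]; if no such [n] up to [N] is
    prime, only even prime powers remain and [T] is bounded. *)
Lemma prime_pattern_log m' a : coprime a m'.+1 ->
  exists r, [/\ prime r, coprime r m'.+1 &
    {in @real_char m', forall f : {ffun 'I_m'.+1 -> bool}, f (inZp r) = f (inZp a)}].
Proof.
set m := m'.+1; set X := @real_char m' => am.
pose sim n := [forall f in X, ~~ f (inZp (a * n))].
have simP n : coprime n m ->
    reflect {in X, forall f : {ffun 'I_m -> bool}, f (inZp n) = f (inZp a)} (sim n).
  move=> nm; apply: (iffP forall_inP) => h f fX; move: (h f fX).
    by rewrite real_charM //; case: (f _); case: (f _).
  by rewrite real_charM // => ->; case: (f _).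
pose A (f : {ffun 'I_m -> bool}) N := chi_mangoldt lg (char_val F f) N.
pose f0 : {ffun 'I_m -> bool} := [ffun=> false].
have f0X : f0 \in X.
  rewrite inE; apply/andP; split; first by apply/forallP => x; rewrite ffunE implybT.
  by do 2!apply/forallP => ?; rewrite !ffunE eqxx !implybT.
(* The pair of zeros is a placeholder where nothing is claimed. *)
have /fin_all_exists[CN hCN] : forall f, exists CN : F * nat, f \in X -> f != f0 ->
    forall N, (CN.2 <= N)%N -> `|A f N| <= CN.1.
  move=> f; have [fX|] := boolP (f \in X); last by exists (0, 0%N).
  have [->|fn0] := eqVneq f f0; first by exists (0, 0%N).
  have [C [N0 h]] := chi_mangoldt_bounded lgM lg_incr (char_valM F fX) (char_val_cases F f)
    (char_val1 F fX) (ltn0Sn m') (char_val_per F f) (char_val_sum F fX fn0).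
  by exists (C, N0) => _ _ N; apply: h.
pose C := \sum_(f in X | f != f0) (CN f).1; pose N0 := (\sum_f (CN f).2)%N.
(* [lg N] is made to beat every bounded contribution: 1 from Mertens, [lgfact lg m] from [n] not
   prime to [m], [C] from the nontrivial characters, the last term from the squares. *)
have [N ltN hN] := lg_unbounded (1 + lgfact lg m + C + 4 * #|X|%:R) N0.
have [/existsP[r /and3P[r_pr rm /(simP _ rm) h]]|] :=
  boolP [exists r : 'I_N.+1, [&& prime r, coprime r m & sim r]]; first by exists r.
rewrite negb_exists => /forallP no_prime; exfalso.
pose T := \sum_(f in X) (-1) ^+ f (inZp a) * A f N.
have T_low : lg N - 1 - lgfact lg m - C <= T.
  rewrite /T (bigD1 f0) //= ffunE expr0 mul1r; apply: lerD.
    have := mertens_lower lgM lg_incr (leq_ltn_trans (leq0n _) ltN).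
    have := mangoldt_noncoprime_bound m' N.
    have -> : A f0 N = \sum_(1 <= n < N.+1 | coprime n m) vM n / n%:R.
      rewrite [RHS]big_mkcond; apply: eq_bigr => n _; rewrite /char_val ffunE expr0.
      by case: ifP => _; rewrite ?mul1r ?mul0r.
    rewrite [\sum_(1 <= a < N.+1) _](bigID (fun n => coprime n m)) /= -/m.
    by set S1 := \sum_(_ <= _ < _ | ~~ _) _; set S2 := \sum_(_ <= _ < _ | _) _; lra.
  rewrite -sumrN; apply: ler_sum => f /andP[fX fn0].
  have leN : ((CN f).2 <= N)%N.
    by apply: leq_trans (ltnW ltN); rewrite /N0 (bigD1 f) //= leq_addr.
  have := hCN f fX fn0 N leN; rewrite ler_norml => /andP[h1 h2].
  by case: (f _); rewrite ?expr1 ?expr0; lra.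
have T_up : T <= 4 * #|X|%:R.
  have -> : T = #|X|%:R * \sum_(1 <= n < N.+1 | coprime n m && sim n) vM n / n%:R.
    rewrite /T mulr_sumr; under eq_bigr => f _ do rewrite mulr_sumr.
    rewrite exchange_big /= [RHS]big_mkcond; apply: eq_bigr => n _.
    have [nm|nm] := boolP (coprime n m); last first.
      by rewrite big1 // => f _; rewrite /char_val (negbTE nm) mul0r mulr0.
    have anm : coprime (a * n) m by rewrite coprimeMl am.
    have /= := real_char_sum F anm; rewrite -/X -/(sim n) => sumX.
    transitivity ((\sum_(f in X) (-1) ^+ f (inZp (a * n))) * (vM n / n%:R)).
      rewrite mulr_suml; apply: eq_bigr => f fX.
      by rewrite /char_val nm /= (real_charM fX am nm) signr_addb -mulrA.
    by rewrite sumX; case: ifP => _; rewrite ?mul0r.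
  rewrite mulrC ler_wpM2r ?ler0n //; apply: mangoldt_square_bound.
  move=> n nN /andP[nm nsim] /mangoldt_neq0[r [k [r_pr k_gt0 def_n]]].
  (* An odd power has the same real characters as its base, so its base would be an excluded
     prime. *)
  have [kodd|] := boolP (odd k); last first.
    by move=> keven; exists (r ^ k./2)%N; rewrite -expnM muln2 even_halfK.
  have rm : coprime r m by move: nm; rewrite def_n coprime_pexpl.
  have rN : (r < N.+1)%N.
    rewrite ltnS (leq_trans _ nN) // def_n -{1}[r]expn1 leq_exp2l //.
    exact: prime_gt1.
  have := no_prime (Ordinal rN); rewrite /= r_pr rm /= => /negP[]; apply/simP => // f fX.
  by move/simP: nsim => /(_ nm f fX) <-; rewrite def_n real_charX // kodd.
have := le_trans T_low T_up; lra.
Qed.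
End PrimePattern.

Section RealLogarithm.
Local Notation R := Rdefinitions.R.
Let Rln (n : nat) : R := Rpower.ln n%:R.

Lemma Rln_mul (a b : nat) : (0 < a)%N -> (0 < b)%N -> Rln (a * b) = Rln a + Rln b.
Proof.
move=> a0 b0; rewrite /Rln natrM; apply: Rpower.ln_mult; apply/RltP; by rewrite ltr0n.
Qed.

Lemma Rln_incr (n : nat) : (0 < n)%N ->
  n.+1%:R^-1 <= Rln n.+1 - Rln n <= (n%:R^-1 : R).
Proof.
move=> n_gt0; have n0 : 0 < n%:R :> R by rewrite ltr0n.
have n1 : 0 < n.+1%:R :> R by rewrite ltr0n.
(* This is ln t <= t - 1 at [t = y / x]; exchanging [x] and [y] gives the other bound. *)
have ln_le (x y : R) : 0 < x -> 0 < y -> Rpower.ln y - Rpower.ln x <= (y - x) / x.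
  move=> x0 y0; have yx0 : 0 < y / x by rewrite divr_gt0.
  have xP : Rdefinitions.Rlt 0 x by exact/RltP.
  have yxP : Rdefinitions.Rlt 0 (y / x) by exact/RltP.
  have -> : Rpower.ln y - Rpower.ln x = Rpower.ln (y / x).
    rewrite -{1}(mulfVK (_ : x != 0) y) ?gt_eqF // [_ / _ * _]mulrC.
    rewrite [Rpower.ln (x * _)](Rpower.ln_mult _ _ xP yxP).
    by rewrite addrAC subrr add0r.
  have /RleP := Rpower.exp_ineq1_le (Rpower.ln (y / x)).
  by rewrite (Rpower.exp_ln _ yxP) => h; rewrite mulrBl mulfV ?gt_eqF // lerBrDl; exact: h.
have e : n.+1%:R - n%:R = 1 :> R by rewrite -natr1 addrAC subrr add0r.
apply/andP; split; last by have := ln_le _ _ n0 n1; rewrite e div1r.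
by have := ln_le _ _ n1 n0; rewrite -[_ - n.+1%:R]opprB e mulN1r lerNr opprB.
Qed.

End RealLogarithm.

Theorem prime_pattern m' a : coprime a m'.+1 ->
  exists r, [/\ prime r, coprime r m'.+1 &
    {in @real_char m', forall f : {ffun 'I_m'.+1 -> bool}, f (inZp r) = f (inZp a)}].
Proof. exact: (prime_pattern_log Rln_mul Rln_incr). Qed.

(** * Quadratic reciprocity *)

Lemma sign_inj (E : fieldType) (a b : bool) : 2 != 0 :> E ->
  (-1) ^+ a = (-1) ^+ b :> E -> a = b.
Proof.
move=> E2; have E1 : (1 == -1 :> E) = false by rewrite -subr_eq0 opprK; apply: negbTE.
by case: a b => [] [] //; rewrite expr0 expr1 => /eqP; rewrite ?E1 // eq_sym E1.
Qed.

(** * Squares in finite fields of odd order *)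

Section Squares.
Variable F : finFieldType.

Definition nonsquare (x : F) : bool := ~~ [exists y, y ^+ 2 == x].

Lemma finfield_prim_root : exists z : F, (#|F|.-1).-primitive_root z.
Proof.
have Fgt1 := finNzRing_gt1 F.
have [] := hasP (@has_prim_root F #|F|.-1 (enum [pred x : F | x != 0]) _ _ _ _).
- by rewrite -ltnS prednK // ltnW.
- apply/allP => x; rewrite mem_enum inE unity_rootE => x0.
  by apply/eqP/(mulfI x0); rewrite -exprS prednK ?(ltnW Fgt1) // expf_card mulr1.
- exact: enum_uniq.
- rewrite -cardE -(cardC1 (0 : F)).
  by rewrite (eq_card (_ : predC1 0 =i [pred x : F | x != 0])) // => x; rewrite ?inE.
- by move=> z _; exists z.
Qed.

Hypothesis Fodd : odd #|F|.

Lemma half_card : (#|F|.-1 = (#|F|./2).*2)%N.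
Proof. by have := finNzRing_gt1 F; have := odd_double_half #|F|; rewrite Fodd; lia. Qed.

Lemma prim_root_neq0 (z : F) n : n.-primitive_root z -> z != 0.
Proof.
move=> z_prim; apply: contraTneq (prim_order_gt0 z_prim) => z0.
have := prim_expr_order z_prim; rewrite z0 expr0n; case: n {z_prim} => // n.
by move/eqP; rewrite eq_sym oner_eq0.
Qed.

Lemma two_neq0 : 2 != 0 :> F.
Proof.
have [z z_prim] := finfield_prim_root.
have h0 : (0 < #|F|./2)%N by have := prim_order_gt0 z_prim; rewrite half_card; lia.
apply/eqP => F2; have N1 : -1 = 1 :> F by apply/eqP; rewrite eq_sym -subr_eq0 opprK; apply/eqP.
have : (z ^+ #|F|./2) ^+ 2 == 1.
  by rewrite -exprM muln2 -half_card (prim_expr_order z_prim).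
rewrite sqrf_eq1 N1 orbb -(prim_order_dvd z_prim) half_card.
by move/(dvdn_leq h0); lia.
Qed.

(** The order of [z] is even, so the parity of a discrete logarithm is well defined. *)
Lemma nonsquare_prim_exp z i : (#|F|.-1).-primitive_root z -> nonsquare (z ^+ i) = odd i.
Proof.
move=> z_prim; apply/idP/idP; last first.
  move=> i_odd; apply/negP => /existsP[y /eqP y2].
  have y0 : y != 0.
    apply: contraTneq i_odd => y0; move: y2; rewrite y0 expr0n /= => /esym/eqP.
    by rewrite expf_eq0 (negbTE (prim_root_neq0 z_prim)) andbF.
  have y1 : y ^+ #|F|.-1 = 1.
    by apply: (mulfI y0); rewrite -exprS prednK ?expf_card ?mulr1 // ltnW // finNzRing_gt1.
  have [j def_y] := prim_rootP z_prim y1.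
  move/eqP: y2; rewrite def_y -exprM (eq_prim_root_expr z_prim) => /eqP e.
  have : odd (j * 2 %% #|F|.-1) = odd (i %% #|F|.-1) by rewrite e.
  by rewrite !odd_mod ?half_card ?odd_double // i_odd muln2 odd_double.
apply: contraR => i_even; apply/existsP; exists (z ^+ i./2).
by rewrite -exprM muln2 even_halfK.
Qed.

Lemma prim_log z (x : F) : (#|F|.-1).-primitive_root z -> x != 0 -> exists i, x = z ^+ i.
Proof.
move=> z_prim x0; have x1 : x ^+ #|F|.-1 = 1.
  by apply: (mulfI x0); rewrite -exprS prednK ?expf_card ?mulr1 // ltnW // finNzRing_gt1.
by have [j ->] := prim_rootP z_prim x1; exists j.
Qed.

Lemma nonsquareM (x y : F) : x != 0 -> y != 0 ->
  nonsquare (x * y) = nonsquare x (+) nonsquare y.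
Proof.
have [z z_prim] := finfield_prim_root => x0 y0.
have [[i ->] [j ->]] := (prim_log z_prim x0, prim_log z_prim y0).
by rewrite -exprD !(nonsquare_prim_exp _ z_prim) oddD.
Qed.

Lemma nonsquare_sqr (x : F) : nonsquare (x ^+ 2) = false.
Proof. by apply/negbF/existsP; exists x. Qed.

Lemma euler_criterion (x : F) : x != 0 -> x ^+ (#|F|./2) = (-1) ^+ nonsquare x.
Proof.
have [z z_prim] := finfield_prim_root => x0; have [i ->] := prim_log z_prim x0.
rewrite (nonsquare_prim_exp _ z_prim) -exprM mulnC exprM signr_odd; congr (_ ^+ _).
have h0 : (0 < #|F|./2)%N by have := prim_order_gt0 z_prim; rewrite half_card; lia.
have : (z ^+ #|F|./2) ^+ 2 == 1.
  by rewrite -exprM muln2 -half_card (prim_expr_order z_prim).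
rewrite sqrf_eq1 => /orP[|/eqP //]; rewrite -(prim_order_dvd z_prim) half_card.
by move/(dvdn_leq h0); lia.
Qed.

Lemma nonsquareN1 : nonsquare (-1) = odd (#|F|./2).
Proof.
have := @euler_criterion (-1); rewrite oppr_eq0 oner_eq0 => /(_ isT).
by rewrite -[LHS]signr_odd => h; rewrite -(@sign_inj F _ _ two_neq0 h).
Qed.

Lemma nonsquare_exists : exists2 z : F, z != 0 & nonsquare z.
Proof.
have [z z_prim] := finfield_prim_root; exists z.
  exact: prim_root_neq0 z_prim.
by rewrite -[z]expr1 (nonsquare_prim_exp _ z_prim).
Qed.

Section QuadraticCharacter.
Variable E : fieldType.

(** The values lie in a second field because the Gauss sums for F_p are formed in characteristic
    [l]. *)
Definition quad_char (x : F) : E := if x == 0 then 0 else (-1) ^+ nonsquare x.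

Lemma quad_charM x y : quad_char (x * y) = quad_char x * quad_char y.
Proof.
rewrite /quad_char mulf_eq0; case: eqVneq => x0 /=; first by rewrite mul0r.
case: eqVneq => y0; first by rewrite mulr0.
by rewrite nonsquareM // signr_addb.
Qed.

Lemma quad_char_sqr x : x != 0 -> quad_char x * quad_char x = 1.
Proof. by rewrite /quad_char => /negbTE ->; rewrite -signr_addb addbb. Qed.

Lemma quad_char_odd_exp x l : odd l -> quad_char x ^+ l = quad_char x.
Proof.
rewrite /quad_char; case: ifP => _ l_odd; first by rewrite expr0n; case: l l_odd.
by case: nonsquare; rewrite ?expr1n // expr1 -signr_odd l_odd.
Qed.

Lemma quad_char_sum : 2 != 0 :> E -> \sum_x quad_char x = 0.
Proof.
move=> E2; have [z z0 nz] := nonsquare_exists.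
have : \sum_x quad_char x = - \sum_x quad_char x.
  rewrite {1}(reindex_inj (mulfI z0)) -sumrN /=; apply: eq_bigr => x _.
  by rewrite quad_charM {1}/quad_char (negbTE z0) nz expr1 mulN1r.
by move/eqP; rewrite -addr_eq0 -mulr2n -mulr_natl mulf_eq0 (negbTE E2) => /eqP.
Qed.

End QuadraticCharacter.
End Squares.

(** * Gauss sums for F_p in characteristic [l] *)

Section GaussSum.
Variables (p l : nat).
Hypotheses (p_pr : prime p) (l_pr : prime l) (p_odd : odd p) (l_odd : odd l) (pl : p != l).
Variables (E : fieldType) (zeta : E).
Hypotheses (E_char : l \in [pchar E]) (zeta_prim : p.-primitive_root zeta).
Local Notation Fp := 'F_p.
Local Notation chi := (@quad_char Fp E).

Lemma odd_card_Fp : odd #|{: 'F_p}|. Proof. by rewrite card_Fp. Qed.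

Lemma natr_neq0_pchar n : ~~ (l %| n)%N -> n%:R != 0 :> E.
Proof. by rewrite (dvdn_pcharf E_char). Qed.

Lemma two_neq0_pchar : 2 != 0 :> E.
Proof.
apply: natr_neq0_pchar; rewrite dvdn_prime2 //.
by apply: contraTneq l_odd => ->.
Qed.

Definition add_char (x : Fp) : E := zeta ^+ x.

Lemma add_charD x y : add_char (x + y) = add_char x * add_char y.
Proof.
rewrite /add_char -exprD -[in RHS](prim_expr_mod zeta_prim) /=.
by congr (_ ^+ (_ %% _)); apply: Fp_cast.
Qed.

Lemma add_char0 : add_char 0 = 1. Proof. by []. Qed.

Lemma add_charM_nat n x : add_char (n%:R * x) = add_char x ^+ n.
Proof.
elim: n => [|n IHn]; first by rewrite mul0r add_char0.
by rewrite -natr1 mulrDl mul1r add_charD IHn exprSr.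
Qed.

Lemma add_char_sum : \sum_x add_char x = 0.
Proof.
have z1 : add_char 1 != 1.
  have : (1%R : Fp) = 1%N :> nat by [].
  rewrite /add_char => ->; rewrite expr1 -[zeta]expr1 -(prim_order_dvd zeta_prim).
  by rewrite dvdn1; apply: contraTneq p_pr => ->.
have : add_char 1 * \sum_x add_char x = \sum_x add_char x.
  rewrite mulr_sumr [RHS](reindex_inj (addrI 1)) /=.
  by apply: eq_bigr => x _; rewrite add_charD.
by move/eqP; rewrite -subr_eq0 -{2}[\sum_x _]mul1r -mulrBl mulf_eq0 subr_eq0 (negbTE z1) => /eqP.
Qed.

Lemma add_char_sumM c : \sum_x add_char (x * c) = if c == 0 then p%:R else 0.
Proof.
case: eqVneq => [->|c0]; last by have := add_char_sum; rewrite (reindex_inj (mulIf c0)).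
rewrite (eq_bigr (fun=> 1)) => [|x _]; last by rewrite mulr0 add_char0.
by rewrite sumr_const card_Fp.
Qed.

Definition gauss_sum : E := \sum_x chi x * add_char x.

Lemma gauss_sum_sqr : gauss_sum ^+ 2 = chi (-1) * p%:R.
Proof.
(* Writing the second variable as [x * c] turns [chi x * chi (x * c)] into [chi c]. The sum over
   nonzero [x] is then p - 1 for c = -1 and -1 otherwise, and the constant part dies with
   [quad_char_sum]. *)
have step x : chi x * add_char x * gauss_sum =
    \sum_c (if x == 0 then 0 else chi c * add_char (x * (1 + c))).
  case: eqVneq => [->|x0]; first by rewrite /quad_char eqxx !mul0r big1.
  rewrite /gauss_sum mulr_sumr (reindex_inj (mulfI x0)) /=; apply: eq_bigr => c _.
  rewrite mulrDr mulr1 add_charD (quad_charM odd_card_Fp).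
  transitivity (chi x * chi x * (chi c * (add_char x * add_char (x * c)))); first by ring.
  by rewrite quad_char_sqr // mul1r.
rewrite expr2 {1}/gauss_sum mulr_suml (eq_bigr _ (fun x _ => step x)) exchange_big /=.
transitivity (\sum_c chi c * ((if 1 + c == 0 then p%:R else 0) - 1)).
  apply: eq_bigr => c _; rewrite -add_char_sumM [\sum_x add_char _](bigD1 0) //=.
  rewrite mul0r add_char0 addrAC subrr add0r mulr_sumr [LHS](bigD1 0) //= ?eqxx add0r.
  by apply: eq_bigr => x /negbTE ->.
rewrite (eq_bigr (fun c => (if 1 + c == 0 then chi c * p%:R else 0) - chi c)); last first.
  by move=> c _; rewrite mulrBr mulr1; case: ifP => _; rewrite ?mulr0.
rewrite sumrB (quad_char_sum odd_card_Fp two_neq0_pchar) subr0 (bigD1 (-1)) //= subrr eqxx.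
rewrite big1 ?addr0 // => c cN1; rewrite addrC addr_eq0 (negbTE cN1) //.
Qed.

Lemma l_Fp_neq0 : l%:R != 0 :> Fp.
Proof.
by rewrite -(dvdn_pcharf (pchar_Fp p_pr)) dvdn_prime2.
Qed.

(** The Frobenius of [E] multiplies the argument of [add_char] by [l] and fixes the values of [chi],
    [l] being odd; rescaling the variable by [l] pulls out [chi l]. *)
Lemma gauss_sum_frobenius : gauss_sum ^+ l = chi l%:R * gauss_sum.
Proof.
have -> : gauss_sum ^+ l = \sum_x chi x * add_char (l%:R * x).
  rewrite -(pFrobenius_autE E_char) rmorph_sum /=; apply: eq_bigr => x _.
  by rewrite rmorphM /= !pFrobenius_autE quad_char_odd_exp // add_charM_nat.
rewrite mulr_sumr [RHS](reindex_inj (mulfI l_Fp_neq0)) /=; apply: eq_bigr => x _.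
by rewrite (quad_charM odd_card_Fp) !mulrA quad_char_sqr ?mul1r // l_Fp_neq0.
Qed.

Lemma gauss_sum_euler : (chi (-1) * p%:R) ^+ l./2 = chi l%:R.
Proof.
have G0 : gauss_sum != 0.
  have : gauss_sum ^+ 2 != 0.
    rewrite gauss_sum_sqr mulf_neq0 //; last by rewrite natr_neq0_pchar // dvdn_prime2 // eq_sym.
    by rewrite /quad_char oppr_eq0 oner_eq0 signr_eq0.
  by rewrite expf_eq0.
apply: (mulIf G0); rewrite -gauss_sum_sqr -exprM -exprSr -gauss_sum_frobenius.
by congr (_ ^+ _); lia.
Qed.

End GaussSum.

Lemma intr_pchar_eq0 (R : fieldType) l (u : int) : l \in [pchar R] ->
  (u%:~R == 0 :> R) = (l %| `|u|)%N.
Proof.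
move=> R_char; case: u => n; first by rewrite -pmulrn (dvdn_pcharf R_char).
by rewrite NegzE mulrNz oppr_eq0 -pmulrn abszN (dvdn_pcharf R_char).
Qed.

(** For prime [l], its multiples count as residues, since 0 is a square. *)
Definition nonres (l : nat) (n : int) : bool := nonsquare (n%:~R : 'F_l).

Section Residues.
Variable l : nat.
Hypotheses (l_pr : prime l) (l_odd : odd l).

Lemma intr_Fp_eq0 (u : int) : (u%:~R == 0 :> 'F_l) = (l %| `|u|)%N.
Proof. exact: intr_pchar_eq0 (pchar_Fp l_pr). Qed.

Lemma nonresM (a b : int) : ~~ (l %| `|a|)%N -> ~~ (l %| `|b|)%N ->
  nonres l (a * b) = nonres l a (+) nonres l b.
Proof.
rewrite -!intr_Fp_eq0 /nonres intrM => a0 b0; apply: nonsquareM => //.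
exact: odd_card_Fp.
Qed.

Lemma nonresN1 : nonres l (-1) = (l %% 4 == 3)%N.
Proof.
rewrite /nonres mulrNz mulr1z nonsquareN1 ?odd_card_Fp // card_Fp //.
by have := odd_double_half l; have := odd_double_half l./2; lia.
Qed.

Lemma nonres_sqr (a : int) : nonres l (a ^+ 2) = false.
Proof. by rewrite /nonres rmorphXn nonsquare_sqr. Qed.

Lemma nonres1 : nonres l 1 = false.
Proof. by rewrite -(expr1n _ 2) nonres_sqr. Qed.

Lemma eq_nonres (a b : int) : (a = b %[mod l])%Z -> nonres l a = nonres l b.
Proof.
move=> /eqP; rewrite eqz_mod_dvd => ab; rewrite /nonres; congr (nonsquare _).
by apply/eqP; rewrite -subr_eq0 -intrB intr_Fp_eq0.
Qed.

Lemma nonres_exists : exists2 a : nat, ~~ (l %| a)%N & nonres l a.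
Proof.
have [z z0 nz] := nonsquare_exists (odd_card_Fp l_pr l_odd).
exists z; last by rewrite /nonres -pmulrn natr_Zp.
by rewrite -[z]natr_Zp -(dvdn_pcharf (pchar_Fp l_pr)) in z0.
Qed.

End Residues.

Theorem quadratic_reciprocity p l : prime p -> prime l -> odd p -> odd l -> p != l ->
  nonres p l (+) nonres l p = (p %% 4 == 3)%N && (l %% 4 == 3)%N.
Proof.
move=> p_pr l_pr p_odd l_odd pl.
have p1 : (0 < p.-1)%N by have := prime_gt1 p_pr; lia.
(* With l^(p-1) elements, [E] has p dividing the order of its multiplicative group by Fermat, hence
   a primitive p-th root of unity. *)
have [E E_char cardE] := pPrimePowerField l_pr p1.
have [z z_prim] := finfield_prim_root E.
have p_dvd : (p %| #|E|.-1)%N.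
  have : l ^ totient p = 1 %[mod p].
    by apply: Euler_exp_totient; rewrite prime_coprime // dvdn_prime2 // eq_sym.
  by rewrite totient_prime // -cardE -subn1 => /eqP; rewrite eqn_mod_dvd // ltnW // finNzRing_gt1.
have := gauss_sum_euler p_pr l_pr p_odd l_odd pl E_char (dvdn_prim_root z_prim p_dvd).
rewrite /quad_char oppr_eq0 oner_eq0 (negbTE (l_Fp_neq0 p_pr l_pr pl)).
set e := nonsquare (-1); set b := nonsquare _ => hE.
have ep : e = (p %% 4 == 3)%N by rewrite -nonresN1 // /nonres mulrNz mulr1z.
have -> : nonres p l = b by rewrite /nonres /b -pmulrn.
(* The square of the Gauss sum, usually written p*. *)
pose t : int := (-1) ^+ e * p%:Z.
have tF : t%:~R != 0 :> 'F_l.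
  rewrite intr_Fp_eq0 // /t abszM abszX /= exp1n mul1n dvdn_prime2 //.
  by rewrite eq_sym.
have := euler_criterion (odd_card_Fp l_pr l_odd) tF; rewrite card_Fp //.
set c := nonsquare _ => hF.
have intr_sign (R : pzRingType) (x : bool) : ((-1) ^+ x : int)%:~R = (-1) ^+ x :> R.
  by case: x; rewrite ?expr0 ?expr1 ?mulrNz.
(* [E] and F_l share the characteristic, so Euler's criterion in F_l, read as a divisibility of
   integers, passes to [E]. *)
have /eqP : (t ^+ l./2 - (-1) ^+ c)%:~R == 0 :> E.
  rewrite (intr_pchar_eq0 _ E_char) -(intr_pchar_eq0 _ (pchar_Fp l_pr)).
  by rewrite intrB rmorphXn /= hF intr_sign subrr.
rewrite intrB rmorphXn /= intr_sign /t intrM intr_sign -pmulrn hE => /eqP; rewrite subr_eq0 => /eqP.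
move/(sign_inj (two_neq0_pchar l_pr l_odd E_char)) => ->.
rewrite /c intrM intr_sign -[nonres l p]/(nonsquare _) -ep.
have pF : (p%:Z)%:~R != 0 :> 'F_l by rewrite intr_Fp_eq0 //= dvdn_prime2 // eq_sym.
rewrite nonsquareM ?signr_eq0 ?odd_card_Fp // -addbA addbb addbF.
case: (e); rewrite ?expr0 ?expr1 /=.
  by rewrite -(nonresN1 l_pr l_odd) /nonres mulrNz mulr1z.
by rewrite -(expr1n _ 2) nonsquare_sqr.
Qed.

(** Since l^2 = 1 modulo 8, the field with l^2 elements has a primitive eighth root of unity [zeta],
    and [zeta + zeta^-1] is a root of 2. Frobenius fixes or negates it according to [l] modulo 8. *)
Theorem nonres2 l : prime l -> odd l -> nonres l 2 = (l %% 8 \in [:: 3; 5])%N.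
Proof.
move=> l_pr l_odd.
have [E E_char cardE] := pPrimePowerField l_pr (isT : 0 < 2)%N.
have [z z_prim] := finfield_prim_root E.
have l8 : (l %% 8 \in [:: 1; 3; 5; 7])%N by rewrite !inE; lia.
have dvd8 : (8 %| #|E|.-1)%N.
  rewrite cardE -subn1 -eqn_mod_dvd ?expn_gt0 ?prime_gt0 // -modnXm.
  by move: l8; rewrite !inE => /or4P[] /eqP ->.
have zeta_prim := dvdn_prim_root z_prim dvd8; set zeta := z ^+ _ in zeta_prim.
have E2 := two_neq0_pchar l_pr l_odd E_char.
have zeta4 : zeta ^+ 4 = -1.
  have : (zeta ^+ 4) ^+ 2 == 1 by rewrite -exprM (prim_expr_order zeta_prim).
  by rewrite sqrf_eq1 -(prim_order_dvd zeta_prim) => /orP[//|/eqP].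
have zeta0 := prim_root_neq0 zeta_prim.
pose y := zeta + zeta^-1.
have y2 : y ^+ 2 = 2.
  have -> : y ^+ 2 = (zeta ^+ 4 + 1) / zeta ^+ 2 + 2 by rewrite /y; field.
  by rewrite zeta4 addNr mul0r add0r.
have y0 : y != 0.
  by apply: contraNneq E2 => y0; rewrite -y2 y0 expr0n.
have yl : y ^+ l = (-1) ^+ (l %% 8 \in [:: 3; 5])%N * y.
  rewrite -(pFrobenius_autE E_char) rmorphD fmorphV /= !pFrobenius_autE.
  rewrite -(prim_expr_mod zeta_prim l).
  move: l8; rewrite !inE => /or4P[] /eqP -> /=; rewrite ?expr0 ?expr1 ?mul1r ?mulN1r //.
  - have -> : zeta ^+ 3 = zeta ^+ 4 / zeta by rewrite [zeta ^+ 4]exprSr mulfK.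
    by rewrite zeta4 mulN1r invrN invrK /y; ring.
  - have -> : zeta ^+ 5 = zeta ^+ 4 * zeta by rewrite -exprSr.
    by rewrite zeta4 mulN1r invrN /y; ring.
  - have -> : zeta ^+ 7 = zeta ^+ 4 * zeta ^+ 4 / zeta.
      by rewrite -exprD -[(4 + 4)%N]/8%N [zeta ^+ 8]exprSr mulfK.
    by rewrite zeta4 mulrNN mulr1 mul1r invrK /y addrC.
have tF : (2 : int)%:~R != 0 :> 'F_l.
  by rewrite intr_Fp_eq0 // dvdn_prime2 //; apply: contraTneq l_odd => ->.
have := euler_criterion (odd_card_Fp l_pr l_odd) tF; rewrite card_Fp //.
rewrite -/(nonres l 2) => hF; apply: (sign_inj E2).
have /eqP : (2 ^+ l./2 - (-1) ^+ nonres l 2 : int)%:~R == 0 :> E.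
  rewrite (intr_pchar_eq0 _ E_char) -(intr_pchar_eq0 _ (pchar_Fp l_pr)).
  by rewrite intrB !rmorphXn /= hF mulrNz mulr1z subrr.
rewrite intrB !rmorphXn /= mulrNz mulr1z => /eqP; rewrite subr_eq0 => /eqP <-.
apply: (mulIf y0); rewrite -yl -[_%:~R]/(2 : E) -y2 -exprM -exprSr.
by congr (_ ^+ _); lia.
Qed.

(** * Hilbert symbols and the product formula *)

Definition unit_part (v : nat) (n : int) : int := (n %/ (v ^ logn v `|n|)%:Z)%Z.

Lemma unit_partK v n : unit_part v n * (v ^ logn v `|n|)%:Z = n.
Proof. by rewrite divzK // dvdzE /= pfactor_dvdnn. Qed.

Section UnitPart.
Variable v : nat.
Hypothesis v_pr : prime v.

Lemma unit_part_ndvd n : n != 0 -> ~~ (v %| `|unit_part v n|)%N.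
Proof.
move=> n0; have absn : (0 < `|n|)%N by rewrite absz_gt0.
have def_n := congr1 absz (unit_partK v n); rewrite abszM /= in def_n.
apply/negP => /dvdnP[k def_u].
have : (v ^ (logn v `|n|).+1 %| `|n|)%N.
  by apply/dvdnP; exists k; rewrite -[in LHS]def_n def_u expnS mulnA.
by rewrite pfactor_dvdn // ltnn.
Qed.

Lemma unit_part_unique u k : ~~ (v %| `|u|)%N ->
  logn v `|u * (v ^ k)%:Z| = k /\ unit_part v (u * (v ^ k)%:Z) = u.
Proof.
move=> vu; have vk : (0 < v ^ k)%N by rewrite expn_gt0 prime_gt0.
have u0 : (0 < `|u|)%N by case: (`|u|)%N vu => //; rewrite dvdn0.
have e : logn v `|u * (v ^ k)%:Z| = k.
  by rewrite abszM lognM // pfactorK // lognE v_pr u0 (negbTE vu).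
by split=> //; rewrite /unit_part e mulzK // eqz_nat -lt0n.
Qed.

Lemma unit_part_unit u : ~~ (v %| `|u|)%N -> logn v `|u| = 0%N /\ unit_part v u = u.
Proof. by move=> /(unit_part_unique 0); rewrite mulr1. Qed.

Lemma unit_partM a b : a != 0 -> b != 0 ->
  unit_part v (a * b) = unit_part v a * unit_part v b.
Proof.
move=> a0 b0; rewrite -{1}(unit_partK v a) -{1}(unit_partK v b) mulrACA -PoszM -expnD.
by apply: (unit_part_unique _ _).2; rewrite abszM Euclid_dvdM // negb_or !unit_part_ndvd.
Qed.

End UnitPart.

(* The class of [n] in the quotient of the nonzero v-adic numbers by the
   squares: the parity of the valuation, followed by the quadratic character
   of the unit part (odd [v]) or by its residues modulo 4 and 8 ([v = 2]). *)
Definition sq_class (v : nat) (n : int) : bool * bool * bool :=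
  let u := unit_part v n in
  if (v == 2)%N then (odd (logn v `|n|), (u == 3 %[mod 4])%Z,
                  (u == 3 %[mod 8])%Z || (u == 5 %[mod 8])%Z)
  else (odd (logn v `|n|), nonres v u, false).

Definition add_class (s t : bool * bool * bool) : bool * bool * bool :=
  (s.1.1 (+) t.1.1, s.1.2 (+) t.1.2, s.2 (+) t.2).

(** The classical explicit formulas for the Hilbert symbol, written additively: the tame symbol for
    odd [v], and e(u)e(u') + alpha w(u') + alpha' w(u) at 2, with e and w the characters modulo 4
    and 8 and alpha the valuation. *)
Definition class_pairing (v : nat) (s t : bool * bool * bool) : bool :=
  let: (s1, s2, s3) := s in let: (t1, t2, t3) := t in
  if (v == 2)%N then (s2 && t2) (+) (s1 && t3) (+) (s3 && t1)
  else [&& s1, t1 & (v %% 4 == 3)%N] (+) (s2 && t1) (+) (s1 && t2).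

(* The Hilbert symbol of [a] and [b] at [v], [true] standing for [-1]. *)
Definition hilbert (v : nat) (a b : int) : bool :=
  class_pairing v (sq_class v a) (sq_class v b).

Definition local_square (v : nat) (n : int) : bool :=
  sq_class v n == (false, false, false).

Lemma class_pairingDl v s s' t :
  class_pairing v (add_class s s') t = class_pairing v s t (+) class_pairing v s' t.
Proof.
move: s s' t => [[s1 s2] s3] [[s1' s2'] s3'] [[t1 t2] t3]; rewrite /class_pairing /=.
case: eqP => _; case: (v %% 4 == 3)%N;
by case: s1 s2 s3 s1' s2' s3' t1 t2 t3 => [] [] [] [] [] [] [] [] [].
Qed.

Lemma class_pairingC v s t : class_pairing v s t = class_pairing v t s.
Proof.
move: s t => [[s1 s2] s3] [[t1 t2] t3]; rewrite /class_pairing /=.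
case: eqP => _; case: (v %% 4 == 3)%N;
by case: s1 s2 s3 t1 t2 t3 => [] [] [] [] [] [].
Qed.

Lemma hilbertC v a b : hilbert v a b = hilbert v b a.
Proof. exact: class_pairingC. Qed.

Lemma odd_prime_neq2 v : prime v -> (v != 2)%N -> odd v.
Proof. by move=> v_pr v2; have [/eqP|//] := even_prime v_pr; rewrite (negbTE v2). Qed.

Lemma mod8_class_mul (x y : int) : ~~ (2 %| `|x|)%N -> ~~ (2 %| `|y|)%N ->
  ((x * y == 3 %[mod 4])%Z = (x == 3 %[mod 4])%Z (+) (y == 3 %[mod 4])%Z) /\
  ((x * y == 3 %[mod 8])%Z || (x * y == 5 %[mod 8])%Z =
   ((x == 3 %[mod 8])%Z || (x == 5 %[mod 8])%Z) (+)
   ((y == 3 %[mod 8])%Z || (y == 5 %[mod 8])%Z)).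
Proof.
move=> x2 y2.
have red (z : int) : ~~ (2 %| `|z|)%N -> exists k : int, exists2 i : int, i \in [:: 1; 3; 5; 7] & z = k * 8 + i.
  move=> z2; exists (z %/ 8)%Z, (z %% 8)%Z; last exact: divz_eq.
  by rewrite !inE; move: z2; rewrite -[(2 %| `|z|)%N]/((2 %| z)%Z); lia.
have [k [i i_in ->]] := red x x2; have [k' [j j_in ->]] := red y y2.
have -> : (k * 8 + i) * (k' * 8 + j) = (k * 8 * k' + k * j + k' * i) * 8 + i * j by ring.
have m8 (q r s : int) : (q * 8 + r == s %[mod 8])%Z = (r == s %[mod 8])%Z by rewrite modzMDl.
have m4 (q r s : int) : (q * 8 + r == s %[mod 4])%Z = (r == s %[mod 4])%Z.
  by rewrite (_ : q * 8 = (q * 2) * 4) ?modzMDl //; ring.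
rewrite !m8 !m4; move: i_in j_in; rewrite !inE.
by move=> /or4P[] /eqP -> /or4P[] /eqP ->.
Qed.

Lemma sq_classM v a b : prime v -> a != 0 -> b != 0 ->
  sq_class v (a * b) = add_class (sq_class v a) (sq_class v b).
Proof.
move=> v_pr a0 b0; rewrite /sq_class unit_partM // abszM lognM ?absz_gt0 // oddD.
have ua := unit_part_ndvd v_pr a0; have ub := unit_part_ndvd v_pr b0.
case: eqVneq => [v2|v2]; last by rewrite nonresM // odd_prime_neq2.
by rewrite v2 in ua ub *; have [-> ->] := mod8_class_mul ua ub.
Qed.

Lemma hilbertMl v a a' b : prime v -> a != 0 -> a' != 0 ->
  hilbert v (a * a') b = hilbert v a b (+) hilbert v a' b.
Proof. by move=> v_pr a0 a0'; rewrite /hilbert sq_classM // class_pairingDl. Qed.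

Lemma hilbertMr v a b b' : prime v -> b != 0 -> b' != 0 ->
  hilbert v a (b * b') = hilbert v a b (+) hilbert v a b'.
Proof. by move=> v_pr b0 b0'; rewrite hilbertC hilbertMl // !(hilbertC _ a). Qed.

Lemma sq_class_unit v a : prime v -> (v != 2)%N -> ~~ (v %| `|a|)%N ->
  sq_class v a = (false, nonres v a, false).
Proof. by move=> v_pr v2 /(unit_part_unit v_pr)[e1 e2]; rewrite /sq_class (negbTE v2) e1 e2. Qed.

Lemma sq_class_odd a : ~~ (2 %| `|a|)%N ->
  sq_class 2 a = (false, (a == 3 %[mod 4])%Z, (a == 3 %[mod 8])%Z || (a == 5 %[mod 8])%Z).
Proof. by move=> /(unit_part_unit (isT : prime 2))[e1 e2]; rewrite /sq_class /= e1 e2. Qed.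

Lemma sq_class_self v : prime v -> sq_class v v = (true, false, false).
Proof.
move=> v_pr; have [|e1 e2] := @unit_part_unique v v_pr 1 1.
  by rewrite dvdn1; apply: contraTneq v_pr => ->.
rewrite mul1r expn1 in e1 e2; rewrite /sq_class e1 e2.
by case: eqVneq => // v2; rewrite nonres1.
Qed.

Lemma sq_class_sqr v a : prime v -> a != 0 -> sq_class v (a ^+ 2) = (false, false, false).
Proof. by move=> v_pr a0; rewrite expr2 sq_classM // /add_class !addbb. Qed.

Lemma hilbert_unit v a b : prime v -> (v != 2)%N -> ~~ (v %| `|a|)%N -> ~~ (v %| `|b|)%N ->
  hilbert v a b = false.
Proof.
by move=> v_pr v2 va vb; rewrite /hilbert !sq_class_unit // /class_pairing (negbTE v2) !andbF.
Qed.

Lemma class_pairing0 v t : class_pairing v (false, false, false) t = false.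
Proof. by case: t => [[t1 t2] t3]; rewrite /class_pairing; case: ifP. Qed.

(** By nondegeneracy [s] and [t] are nonzero linear forms over F_2; equal or independent, they take
    the value 1 together. For odd [v] the third coordinate is padding, invisible to the pairing, so
    it is kept false. *)
Lemma class_pairing_separate v s t : ((v != 2)%N -> ~~ s.2 /\ ~~ t.2) ->
  s != (false, false, false) -> t != (false, false, false) ->
  exists x, [/\ (v != 2)%N -> ~~ x.2, class_pairing v x s & class_pairing v x t].
Proof.
move: s t => [[s1 s2] s3] [[t1 t2] t3] /=; rewrite /class_pairing.
case: eqVneq => [_ _|_ /(_ isT)[/negbTE -> /negbTE ->]] /=.
  case: s1 s2 s3 t1 t2 t3 => [] [] [] [] [] [] s0 t0;
    solve [by []|by exists (true,true,true)|by exists (true,true,false)|by exists (true,false,true)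
      |by exists (true,false,false)|by exists (false,true,true)|by exists (false,true,false)
      |by exists (false,false,true)].
case: (v %% 4 == 3)%N; case: s1 s2 t1 t2 => [] [] [] [] s0 t0;
  solve [by []|by exists (true,true,false)|by exists (true,false,false)|by exists (false,true,false)].
Qed.

Definition hilbert_inf (a b : int) : bool := (a < 0) && (b < 0).

(** The product of the symbols over the real place and the primes below [N]; the symbols at larger
    primes vanish once [N] exceeds 2 and both absolute values. *)
Definition hilbert_total (N : nat) (a b : int) : bool :=
  hilbert_inf a b (+) \big[addb/false]_(0 <= v < N | prime v) hilbert v a b.

Lemma hilbert_totalC N a b : hilbert_total N a b = hilbert_total N b a.
Proof.
rewrite /hilbert_total /hilbert_inf andbC; congr (_ (+) _).
by apply: eq_bigr => v _; apply: hilbertC.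
Qed.

Lemma hilbert_totalMl N a a' b : a != 0 -> a' != 0 ->
  hilbert_total N (a * a') b = hilbert_total N a b (+) hilbert_total N a' b.
Proof.
move=> a0 a0'; rewrite /hilbert_total addbACA -big_split /=; congr (_ (+) _).
  rewrite /hilbert_inf; have -> : (a * a' < 0) = (a < 0) (+) (a' < 0).
    by case: (ltgtP a 0) a0 (ltgtP a' 0) a0' => // ? _ [] // ? _; apply/idP/idP; nia.
  by case: (a < 0) (a' < 0) (b < 0) => [] [] [].
by apply: eq_bigr => v v_pr; apply: hilbertMl.
Qed.

Lemma big_xor_support (f : nat -> bool) N (s : seq nat) : uniq s ->
  all (fun v => prime v && (v < N)%N) s ->
  (forall v, prime v -> v \notin s -> f v = false) ->
  \big[addb/false]_(0 <= v < N | prime v) f v = \big[addb/false]_(v <- s) f v.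
Proof.
move=> s_uniq /allP s_pr f0; rewrite (bigID (mem s)) /= [X in _ (+) X]big1 ?addbF.
  rewrite -big_filter; apply: perm_big; apply: uniq_perm => //.
    by rewrite filter_uniq // iota_uniq.
  move=> v; rewrite mem_filter mem_index_iota /= andbC.
  have [vs|] := boolP (v \in s); last by rewrite !andbF.
  by have /andP[-> ->] := s_pr v vs.
by move=> v /andP[]; apply: f0.
Qed.

Lemma int_prime_ind (P : int -> Prop) : P (-1) -> (forall p : nat, prime p -> P p) ->
  (forall a b, a != 0 -> b != 0 -> P a -> P b -> P (a * b)) -> forall a, a != 0 -> P a.
Proof.
move=> PN1 Pp PM.
have P1 : P 1 by exact: (PM (-1) (-1)).
have Pnat n : (0 < n)%N -> P n.
  elim/ltn_ind: n => n IHn n_gt0; have [n_gt1|n_le1] := ltnP 1 n; last first.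
    by have -> : n = 1%N by lia.
  have r_pr := pdiv_prime n_gt1; have r_gt1 := prime_gt1 r_pr.
  have def_n : n = (pdiv n * (n %/ pdiv n))%N by rewrite mulnC divnK // pdiv_dvd.
  have M_gt0 : (0 < n %/ pdiv n)%N by rewrite divn_gt0 ?pdiv_gt0 // pdiv_leq.
  rewrite def_n PoszM; apply: PM; rewrite ?eqz_nat -?lt0n ?pdiv_gt0 //; first exact: Pp.
  by apply: IHn => //; rewrite ltn_Pdiv.
case=> n a0; first by apply: Pnat; rewrite lt0n.
by rewrite NegzE -mulN1r; apply: PM => //; apply: Pnat.
Qed.

Lemma odd_classE (q : nat) : odd q ->
  sq_class 2 q = (false, (q %% 4 == 3)%N, (q %% 8 \in [:: 3; 5])%N).
Proof.
move=> q_odd; rewrite sq_class_odd /=; last by rewrite dvdn2 q_odd.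
by rewrite !modz_nat !inE.
Qed.

Lemma sq_class_N1 v : prime v ->
  sq_class v (-1) = (false, (v == 2)%N || (v %% 4 == 3)%N, false).
Proof.
move=> v_pr; case: eqVneq => [->|v2]; first by rewrite sq_class_odd.
rewrite sq_class_unit ?nonresN1 ?odd_prime_neq2 //.
by rewrite dvdn1; apply: contraTneq v_pr => ->.
Qed.

Lemma prime_ndvd p q : prime p -> prime q -> p != q -> ~~ (p %| q)%N.
Proof. by move=> p_pr q_pr pq; rewrite dvdn_prime2. Qed.

(** For distinct odd primes this is quadratic reciprocity, with a single 2 its supplement. For p = q
    odd, the places 2 and p both see whether p is 3 modulo 4. *)
Lemma hilbert_total_primes N p q : prime p -> prime q -> (2 < N)%N -> (p < N)%N -> (q < N)%N ->
  hilbert_total N p q = false.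
Proof.
move=> p_pr q_pr N2 pN qN.
have ex2 (r : nat) : prime r -> r != 2%N -> (r < N)%N -> hilbert_total N 2 r = false.
  move=> r_pr r2 rN; have r_odd := odd_prime_neq2 r_pr r2; rewrite /hilbert_total /hilbert_inf /=.
  rewrite (@big_xor_support _ _ [:: 2%N; r]) /= ?inE ?r_pr ?rN ?N2 ?[2%N == r]eq_sym ?r2 //.
    rewrite big_cons big_seq1 /hilbert !sq_class_self // odd_classE //.
    rewrite [sq_class r 2]sq_class_unit ?prime_ndvd // nonres2 //.
    by rewrite /class_pairing /= (negbTE r2) ?andbF ?andbT /= ?addbF addbb.
  move=> v v_pr; rewrite !inE negb_or => /andP[v2 vr].
  by apply: hilbert_unit => //; apply: prime_ndvd.
have [->|p2] := eqVneq p 2%N.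
  have [->|q2] := eqVneq q 2%N; last exact: ex2.
  rewrite /hilbert_total /hilbert_inf /= (@big_xor_support _ _ [:: 2%N]) /= ?N2 //.
    by rewrite big_seq1 /hilbert sq_class_self.
  move=> v v_pr; rewrite !inE => v2.
  by apply: hilbert_unit => //; apply: prime_ndvd.
have [->|q2] := eqVneq q 2%N; first by rewrite hilbert_totalC; apply: ex2.
have p_odd := odd_prime_neq2 p_pr p2; have q_odd := odd_prime_neq2 q_pr q2.
rewrite /hilbert_total /hilbert_inf /=.
have [<-|pq] := eqVneq p q.
  rewrite (@big_xor_support _ _ [:: 2%N; p]) /= ?inE ?p_pr ?pN ?N2 ?[2%N == p]eq_sym ?p2 //.
    rewrite big_cons big_seq1 /hilbert !sq_class_self // odd_classE //.
    by rewrite /class_pairing /= (negbTE p2) !andbF; case: (p %% 4 == 3)%N.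
  move=> v v_pr; rewrite !inE negb_or => /andP[v2 vr].
  by apply: hilbert_unit => //; apply: prime_ndvd.
rewrite (@big_xor_support _ _ [:: 2%N; p; q]) /=.
- rewrite !big_cons big_nil /hilbert !sq_class_self // !odd_classE //.
  rewrite [sq_class p q]sq_class_unit ?prime_ndvd // [sq_class q p]sq_class_unit ?prime_ndvd //; last by rewrite eq_sym.
  rewrite /class_pairing /= (negbTE p2) (negbTE q2) ?andbF ?andbT /= ?addbF.
  by rewrite quadratic_reciprocity // addbb.
- by rewrite !inE negb_or ![2%N == _]eq_sym p2 q2 pq.
- by rewrite N2 p_pr q_pr pN qN.
- move=> v v_pr; rewrite !inE !negb_or => /and3P[v2 vp vq].
  by apply: hilbert_unit => //; apply: prime_ndvd.
Qed.

Lemma hilbert_total_N1 N q : prime q -> (2 < N)%N -> (q < N)%N ->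
  hilbert_total N (-1) q = false.
Proof.
move=> q_pr N2 qN; rewrite /hilbert_total /hilbert_inf /=.
have [->|q2] := eqVneq q 2%N.
  rewrite (@big_xor_support _ _ [:: 2%N]) /= ?N2 //.
    by rewrite big_seq1 /hilbert sq_class_self // sq_class_N1.
  move=> v v_pr; rewrite !inE => v2.
  apply: hilbert_unit => //; last exact: prime_ndvd.
  by rewrite dvdn1; apply: contraTneq v_pr => ->.
have q_odd := odd_prime_neq2 q_pr q2.
rewrite (@big_xor_support _ _ [:: 2%N; q]) /= ?inE ?q_pr ?qN ?N2 ?[2%N == q]eq_sym ?q2 //.
  rewrite big_cons big_seq1 /hilbert !sq_class_N1 // sq_class_self // odd_classE //.
  by rewrite /class_pairing /= (negbTE q2) ?andbF ?andbT /= ?addbF addbb.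
move=> v v_pr; rewrite !inE negb_or => /andP[v2 vr].
apply: hilbert_unit => //; last exact: prime_ndvd.
by rewrite dvdn1; apply: contraTneq v_pr => ->.
Qed.

Lemma hilbert_total_N1N1 N : (2 < N)%N -> hilbert_total N (-1) (-1) = false.
Proof.
move=> N2; rewrite /hilbert_total /hilbert_inf /= (@big_xor_support _ _ [:: 2%N]) /= ?N2 //.
  by rewrite big_seq1 /hilbert sq_class_N1.
move=> v v_pr; rewrite !inE => v2.
by apply: hilbert_unit => //; rewrite dvdn1; apply: contraTneq v_pr => ->.
Qed.

Theorem hilbert_product N a b : a != 0 -> b != 0 ->
  (2 < N)%N -> (`|a| < N)%N -> (`|b| < N)%N -> hilbert_total N a b = false.
Proof.
move=> a0 b0 N2.
have factor_lt (x y : int) : x != 0 -> y != 0 -> (`|(x * y)%R| < N)%N -> (`|x| < N)%N /\ (`|y| < N)%N.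
  by rewrite -!absz_gt0 abszM; nia.
have right_ind (c : int) : ((`|c| < N)%N -> hilbert_total N c (-1) = false) ->
    (forall p : nat, prime p -> (`|c| < N)%N -> (p < N)%N -> hilbert_total N c p = false) ->
    (`|c| < N)%N -> (`|b| < N)%N -> hilbert_total N c b = false.
  move=> hN1 hp cN; move: b b0; apply: int_prime_ind => [_||x y x0 y0 hx hy xyN].
  - exact: hN1.
  - by move=> p p_pr pN; apply: hp.
  - have [xN yN] := factor_lt _ _ x0 y0 xyN.
    by rewrite hilbert_totalC hilbert_totalMl // ![hilbert_total _ _ c]hilbert_totalC hx ?hy.
move: a a0; apply: int_prime_ind => [||x y x0 y0 hx hy xyN bN].
- apply: right_ind => [_|p p_pr _ pN]; first exact: hilbert_total_N1N1.
  exact: hilbert_total_N1.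
- move=> p p_pr; apply: right_ind => [pN|q q_pr pN qN].
    by rewrite hilbert_totalC hilbert_total_N1.
  exact: hilbert_total_primes.
have [xN yN] := factor_lt _ _ x0 y0 xyN.
by rewrite hilbert_totalMl // hx ?hy.
Qed.

(** * Legendre's theorem *)

Definition ternary_isotropic (a b : int) : Prop :=
  exists x y z : int, ~~ [&& x == 0, y == 0 & z == 0] /\ z ^+ 2 = a * x ^+ 2 + b * y ^+ 2.

Lemma ternary_isotropicC a b : ternary_isotropic a b -> ternary_isotropic b a.
Proof.
move=> [x [y [z [xyz e]]]]; exists y, x, z; split; last by rewrite addrC.
by rewrite andbCA.
Qed.

Lemma sqrt_mod_prime (l : nat) (b : int) : prime l -> ~~ nonres l b ->
  exists t : int, (l %| t ^+ 2 - b)%Z.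
Proof.
move=> l_pr; rewrite negbK => /existsP[y /eqP y2]; exists (val y)%:Z.
rewrite dvdzE /= -intr_Fp_eq0 // intrB rmorphXn /= -pmulrn natr_Zp y2 subrr //.
Qed.

Lemma sqrt_mod_squarefree (n : nat) (b : int) : (0 < n)%N ->
  (forall l, prime l -> ~~ (l ^ 2 %| n)%N) ->
  (forall l, prime l -> (l %| n)%N -> exists t : int, (l %| t ^+ 2 - b)%Z) ->
  exists t : int, (n %| t ^+ 2 - b)%Z.
Proof.
elim/ltn_ind: n => n IHn n_gt0 sqf roots.
have [n_gt1|n_le1] := ltnP 1 n; last by exists 0; have -> : n = 1%N by [lia]; rewrite dvd1z.
have r_pr := pdiv_prime n_gt1; set r := pdiv n in r_pr.
have r_gt1 := prime_gt1 r_pr.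
have rn : (r %| n)%N by apply: pdiv_dvd.
have def_n : n = (r * (n %/ r))%N by rewrite mulnC divnK.
set M := (n %/ r)%N in def_n; have M_gt0 : (0 < M)%N by rewrite divn_gt0 ?pdiv_gt0 // pdiv_leq.
have Mn : (M %| n)%N by rewrite def_n dvdn_mull.
have [|||| t2 ht2] := IHn M.
- by rewrite def_n; nia.
- by [].
- by move=> l /sqf; apply: contra => /dvdn_trans; apply.
- by move=> l l_pr lM; apply: roots => //; apply: dvdn_trans lM Mn.
have [t1 ht1] := roots r r_pr rn.
have cop : coprimez r M.
  rewrite coprimezE /= prime_coprime //; apply: contra (sqf r r_pr) => rM.
  by rewrite def_n expnS expn1 dvdn_pmul2l ?prime_gt0.
exists (zchinese r M t1 t2); rewrite def_n PoszM Gauss_dvdz //.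
set t := zchinese _ _ _ _.
have red (m : int) (s : int) : (t = s %[mod m])%Z -> (m %| s ^+ 2 - b)%Z -> (m %| t ^+ 2 - b)%Z.
  move=> /eqP; rewrite eqz_mod_dvd => ts sb.
  have -> : t ^+ 2 - b = (t - s) * (t + s) + (s ^+ 2 - b) by ring.
  by apply: rpredD => //; apply: dvdz_mulr.
by apply/andP; split; [apply: red ht1; apply: zchinese_modl|apply: red ht2; apply: zchinese_modr].
Qed.

Lemma sqrt_mod_small (n : nat) (b : int) : (0 < n)%N ->
  (exists t : int, (n %| t ^+ 2 - b)%Z) ->
  exists t : int, (n %| t ^+ 2 - b)%Z /\ (2 * `|t| <= n)%N.
Proof.
move=> n_gt0 [t ht].
have red (k : int) : (n %| (t - k * n) ^+ 2 - b)%Z.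
  have -> : (t - k * n) ^+ 2 - b = (t ^+ 2 - b) + (k ^+ 2 * n%:Z - 2 * k * t) * n by ring.
  by apply: rpredD => //; apply: dvdz_mull.
have n0 : n%:Z != 0 by rewrite eqz_nat -lt0n.
have e : t - (t %/ n)%Z * n = (t %% n)%Z by [].
have r0 := modz_ge0 t n0; have r1 := ltz_pmod t (_ : 0 < n%:Z).
have {}r1 : (t %% n)%Z < n by apply: r1; rewrite ltz_nat.
have [h|h] := leP (2 * (t %% n)%Z) n.
  exists (t %% n)%Z; split; first by rewrite -e.
  by lia.
exists ((t %% n)%Z - n%:Z); split; last by lia.
by have := red ((t %/ n)%Z + 1); rewrite mulrDl mul1r opprD addrA e.
Qed.

(** [t ^+ 2 - b] is a norm from Q(sqrt b). As [b] has valuation at most 1 at [l], three cases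
    suffice: [l] divides neither [b] nor more is asked of [t], [l] divides [b] only, or [l] divides
    both. *)
Lemma hilbert_norm l (t b : int) : prime l -> (l != 2)%N -> b != 0 -> ~~ (l ^ 2 %| `|b|)%N ->
  t ^+ 2 - b != 0 -> hilbert l (t ^+ 2 - b) b = false.
Proof.
move=> l_pr l2 b0 lb n0; have l_odd := odd_prime_neq2 l_pr l2.
have nonres_mod x y : (l %| x - y)%Z -> nonres l x = nonres l y.
  by rewrite -eqz_mod_dvd => /eqP; apply: eq_nonres.
have [lb1|lb1] := boolP (l %| `|b|)%N; last first.
  rewrite /hilbert [sq_class l b]sq_class_unit //.
  have [ln|ln] := boolP (l %| `|(t ^+ 2 - b)%R|)%N.
    rewrite -(nonres_mod (t ^+ 2)) ?dvdzE // nonres_sqr.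
    by rewrite class_pairingC class_pairing0.
  by rewrite sq_class_unit // /class_pairing (negbTE l2) /= !andbF.
have [b' def_b] : exists b', b = l%:Z * b' by have /dvdzP[b' ->] : (l %| b)%Z by []; exists b'; rewrite mulrC.
have lb' : ~~ (l %| `|b'|)%N.
  by apply: contra lb => lb'; rewrite def_b abszM /= expnS expn1 dvdn_pmul2l ?prime_gt0.
have l0 : l%:Z != 0 by rewrite eqz_nat -lt0n prime_gt0.
have b'0 : b' != 0 by apply: contraNneq b0 => b'0; rewrite def_b b'0 mulr0.
have class_b : sq_class l b = (true, nonres l b', false).
  by rewrite def_b sq_classM // sq_class_self // sq_class_unit.
have [lt|lt] := boolP (l %| t)%Z; last first.
  have ln : (l %| t ^+ 2 - (t ^+ 2 - b))%Z by rewrite opprB addrC subrK.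
  have lt2 : ~~ (l %| t ^+ 2)%Z by rewrite dvdzE abszX Euclid_dvdX // negb_and lt.
  have ln' : ~~ (l %| `|(t ^+ 2 - b)%R|)%N.
    apply: contra lt2 => h; rewrite -(subrK b (t ^+ 2)).
    by apply: rpredD; rewrite ?dvdzE.
  rewrite /hilbert class_b sq_class_unit // -(nonres_mod _ _ ln) nonres_sqr.
  by rewrite class_pairing0.
have [t' def_t] : exists t', t = l%:Z * t' by have /dvdzP[t' ->] := lt; exists t'; rewrite mulrC.
pose u := l%:Z * t' ^+ 2 - b'.
have def_n : t ^+ 2 - b = l%:Z * u by rewrite /u def_t def_b; ring.
have lu : ~~ (l %| `|u|)%N.
  apply: contra lb' => h; have -> : b' = l%:Z * t' ^+ 2 - u by rewrite /u; ring.
  by rewrite -[(_ %| _)%N]/(l %| _)%Z; apply: rpredB; [apply: dvdz_mulr | rewrite dvdzE].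
have u0 : u != 0 by apply: contraNneq n0 => u0; rewrite def_n u0 mulr0.
have ru : nonres l u = (l %% 4 == 3)%N (+) nonres l b'.
  rewrite -nonresN1 // -nonresM //; last by rewrite dvdn1; apply: contraTneq l_pr => ->.
  by apply: nonres_mod; rewrite mulN1r opprK /u subrK; apply: dvdz_mulr.
rewrite /hilbert def_n sq_classM // sq_class_self // sq_class_unit // class_b ru.
rewrite /class_pairing (negbTE l2) /=; by case: (_ == _) (nonres _ _) => [] [].
Qed.

(** The new solution is the product of t + sqrt b and z + y sqrt b, whose norm is
    [a * a' * (a' * x ^+ 2)], that is [a * (a' * x) ^+ 2]. *)
Lemma sol_combine (a a' b t x y z : int) : a != 0 -> a' != 0 -> a * a' = t ^+ 2 - b ->
  ~~ [&& x == 0, y == 0 & z == 0] -> z ^+ 2 = a' * x ^+ 2 + b * y ^+ 2 ->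
  ternary_isotropic a b.
Proof.
move=> a0 a'0 def_a' xyz e; have [x0|x0] := eqVneq x 0.
  exists 0, y, z; rewrite eqxx; split; first by move: xyz; rewrite x0 eqxx.
  by rewrite e x0; ring.
exists (a' * x), (t * y + z), (t * z + b * y); split.
  by rewrite mulf_eq0 (negbTE a'0) (negbTE x0).
have -> : (t * z + b * y) ^+ 2 = (t ^+ 2 - b) * (z ^+ 2 - b * y ^+ 2) + b * (t * y + z) ^+ 2 by ring.
by rewrite -def_a' e; ring.
Qed.

Lemma strip_square (a b : int) (l : nat) : prime l -> (l ^ 2 %| `|a|)%N -> a != 0 -> b != 0 ->
  ~~ hilbert_inf a b -> (forall v, prime v -> (v != 2)%N -> hilbert v a b = false) ->
  exists a', [/\ a' != 0, (`|a'| < `|a|)%N, ~~ hilbert_inf a' b,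
    forall v, prime v -> (v != 2)%N -> hilbert v a' b = false
    & ternary_isotropic a' b -> ternary_isotropic a b].
Proof.
move=> l_pr la a0 b0 inf hil.
have [a' def_a] : exists a', a = l%:Z ^+ 2 * a'.
  by have /dvdzP[a' ->] : ((l ^ 2)%:Z %| a)%Z by []; exists a'; rewrite mulrC PoszM -expr2.
have l_gt1 := prime_gt1 l_pr; have l0 : l%:Z != 0 by rewrite eqz_nat; lia.
have a'0 : a' != 0 by apply: contraNneq a0 => a'0; rewrite def_a a'0 mulr0.
exists a'; split=> //.
- rewrite def_a abszM abszX /=; move: a'0; rewrite -absz_gt0; nia.
- by move: inf; rewrite def_a /hilbert_inf pmulr_rlt0 // exprn_even_gt0.
- move=> v v_pr v2; rewrite -(hil v v_pr v2) def_a hilbertMl // ?expf_neq0 //.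
  by rewrite {2}/hilbert sq_class_sqr // class_pairing0.
move=> [x [y [z [xyz e]]]]; exists x, (l%:Z * y), (l%:Z * z); split.
  by rewrite !mulf_eq0 (negbTE l0).
by rewrite def_a exprMn e; ring.
Qed.

Lemma dvd2_mul_pred (b : int) : (2 %| b * (b - 1))%Z.
Proof. by rewrite dvdzE abszM Euclid_dvdM //; lia. Qed.

(** Dividing by |a| gives |c| <= |a|/4 + 1, which is below |a| from 2 on. *)
Lemma descent_lt (a b c t : int) : a * c = t ^+ 2 - b -> (2 * `|t| <= `|a|)%N ->
  (`|b| <= `|a|)%N -> (1 < `|a|)%N -> (`|c| < `|a|)%N.
Proof.
move=> e t_small leba a_gt1.
have h1 : (`|a| * `|c| <= `|t| ^ 2 + `|b|)%N by rewrite -abszM e -abszX; lia.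
by move: h1 t_small leba a_gt1; rewrite expnS expn1; clear; nia.
Qed.

(* Legendre's theorem, by Lagrange's descent.  No condition at 2 is needed:
   every integer is a square modulo 2. *)
Theorem legendre_isotropic (a b : int) : a != 0 -> b != 0 -> ~~ hilbert_inf a b ->
  (forall v, prime v -> (v != 2)%N -> hilbert v a b = false) -> ternary_isotropic a b.
Proof.
move: {2}(`|a| + `|b|)%N (leqnn (`|a| + `|b|)) => n; elim: n a b => [|n IHn] a b.
  by rewrite leqn0 addn_eq0 !absz_eq0 => /andP[-> _].
move=> leabn a0 b0 inf hil.
wlog leba : a b leabn a0 b0 inf hil / (`|b| <= `|a|)%N => [th|].
  case/orP: (leq_total `|b| `|a|) => h; first exact: th.
  apply: ternary_isotropicC; apply: th => //; first by rewrite addnC.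
    by rewrite /hilbert_inf andbC.
  by move=> v v_pr v2; rewrite hilbertC hil.
have [/hasP[l]|sqf_a] := boolP (has (fun l => l ^ 2 %| `|a|)%N (primes `|a|)).
  rewrite mem_primes => /andP[l_pr _] la.
  have [a' [a'0 lta' inf' hil' lift]] := strip_square l_pr la a0 b0 inf hil.
  by apply: lift; apply: IHn => //; lia.
have [/hasP[l]|sqf_b] := boolP (has (fun l => l ^ 2 %| `|b|)%N (primes `|b|)).
  rewrite mem_primes => /andP[l_pr _] lb.
  have inf2 : ~~ hilbert_inf b a by rewrite /hilbert_inf andbC.
  have hil2 v : prime v -> (v != 2)%N -> hilbert v b a = false.
    by move=> v_pr v2; rewrite hilbertC hil.
  have [b' [b'0 ltb' inf' hil' lift]] := strip_square l_pr lb b0 a0 inf2 hil2.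
  by apply/ternary_isotropicC/lift; apply: IHn => //; lia.
have sqf (c : int) : c != 0 -> ~~ has (fun l => l ^ 2 %| `|c|)%N (primes `|c|) ->
    forall l, prime l -> ~~ (l ^ 2 %| `|c|)%N.
  move=> c0 /hasPn h l l_pr; have [lc|lc] := boolP (l %| `|c|)%N.
    by apply: h; rewrite mem_primes l_pr lc absz_gt0 c0.
  by apply: contra lc; apply: dvdn_trans; rewrite expnS dvdn_mulr.
have {}sqf_a := sqf a a0 sqf_a; have {sqf}sqf_b := sqf b b0 sqf_b.
(* Both numbers are 1 or -1 here, and the real condition excludes a = b = -1. *)
have [a_gt1|a_le1] := ltnP 1 `|a|; last first.
  have [->|def_a] : a = 1 \/ a = -1 by lia.
    by exists 1, 0, 1; rewrite !expr1n expr0n mulr0 addr0 mulr1.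
  have -> : b = 1.
    have : ~~ (b < 0) by move: inf; rewrite def_a /hilbert_inf ltrN10.
    by move: b0 leba a_le1; lia.
  by exists 0, 1, 1; rewrite !expr1n expr0n mulr0 add0r mulr1.
have a_gt0 : (0 < `|a|)%N by rewrite absz_gt0.
have [t [at_b t_small]] : exists t : int, (`|a|%N %| t ^+ 2 - b)%Z /\ (2 * `|t| <= `|a|)%N.
  apply: sqrt_mod_small => //; apply: sqrt_mod_squarefree => // l l_pr la.
  have [->|l2] := eqVneq l 2%N.
    exists b; have -> : b ^+ 2 - b = b * (b - 1) by ring.
    exact: dvd2_mul_pred.
  have [lb|lb] := boolP (l %| b)%Z.
    by exists 0; rewrite expr0n /= sub0r rpredN.
  (* [l] divides [a] exactly once and does not divide [b], so a trivial symbol means that [b] is a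
     residue. *)
  apply: sqrt_mod_prime => //; have := hil l l_pr l2.
  rewrite /hilbert [sq_class l b]sq_class_unit //.
  have -> : sq_class l a = (true, nonres l (unit_part l a), false).
    rewrite /sq_class (negbTE l2); congr (_, _, _).
    have -> // : logn l `|a| = 1%N.
    apply/eqP; rewrite eqn_leq; have := sqf_a l l_pr; rewrite pfactor_dvdn // -leqNgt => ->.
    by rewrite -pfactor_dvdn // expn1.
  by rewrite /class_pairing (negbTE l2) /= !andbF /= => ->.
have [tb|tb] := eqVneq (t ^+ 2 - b) 0.
  exists 0, 1, t; split=> //; move/eqP: tb; rewrite subr_eq0 => /eqP ->.
  by rewrite expr1n expr0n mulr0 add0r mulr1.
have [a' def_a'] : exists a', a * a' = t ^+ 2 - b.
  have /dvdzP[a' ->] : (a %| t ^+ 2 - b)%Z by rewrite dvdzE -[`|a|%N]/(absz `|a|%N) -dvdzE.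
  by exists a'; rewrite mulrC.
have a'0 : a' != 0 by apply: contraNneq tb => a'0; rewrite -def_a' a'0 mulr0.
have lta' := descent_lt def_a' t_small leba a_gt1.
have leab' : (`|a'| + `|b| <= n)%N by rewrite -ltnS; apply: leq_trans leabn; rewrite ltn_add2r.
have inf' : ~~ hilbert_inf a' b.
  apply: contra inf => /andP[a'_lt0 b_lt0]; rewrite /hilbert_inf b_lt0 andbT.
  have : 0 < a * a' by rewrite def_a' subr_gt0 (lt_le_trans b_lt0) // sqr_ge0.
  by rewrite nmulr_lgt0.
have hil' v : prime v -> (v != 2)%N -> hilbert v a' b = false.
  move=> v_pr v2; have := hilbert_norm v_pr v2 b0 (sqf_b v v_pr) tb.
  by rewrite -def_a' hilbertMl // hil.
have [x [y [z [xyz e]]]] := IHn a' b leab' a'0 b0 inf' hil'.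
exact: sol_combine a0 a'0 def_a' xyz e.
Qed.

(** * Existence of a common slot *)

Lemma prod_primes_gt0 (s : seq nat) : all prime s -> (0 < \prod_(l <- s) l)%N.
Proof.
elim: s => [|l s IHs] /=; first by rewrite big_nil.
by move=> /andP[l_pr s_pr]; rewrite big_cons muln_gt0 prime_gt0 // IHs.
Qed.

Lemma dvdn_prod_primes (s : seq nat) v : all prime s -> prime v ->
  (v %| \prod_(l <- s) l)%N = (v \in s).
Proof.
elim: s => [|l s IHs] /=.
  by rewrite big_nil dvdn1 => _ v_pr; apply/negbTE; apply: contraTneq v_pr => ->.
move=> /andP[l_pr s_pr] v_pr.
by rewrite big_cons Euclid_dvdM // IHs // inE dvdn_prime2.
Qed.

Lemma logn_prod_primes (s : seq nat) v : uniq s -> all prime s -> prime v ->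
  logn v (\prod_(l <- s) l) = (v \in s).
Proof.
elim: s => [|l s IHs] /=; first by rewrite big_nil logn1.
move=> /andP[ls s_uniq] /andP[l_pr s_pr] v_pr.
rewrite big_cons lognM ?prod_primes_gt0 ?prime_gt0 // IHs // logn_prime // inE.
by case: eqVneq => [->|] //=; rewrite (negbTE ls).
Qed.

Lemma exists_mod_classes (S : seq nat) (a0 : nat) (c : nat -> bool) : odd a0 -> uniq S ->
  all prime S -> all odd S ->
  exists a : nat, [/\ coprime a (8 * \prod_(l <- S) l), a = a0 %[mod 8]
    & forall l : nat, l \in S -> nonres l a = c l].
Proof.
move=> a0_odd; elim: S => [|l S IHS] /=.
  exists a0; split=> //; rewrite big_nil muln1 -[8%N]/(2 ^ 3)%N coprimeXr //.
  by rewrite coprimen2.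
move=> /andP[lS S_uniq] /andP[l_pr S_pr] /andP[l_odd S_odd].
have [a [am a8 a_res]] := IHS S_uniq S_pr S_odd.
have [n [ln n_res]] : exists n : nat, ~~ (l %| n)%N /\ nonres l n = c l.
  case: (c l).
    by have [n ln nn] := nonres_exists l_pr l_odd; exists n; rewrite nn.
  exists 1%N; rewrite nonres1 //; split=> //.
  by rewrite dvdn1; apply: contraTneq l_pr => ->.
set m := (8 * \prod_(l <- S) l)%N in am.
have cop : coprime m l.
  rewrite coprime_sym prime_coprime // /m Euclid_dvdM // negb_or dvdn_prod_primes // lS andbT.
  rewrite -[8%N]/(2 ^ 3)%N Euclid_dvdX // negb_and dvdn_prime2 //.
  by apply/orP; left; apply: contraTneq l_odd => ->.
have m8 : (8 %| m)%N by rewrite dvdn_mulr.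
pose a' := chinese m l a n.
have e1 : a' = a %[mod m] by apply: chinese_modl.
have e2 : a' = n %[mod l] by apply: chinese_modr.
exists a'; split.
- rewrite big_cons mulnCA coprimeMr; apply/andP; split; last by rewrite -coprime_modl e1 coprime_modl.
  by rewrite -coprime_modl e2 coprime_modl coprime_sym prime_coprime.
- by rewrite -a8 -(modn_dvdm a' m8) e1 modn_dvdm.
- have eq_res (k x y : nat) : x = y %[mod k] -> prime k -> nonres k x = nonres k y.
    by move=> xy k_pr; apply: eq_nonres => //; rewrite !modz_nat xy.
  move=> k; rewrite inE => /orP[/eqP ->|kS]; first by rewrite (eq_res _ _ _ e2).
  have k_pr := allP S_pr k kS.
  rewrite -a_res //; apply: eq_res => //.
  have km : (k %| m)%N by rewrite dvdn_mull // dvdn_prod_primes.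
  by rewrite -(modn_dvdm a' km) e1 modn_dvdm.
Qed.

(** All prescribed symbols are real characters modulo 8 times the product of [S], so [prime_pattern]
    copies them from a solution [a] of the congruences to a prime. *)
Lemma exists_prime_classes (S : seq nat) (c : nat -> bool) (e w : bool) : uniq S ->
  all prime S -> all odd S ->
  exists r : nat, [/\ prime r, odd r, r \notin S, sq_class 2 r = (false, e, w)
    & forall l : nat, l \in S -> nonres l r = c l].
Proof.
move=> S_uniq S_pr S_odd.
(* The unit classes at 2: [e] says 3 modulo 4, [w] says 3 or 5 modulo 8. *)
pose a0 := (if e then if w then 3 else 7 else if w then 5 else 1)%N.
have a0_odd : odd a0 by rewrite /a0; case: (e) (w) => [] [].
have [a [am a8 a_res]] := exists_mod_classes c a0_odd S_uniq S_pr S_odd.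
set m := (8 * \prod_(l <- S) l)%N in am.
have m_gt0 : (0 < m)%N by rewrite muln_gt0 prod_primes_gt0.
have def_m : m = m.-1.+1 by rewrite prednK.
rewrite def_m in am; have [r [r_pr rm r_chars]] := prime_pattern am.
have char_eq (g : nat -> bool) : (forall n, g (n %% m.-1.+1)%N = g n) ->
    (forall x y, coprime x m.-1.+1 -> coprime y m.-1.+1 -> g (x * y)%N = g x (+) g y) ->
    g r = g a.
  move=> g_per gM; have := r_chars _ (mem_real_char g_per gM).
  by rewrite !ffunE /= !g_per !coprime_modl rm am.
rewrite -def_m in rm am char_eq.
have m8 : (8 %| m)%N by rewrite dvdn_mulr.
have cop2 x : coprime x m -> odd x.
  by rewrite /m coprimeMr -[8%N]/(2 ^ 3)%N coprime_pexpr // coprimen2 => /andP[].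
have per8 n k : (k %| 8)%N -> n %% m = n %[mod k].
  by move=> k8; rewrite modn_dvdm // (dvdn_trans k8).
have cls x y : odd x -> odd y ->
    add_class (false, (x %% 4 == 3)%N, (x %% 8 \in [:: 3; 5])%N)
              (false, (y %% 4 == 3)%N, (y %% 8 \in [:: 3; 5])%N) =
    (false, (x * y %% 4 == 3)%N, (x * y %% 8 \in [:: 3; 5])%N).
  move=> x_odd y_odd; rewrite -!odd_classE ?oddM ?x_odd // PoszM sq_classM //;
  by rewrite eqz_nat; apply: contraTneq x_odd => -> || apply: contraTneq y_odd => ->.
have r4 : (r %% 4 == 3)%N = (a %% 4 == 3)%N.
  apply: (char_eq (fun n => n %% 4 == 3)%N) => [n|x y /cop2 x_odd /cop2 y_odd].
    by rewrite per8.
  by have [<- _] := cls x y x_odd y_odd.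
have r8 : (r %% 8 \in [:: 3; 5])%N = (a %% 8 \in [:: 3; 5])%N.
  apply: (char_eq (fun n => n %% 8 \in [:: 3; 5])%N) => [n|x y /cop2 x_odd /cop2 y_odd].
    by rewrite per8.
  by have [_ <-] := cls x y x_odd y_odd.
have r_odd := cop2 _ rm.
exists r; split=> //.
- apply/negP => rS; move: rm; rewrite /m coprimeMr => /andP[_].
  by rewrite prime_coprime // dvdn_prod_primes // rS.
- rewrite odd_classE // r4 r8 -(@modn_dvdm 8 a 4) // a8 modn_dvdm //.
  by rewrite /a0; case: (e) (w) => [] [].
move=> l lS; rewrite -a_res //.
have l_pr := allP S_pr l lS; have l_odd := allP S_odd l lS.
have lm : (l %| m)%N by rewrite dvdn_mull // dvdn_prod_primes.
have ndvd x : coprime x m -> ~~ (l %| x)%N.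
  by move=> /(coprime_dvdr lm); rewrite coprime_sym prime_coprime.
apply: (char_eq (fun n => nonres l n)) => [n|x y xm ym].
  by apply: eq_nonres => //; rewrite !modz_nat modn_dvdm.
by rewrite PoszM nonresM ?ndvd.
Qed.

Lemma sq_class3 v n : (v != 2)%N -> (sq_class v n).2 = false.
Proof. by rewrite /sq_class => /negbTE ->. Qed.

(* With [v] ranging over the ramified places of the algebra (a, b), the integer
   [u] is chosen so that (u, b) and (u, d) both ramify exactly there: its classes
   are prescribed at the primes dividing 2abd, a further prime factor [r] of [u]
   realises them, and the product formula takes care of the place [r]. *)
Lemma exists_common_slot (a b d : int) : 0 < a -> b != 0 -> d != 0 ->
  (forall v, prime v -> hilbert v a b -> ~~ local_square v d) ->
  exists2 u : int, 0 < u &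
    forall v, prime v -> hilbert v u b = hilbert v a b /\ hilbert v u d = hilbert v a b.
Proof.
move=> a_gt0 b0 d0 hd; have a0 : a != 0 by rewrite gt_eqF.
pose n := (2 * (`|a| * (`|b| * `|d|)))%N; pose V := primes n.
have n_gt0 : (0 < n)%N by rewrite !muln_gt0 !absz_gt0 a0 b0 d0.
have memV v : prime v -> (v \in V) = [|| v == 2%N, v %| `|a|, v %| `|b| | v %| `|d|]%N.
  by move=> v_pr; rewrite mem_primes v_pr n_gt0 !Euclid_dvdM // dvdn_prime2.
have V_pr : all prime V by apply/allP => v; rewrite mem_primes => /andP[].
have V_uniq : uniq V by apply: primes_uniq.
pose good v (x : bool * bool * bool) := [&& (v != 2)%N ==> ~~ x.2,
  class_pairing v x (sq_class v b) == hilbert v a b &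
  class_pairing v x (sq_class v d) == hilbert v a b].
(* The target class of [u] at [v]; by [XP] it is good at every prime, so the default is harmless. *)
pose X v := odflt (false, false, false) [pick x | good v x].
have XP v : prime v -> good v (X v).
  move=> v_pr; rewrite /X; case: pickP => [x //|no]; exfalso.
  have [h|h] := boolP (hilbert v a b); last first.
    by have := no (false, false, false); rewrite /good !class_pairing0 (negbTE h) !eqxx !andbT /= implybT.
  have b_cl : sq_class v b != (false, false, false).
    by apply: contraTneq h => e; rewrite /hilbert e class_pairingC class_pairing0.
  have [|x [x3 xb xd]] := @class_pairing_separate v (sq_class v b) (sq_class v d) _ b_cl (hd v v_pr h).
    by move=> v2; rewrite !sq_class3.
  by have := no x; rewrite /good h xb xd eqxx !andbT => /negP[]; apply/implyP.
(* [w] realises the prescribed parities of valuations on [V]; the prime [r], chosen outside [V],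
   then corrects the unit parts, whence its targets are the differences between [X] and the classes
   of [w]. *)
pose W := [seq v <- V | (X v).1.1]; pose w := (\prod_(v <- W) v)%N.
have W_pr : all prime W by apply/allP => v; rewrite mem_filter => /andP[_ /(allP V_pr)].
have W_uniq : uniq W by rewrite filter_uniq.
have w_gt0 : (0 < w)%N by apply: prod_primes_gt0.
pose S := [seq v <- V | (v != 2)%N].
have S_uniq : uniq S by rewrite filter_uniq.
have S_pr : all prime S by apply/allP => v; rewrite mem_filter => /andP[_ /(allP V_pr)].
have S_odd : all odd S.
  by apply/allP => v; rewrite mem_filter => /andP[v2 /(allP V_pr) v_pr]; apply: odd_prime_neq2.
have [r [r_pr r_odd rS r_cl2 r_res]] := exists_prime_classes
  (fun v => (X v).1.2 (+) (sq_class v w).1.2) ((X 2).1.2 (+) (sq_class 2 w).1.2)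
  ((X 2).2 (+) (sq_class 2 w).2) S_uniq S_pr S_odd.
have r2 : (r != 2)%N by apply: contraTneq r_odd => ->.
have rV : r \notin V by move: rS; rewrite mem_filter r2.
have w0 : w%:Z != 0 by rewrite eqz_nat -lt0n.
have r0 : r%:Z != 0 by rewrite eqz_nat -lt0n prime_gt0.
have cl_w1 v : v \in V -> (sq_class v w).1.1 = (X v).1.1.
  move=> vV; have v_pr := allP V_pr v vV.
  have -> : (sq_class v w).1.1 = odd (logn v w) by rewrite /sq_class; case: ifP.
  by rewrite logn_prod_primes // mem_filter vV andbT; case: (X v).1.1.
have cl_u v : v \in V -> sq_class v (w%:Z * r%:Z) = X v.
  move=> vV; have v_pr := allP V_pr v vV; rewrite sq_classM //.
  have vr : ~~ (v %| r)%N by rewrite dvdn_prime2 //; apply: contraNneq rV => <-.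
  have := XP v v_pr; have := cl_w1 v vV.
  have [v2|v2] := eqVneq v 2%N.
    rewrite v2 r_cl2; case: (X 2) (sq_class 2 w) => [[x1 x2] x3] [[y1 y2] y3] /= <- _.
    by case: x2 x3 y1 y2 y3 => [] [] [] [] [].
  have vS : v \in S by rewrite mem_filter v2.
  rewrite [sq_class v r]sq_class_unit // r_res //; have := sq_class3 w v2.
  rewrite /good v2; case: (X v) (sq_class v w) => [[x1 x2] x3] [[y1 y2] y3] /= -> <-.
  move=> /and3P[/negbTE -> _ _].
  by case: x2 y1 y2 => [] [] [].
have off v c : prime v -> v \notin V -> (v != r)%N -> ~~ (v %| `|c|)%N ->
    hilbert v (w%:Z * r%:Z) c = false /\ hilbert v a b = false.
  move=> v_pr; rewrite (memV v v_pr) !negb_or => /and4P[v2 va vb vd] vr vc.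
  have vw : ~~ (v %| w)%N.
    rewrite dvdn_prod_primes // mem_filter negb_and (memV v v_pr) !negb_or v2 va vb vd.
    by rewrite orbT.
  split; apply: hilbert_unit => //; rewrite abszM Euclid_dvdM // negb_or vw /=.
  by rewrite dvdn_prime2.
(* Both symbols vanish outside [V] and [r], agree on [V] by assumption, and are trivial at infinity
   because [a] and the slot are positive; comparing the two product formulas leaves agreement at
   [r]. *)
have key c : c != 0 -> (forall v, prime v -> v \notin V -> ~~ (v %| `|c|)%N) ->
    (forall v, v \in V -> hilbert v (w%:Z * r%:Z) c = hilbert v a b) ->
    forall v, prime v -> hilbert v (w%:Z * r%:Z) c = hilbert v a b.
  move=> c0 cV on_V v v_pr.
  have [|vV] := boolP (v \in V); first exact: on_V.
  have [->|vr] := eqVneq v r; last first.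
    by have [-> ->] := off v c v_pr vV vr (cV v v_pr vV).
  have [N defN] : exists N, N = (`|a| + (`|b| + (`|c| + (`|(w%:Z * r%:Z)%R| + (r + 3)))))%N by eexists.
  have wr0 : (w%:Z * r%:Z) != 0 by rewrite mulf_neq0.
  have [N2 aN bN cN] : [/\ (2 < N)%N, (`|a| < N)%N, (`|b| < N)%N & (`|c| < N)%N].
    by split; rewrite defN; clear; lia.
  have [wrN rN] : (`|(w%:Z * r%:Z)%R| < N)%N /\ (r < N)%N by split; rewrite defN; clear; lia.
  have t1 := hilbert_product wr0 c0 N2 wrN cN.
  have t2 := hilbert_product a0 b0 N2 aN bN.
  have : hilbert_total N (w%:Z * r%:Z) c (+) hilbert_total N a b = false by rewrite t1 t2.
  rewrite /hilbert_total addbACA -big_split /=.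
  have -> : hilbert_inf a b = false by rewrite /hilbert_inf ltNge (ltW a_gt0).
  rewrite /= (@big_xor_support (fun v => hilbert v (w%:Z * r%:Z) c (+) hilbert v a b) N [:: r]) //=.
  - by rewrite big_seq1; case: (hilbert _ _ _) (hilbert _ _ _) => [] [].
  - by rewrite r_pr rN.
  move=> l l_pr; rewrite inE => lr; have [lV|lV] := boolP (l \in V); first by rewrite on_V // addbb.
  by have [-> ->] := off l c l_pr lV lr (cV l l_pr lV).
exists (w%:Z * r%:Z); first by rewrite -PoszM ltz_nat muln_gt0 w_gt0 prime_gt0.
move=> v v_pr; split; apply: key => // l.
- by move=> l_pr; rewrite memV // !negb_or => /and4P[].
- by move=> lV; rewrite {1}/hilbert cl_u //; have /and3P[_ /eqP -> _] := XP l (allP V_pr l lV).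
- by move=> l_pr; rewrite memV // !negb_or => /and4P[].
- by move=> lV; rewrite {1}/hilbert cl_u //; have /and3P[_ _ /eqP ->] := XP l (allP V_pr l lV).
Qed.

(** * Splitting by a quadratic field *)

Section QuaternionNorm.
Variables (F : fieldType) (a b : F).

Definition qnorm (x0 x1 x2 x3 : F) : F :=
  x0 ^+ 2 - a * x1 ^+ 2 - b * x2 ^+ 2 + a * b * x3 ^+ 2.

Lemma quat_mul_conj (x0 x1 x2 x3 : F) :
  (Quat a b x0 x1 x2 x3 * Quat a b x0 (- x1) (- x2) (- x3) = (qnorm x0 x1 x2 x3)%:A) *
  (Quat a b x0 (- x1) (- x2) (- x3) * Quat a b x0 x1 x2 x3 = (qnorm x0 x1 x2 x3)%:A).
Proof. by split; congr Quat; rewrite /qnorm /=; ring. Qed.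

Lemma quat_eq0 (x0 x1 x2 x3 : F) :
  (Quat a b x0 x1 x2 x3 == 0) = [&& x0 == 0, x1 == 0, x2 == 0 & x3 == 0].
Proof.
apply/eqP/and4P => [[-> -> -> ->]|]; first by rewrite eqxx.
by move=> [/eqP -> /eqP -> /eqP -> /eqP ->].
Qed.

Lemma division_quaternionP : division_ring (quaternion a b) <->
  (forall x0 x1 x2 x3, qnorm x0 x1 x2 x3 = 0 -> [/\ x0 = 0, x1 = 0, x2 = 0 & x3 = 0]).
Proof.
split=> [div x0 x1 x2 x3 n0|aniso [x0 x1 x2 x3] x_neq0].
  have [x_eq0|x_neq0] := boolP (Quat a b x0 x1 x2 x3 == 0).
    by move: x_eq0; rewrite quat_eq0 => /and4P[/eqP ? /eqP ? /eqP ? /eqP ?].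
  have [y [_ yx]] := div _ x_neq0.
  have : y * (Quat a b x0 x1 x2 x3 * Quat a b x0 (- x1) (- x2) (- x3)) = 0.
    by rewrite quat_mul_conj n0 scale0r mulr0.
  rewrite mulrA yx mul1r => /eqP.
  by rewrite quat_eq0 !oppr_eq0 => /and4P[/eqP ? /eqP ? /eqP ? /eqP ?].
have n_neq0 : qnorm x0 x1 x2 x3 != 0.
  apply: contraNneq x_neq0 => /aniso[-> -> -> ->].
  by rewrite quat_eq0 eqxx.
exists ((qnorm x0 x1 x2 x3)^-1 *: Quat a b x0 (- x1) (- x2) (- x3)).
by rewrite -scalerAr -scalerAl !quat_mul_conj scalerA mulVf // scale1r.
Qed.

End QuaternionNorm.

Section Splitting.
Variables (K : fieldType) (s : K) (a b d : int).
Hypothesis intr_inj0 : forall z : int, z%:~R = 0 :> K -> z = 0.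
Hypothesis s2 : s ^+ 2 = d%:~R.

(** With j^2 = b, the two solutions make a u x^2 the norm of z + y j and, over [K], u x'^2 the norm
    of z' + s y' j. The product of these elements has norm a (u x x')^2 and supplies the zero of the
    quaternion norm. *)
Lemma common_slot_split (u : int) : a != 0 -> u != 0 -> d != 0 ->
  ternary_isotropic (a * u) b -> ternary_isotropic u (d * b) ->
  ~ division_ring (quaternion (a%:~R : K) (b%:~R : K)).
Proof.
move=> a0 u0 d0 [x [y [z [xyz e]]]] [x' [y' [z' [xyz' e']]]] /division_quaternionP aniso.
have s0 : s != 0.
  by apply: contraNneq d0 => s0; apply/eqP/intr_inj0; rewrite -s2 s0 expr0n.
have eK : z%:~R ^+ 2 = a%:~R * u%:~R * x%:~R ^+ 2 + b%:~R * y%:~R ^+ 2 :> K.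
  by rewrite -!(rmorphXn, rmorphM, rmorphD) /= e.
have eK' : z'%:~R ^+ 2 = u%:~R * x'%:~R ^+ 2 + d%:~R * b%:~R * y'%:~R ^+ 2 :> K.
  by rewrite -!(rmorphXn, rmorphM, rmorphD) /= e'.
have [x0|x0] := eqVneq x 0.
  have [] := aniso z%:~R 0 y%:~R 0; first by rewrite /qnorm eK x0; ring.
  move=> /intr_inj0 z0 _ /intr_inj0 y0 _.
  by move: xyz; rewrite x0 y0 z0 eqxx.
have [x'0|x'0] := eqVneq x' 0.
  have [] := aniso z'%:~R 0 (s * y'%:~R) 0; first by rewrite /qnorm eK' exprMn s2 x'0; ring.
  move=> /intr_inj0 z'0 _ /eqP + _; rewrite mulf_eq0 (negbTE s0) /= => /eqP /intr_inj0 y'0.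
  by move: xyz'; rewrite x'0 y'0 z'0 eqxx.
have [] := aniso (z%:~R * z'%:~R + b%:~R * y%:~R * (s * y'%:~R))
  (u%:~R * x%:~R * x'%:~R) (z%:~R * (s * y'%:~R) + y%:~R * z'%:~R) 0.
  rewrite /qnorm.
  transitivity ((z%:~R ^+ 2 - b%:~R * y%:~R ^+ 2) * (z'%:~R ^+ 2 - s ^+ 2 * b%:~R * y'%:~R ^+ 2)
     - a%:~R * (u%:~R * x%:~R * x'%:~R) ^+ 2 : K); first by ring.
  by rewrite s2 eK eK'; ring.
move=> _ /eqP; rewrite !mulf_eq0 => /orP[/orP[]|] /eqP /intr_inj0 h.
- by rewrite h eqxx in u0.
- by rewrite h eqxx in x0.
- by rewrite h eqxx in x'0.
Qed.

Theorem locally_split_not_division : 0 < a -> b != 0 -> d != 0 ->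
  (forall v, prime v -> hilbert v a b -> ~~ local_square v d) ->
  ~ division_ring (quaternion (a%:~R : K) (b%:~R : K)).
Proof.
move=> a_gt0 b0 d0 hd; have a0 : a != 0 by rewrite gt_eqF.
have [u u_gt0 hu] := exists_common_slot a_gt0 b0 d0 hd.
have u0 : u != 0 by rewrite gt_eqF.
apply: (@common_slot_split u) => //; apply: legendre_isotropic; rewrite ?mulf_neq0 //.
- by rewrite /hilbert_inf ltNge mulr_ge0 // ltW.
- by move=> v v_pr v2; rewrite hilbertMl // (hu v v_pr).1 addbb.
- by rewrite /hilbert_inf ltNge ltW.
- by move=> v v_pr v2; rewrite hilbertMr // (hu v v_pr).1 (hu v v_pr).2 addbb.
Qed.

End Splitting.

(** * Local anisotropy *)

Definition qnormz (a b : int) (x0 x1 x2 x3 : int) : int :=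
  x0 ^+ 2 - a * x1 ^+ 2 - b * x2 ^+ 2 + a * b * x3 ^+ 2.

Definition all_dvd (m : int) (x0 x1 x2 x3 : int) : bool :=
  [&& (m %| x0)%Z, (m %| x1)%Z, (m %| x2)%Z & (m %| x3)%Z].

(** For prime [v] this is anisotropy of the norm form over Q_v: by compactness its valuation is
    bounded on primitive vectors. *)
Definition locally_anisotropic (v : nat) (a b : int) : Prop :=
  exists e : nat, forall x0 x1 x2 x3,
    (v%:Z ^+ e %| qnormz a b x0 x1 x2 x3)%Z -> all_dvd v x0 x1 x2 x3.

Lemma locally_anisotropicC v a b : locally_anisotropic v a b -> locally_anisotropic v b a.
Proof.
move=> [e h]; exists e => x0 x1 x2 x3; have := h x0 x2 x1 x3.
have -> : qnormz a b x0 x2 x1 x3 = qnormz b a x0 x1 x2 x3 by rewrite /qnormz; ring.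
by move=> {}h /h /and4P[? ? ? ?]; apply/and4P.
Qed.

Lemma dvdz_prime_sqr (l : nat) (x : int) : prime l -> (l %| x ^+ 2)%Z -> (l %| x)%Z.
Proof. by move=> l_pr; rewrite !dvdzE abszX Euclid_dvdX // => /andP[]. Qed.

Lemma nonres_form_aniso (l : nat) (c x y : int) : prime l -> odd l -> nonres l c ->
  (l %| x ^+ 2 - c * y ^+ 2)%Z -> (l %| x)%Z /\ (l %| y)%Z.
Proof.
move=> l_pr l_odd c_res h.
have lc : ~~ (l %| c)%Z.
  apply: contraL c_res => lc; rewrite (@eq_nonres _ l_pr c (0 ^+ 2)) ?nonres_sqr //.
  by apply/eqP; rewrite eqz_mod_dvd expr0n subr0.
suff ly : (l %| y)%Z.
  split=> //; have : (l %| x ^+ 2)%Z.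
    by rewrite -(subrK (c * y ^+ 2) (x ^+ 2)); apply: rpredD => //; apply/dvdz_mull/dvdz_exp.
  exact: dvdz_prime_sqr.
apply: contraLR c_res => ly; have ly2 : ~~ (l %| `|(y ^+ 2)%R|)%N.
  by rewrite abszX Euclid_dvdX // negb_and; apply/orP; left.
have := @nonresM l l_pr l_odd c (y ^+ 2) lc ly2.
rewrite nonres_sqr addbF => <-; rewrite (@eq_nonres _ l_pr _ (x ^+ 2)) ?nonres_sqr //.
by apply/esym/eqP; rewrite eqz_mod_dvd.
Qed.

(** The form is N(x0, x2) - p N(x1, x3) with N anisotropic modulo p: one power of p forces the first
    pair, and after division by p the second power forces the other. *)
Lemma aniso_ramified (p : nat) (b : int) : prime p -> odd p -> nonres p b ->
  locally_anisotropic p p b.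
Proof.
move=> p_pr p_odd b_res; exists 2%N => x0 x1 x2 x3.
have p0 : p%:Z != 0 by rewrite eqz_nat -lt0n prime_gt0.
rewrite /qnormz (_ : _ + _ = (x0 ^+ 2 - b * x2 ^+ 2) - p%:Z * (x1 ^+ 2 - b * x3 ^+ 2)); last by ring.
move=> h.
have hp : (p %| x0 ^+ 2 - b * x2 ^+ 2)%Z.
  rewrite -(subrK (p%:Z * (x1 ^+ 2 - b * x3 ^+ 2)) (x0 ^+ 2 - b * x2 ^+ 2)).
  by apply: rpredD; [apply: dvdz_trans h; rewrite expr2 dvdz_mulr | rewrite dvdz_mulr].
have [p0x p2x] := nonres_form_aniso p_pr p_odd b_res hp.
have : (p%:Z ^+ 2 %| p%:Z * (x1 ^+ 2 - b * x3 ^+ 2))%Z.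
  rewrite -(subKr (x0 ^+ 2 - b * x2 ^+ 2) (p%:Z * _)).
  apply: rpredB => //; apply: rpredB; first by rewrite !expr2 dvdz_mul.
  by apply: dvdz_mull; rewrite !expr2 dvdz_mul.
rewrite expr2 (dvdz_mul2l p0) => /(nonres_form_aniso p_pr p_odd b_res)[p1x p3x].
by apply/and4P.
Qed.

(** As -1 is a nonresidue, sums of two squares are anisotropic modulo p. The three powers of p yield
    in turn [x0], then [x1] and [x2], then [x3] together with [x0 / p]. *)
Lemma aniso_self (p : nat) : prime p -> (p %% 4 = 3)%N -> locally_anisotropic p p p.
Proof.
move=> p_pr p43; exists 3%N => x0 x1 x2 x3.
have p_odd : odd p by lia.
have N1_res : nonres p (-1) by rewrite nonresN1 // p43.
have p0 : p%:Z != 0 by rewrite eqz_nat -lt0n prime_gt0.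
rewrite /qnormz => h.
have p0x : (p %| x0)%Z.
  apply: dvdz_prime_sqr => //.
  have -> : x0 ^+ 2 = (x0 ^+ 2 - p%:Z * x1 ^+ 2 - p%:Z * x2 ^+ 2 + p%:Z * p%:Z * x3 ^+ 2)
     + p%:Z * (x1 ^+ 2 + x2 ^+ 2 - p%:Z * x3 ^+ 2) by ring.
  by apply: rpredD; [apply: dvdz_trans h; rewrite exprS dvdz_mulr | rewrite dvdz_mulr].
have /dvdzP[y0 def_x0] := p0x.
have [p1x p2x] : (p %| x1)%Z /\ (p %| x2)%Z.
  apply: (nonres_form_aniso p_pr p_odd N1_res); rewrite -(dvdz_mul2l p0).
  have -> : p%:Z * (x1 ^+ 2 - -1 * x2 ^+ 2) =
     p%:Z * p%:Z * (y0 ^+ 2 + x3 ^+ 2) -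
     (x0 ^+ 2 - p%:Z * x1 ^+ 2 - p%:Z * x2 ^+ 2 + p%:Z * p%:Z * x3 ^+ 2) by rewrite def_x0; ring.
  apply: rpredB; first by rewrite dvdz_mulr.
  by apply: dvdz_trans h; rewrite exprS expr2 dvdz_mull.
have /dvdzP[y1 def_x1] := p1x; have /dvdzP[y2 def_x2] := p2x.
have [_ p3x] : (p %| y0)%Z /\ (p %| x3)%Z.
  apply: (nonres_form_aniso p_pr p_odd N1_res).
  have p20 : p%:Z * p%:Z != 0 by rewrite mulf_neq0.
  rewrite -(dvdz_mul2l p20).
  have -> : p%:Z * p%:Z * (y0 ^+ 2 - -1 * x3 ^+ 2) =
     (x0 ^+ 2 - p%:Z * x1 ^+ 2 - p%:Z * x2 ^+ 2 + p%:Z * p%:Z * x3 ^+ 2) +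
     p%:Z * p%:Z * p%:Z * (y1 ^+ 2 + y2 ^+ 2) by rewrite def_x0 def_x1 def_x2; ring.
  by apply: rpredD; [have -> : p%:Z * p%:Z * p%:Z = p%:Z ^+ 3 by [ring]; exact: h | rewrite dvdz_mulr].
by apply/and4P.
Qed.

(** Set in natural numbers so that it can be evaluated; [m - a] stands for -a modulo [m]. *)
Definition aniso_check (m : nat) (a b : nat) (s : seq nat) : bool :=
  all (fun x0 => all (fun x1 => all (fun x2 => all (fun x3 =>
    (m %| x0 ^ 2 + (m - a) * x1 ^ 2 + (m - b) * x2 ^ 2 + a * b * x3 ^ 2)%N ==>
    [&& ~~ odd x0, ~~ odd x1, ~~ odd x2 & ~~ odd x3]) s) s) s) s.

Lemma aniso_check_odd r t : r \in [:: 3; 7]%N -> t \in [:: 3; 7]%N ->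
  aniso_check 8 r t (iota 0 4).
Proof. by rewrite !inE => /orP[] /eqP -> /orP[] /eqP ->; vm_compute. Qed.

Lemma aniso_check_even r : r \in [:: 3; 5; 11; 13]%N -> aniso_check 16 r 2 (iota 0 8).
Proof. by rewrite !inE => /or4P[] /eqP ->; vm_compute. Qed.

(** As [m] divides [2 * k] and [k ^ 2], squares modulo [m] depend only on residues modulo [k]; this
    shortens the search to 4 values for modulus 8 and 8 values for modulus 16. *)
Lemma aniso_of_check (m k a' b' : nat) (a b : int) (x0 x1 x2 x3 : int) :
  (0 < k)%N -> (2 %| k)%N -> (m %| 2 * k)%N -> (m %| k ^ 2)%N -> (a' <= m)%N -> (b' <= m)%N ->
  (m %| a - a'%:Z)%Z -> (m %| b - b'%:Z)%Z -> aniso_check m a' b' (iota 0 k) ->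
  (m %| qnormz a b x0 x1 x2 x3)%Z -> all_dvd 2 x0 x1 x2 x3.
Proof.
move=> k_gt0 k2 m2k mk2 am bm /dvdzP[al def_a] /dvdzP[be def_b] check.
have red (x : int) : exists y : nat, exists c : int,
    [/\ y \in iota 0 k, x ^+ 2 = y%:Z ^+ 2 + c * m & (2 %| x)%Z = ~~ odd y].
  have k0 : k%:Z != 0 by rewrite eqz_nat -lt0n.
  have y_lt : (x %% k)%Z < k by apply: ltz_pmod; rewrite ltz_nat.
  have /gez0_abs def_y := modz_ge0 x k0.
  set y := `|(x %% k)%Z|%N in def_y.
  have def_x := divz_eq x k; rewrite -def_y in def_x; set t := (x %/ k)%Z in def_x.
  have [c1 e1] := dvdnP m2k; have [c2 e2] := dvdnP mk2.
  have [k' def_k] := dvdnP k2.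
  exists y, (c1%:Z * t * y + c2%:Z * t ^+ 2); split.
  - by rewrite mem_iota add0n -ltz_nat def_y y_lt.
  - have e1' : 2 * k%:Z = c1%:Z * m by rewrite -!PoszM e1.
    have e2' : k%:Z ^+ 2 = c2%:Z * m by rewrite -PoszM -e2 PoszM.
    rewrite {1}def_x.
    transitivity (y%:Z ^+ 2 + (2 * k%:Z) * t * y + k%:Z ^+ 2 * t ^+ 2); first by ring.
    by rewrite e1' e2'; ring.
  rewrite {1}def_x def_k PoszM mulrA [_ * 2]mulrC rpredDl ?dvdz_mulr //.
  by rewrite dvdzE /= dvdn2.
have [y0 [c0 [i0 e0 o0]]] := red x0; have [y1 [c1 [i1 e1 o1]]] := red x1.
have [y2 [c2 [i2 e2 o2]]] := red x2; have [y3 [c3 [i3 e3 o3]]] := red x3.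
rewrite /all_dvd o0 o1 o2 o3 => h; have /allP/(_ y0 i0)/allP/(_ y1 i1)/allP/(_ y2 i2)/allP/(_ y3 i3)/implyP := check.
apply; move: h; rewrite /qnormz e0 e1 e2 e3 -[a](subrK a'%:Z) def_a -[b](subrK b'%:Z) def_b.
set n := (_ + _ : int) => h.
have -> : (m %| y0 ^ 2 + (m - a') * y1 ^ 2 + (m - b') * y2 ^ 2 + a' * b' * y3 ^ 2)%N =
   (m %| y0%:Z ^+ 2 + (m%:Z - a'%:Z) * y1%:Z ^+ 2 + (m%:Z - b'%:Z) * y2%:Z ^+ 2
      + a'%:Z * b'%:Z * y3%:Z ^+ 2)%Z.
  by rewrite !subzn // -!(PoszM, PoszD, expr2) !expnS !expn0 !muln1.
rewrite (_ : y0%:Z ^+ 2 + (m%:Z - a'%:Z) * y1%:Z ^+ 2 + (m%:Z - b'%:Z) * y2%:Z ^+ 2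
      + a'%:Z * b'%:Z * y3%:Z ^+ 2 = n + m%:Z * (y1%:Z ^+ 2 + y2%:Z ^+ 2 - c0 + a'%:Z * c1 + al * y1%:Z ^+ 2 + m%:Z * al * c1
   + b'%:Z * c2 + be * y2%:Z ^+ 2 + m%:Z * be * c2
   - (a'%:Z * be + al * b'%:Z + m%:Z * al * be) * (y3%:Z ^+ 2 + m%:Z * c3) - a'%:Z * b'%:Z * c3)); last by rewrite /n; ring.
by apply: rpredD => //; apply: dvdz_mulr.
Qed.

Lemma modn_dvdz (m n r : nat) : n = r %[mod m] -> (m %| n%:Z - r%:Z)%Z.
Proof. by move=> h; rewrite -eqz_mod_dvd !modz_nat h. Qed.

Lemma aniso_two_odd (p q : nat) : (p %% 4 = 3)%N -> (q %% 4 = 3)%N -> locally_anisotropic 2 p q.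
Proof.
move=> p43 q43; exists 3%N => x0 x1 x2 x3.
have res (n : nat) : (n %% 4 = 3)%N -> exists r, [/\ r \in [:: 3; 7]%N & (8 %| n%:Z - r%:Z)%Z].
  move=> n43; exists (n %% 8)%N; split; first by rewrite !inE; lia.
  by apply: modn_dvdz; rewrite modn_mod.
have [r [r_in hr]] := res p p43; have [t [t_in ht]] := res q q43.
have le8 n : n \in [:: 3; 7]%N -> (n <= 8)%N by rewrite !inE => /orP[] /eqP ->.
exact: (@aniso_of_check 8 4 r t _ _ x0 x1 x2 x3 isT isT isT isT (le8 r r_in) (le8 t t_in)
  hr ht (aniso_check_odd r_in t_in)).
Qed.

Lemma aniso_two_even (p : nat) : (p %% 8 \in [:: 3; 5])%N -> locally_anisotropic 2 p 2.
Proof.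
move=> p8; exists 4%N => x0 x1 x2 x3.
pose r := (p %% 16)%N; have r_in : (r \in [:: 3; 5; 11; 13])%N.
  by move: p8; rewrite /r !inE; lia.
have hr : (16 %| p%:Z - r%:Z)%Z by apply: modn_dvdz; rewrite modn_mod.
have le16 : (r <= 16)%N by move: r_in; rewrite !inE => /or4P[] /eqP ->.
have h2 : (16 %| 2%:Z - 2%:Z)%Z by [].
exact: (@aniso_of_check 16 8 r 2 _ _ x0 x1 x2 x3 isT isT isT isT le16 isT
  hr h2 (aniso_check_even r_in)).
Qed.

Lemma hilbert_aniso v p q : prime v -> prime p -> prime q -> hilbert v p q ->
  locally_anisotropic v p q.
Proof.
move=> v_pr p_pr q_pr; have [v2|v2] := eqVneq v 2%N.
  rewrite v2 /hilbert; have [->|p2] := eqVneq p 2%N.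
    have [->|q2] := eqVneq q 2%N; first by rewrite sq_class_self.
    have q_odd := odd_prime_neq2 q_pr q2; rewrite sq_class_self // odd_classE //.
    rewrite /class_pairing /= ?andbF ?addbF => /aniso_two_even.
    exact: locally_anisotropicC.
  have p_odd := odd_prime_neq2 p_pr p2.
  have [->|q2] := eqVneq q 2%N.
    rewrite sq_class_self // odd_classE // /class_pairing /= ?andbF ?andbT ?addbF.
    exact: aniso_two_even.
  have q_odd := odd_prime_neq2 q_pr q2.
  rewrite !odd_classE // /class_pairing /= ?andbF ?addbF => /andP[/eqP p43 /eqP q43].
  exact: aniso_two_odd.
have v_odd := odd_prime_neq2 v_pr v2.
have [vp|vp] := eqVneq v p.
  have [vq|vq] := eqVneq v q.
    rewrite -vp -vq /hilbert sq_class_self // /class_pairing (negbTE v2) /= ?andbF ?addbF.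
    by move=> /eqP; apply: aniso_self.
  rewrite -vp /hilbert sq_class_self // sq_class_unit ?prime_ndvd //.
  rewrite /class_pairing (negbTE v2) /=.
  exact: aniso_ramified.
have [vq|vq] := eqVneq v q; last by rewrite hilbert_unit ?prime_ndvd.
rewrite -vq /hilbert sq_class_self // sq_class_unit ?prime_ndvd //.
rewrite /class_pairing (negbTE v2) /= ?andbT ?addbF => h.
by apply/locally_anisotropicC/aniso_ramified.
Qed.

(** Dividing the four coordinates by [v] divides the form by [v ^ 2], so each step consumes two
    powers. *)
Lemma aniso_power (v : nat) (a b : int) : prime v -> locally_anisotropic v a b ->
  exists e : nat, forall k x0 x1 x2 x3,
    (v%:Z ^+ (e + 2 * k) %| qnormz a b x0 x1 x2 x3)%Z -> all_dvd (v%:Z ^+ k) x0 x1 x2 x3.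
Proof.
move=> v_pr [e h]; exists e; elim=> [|k IHk] x0 x1 x2 x3 hv.
  by rewrite expr0 /all_dvd !dvd1z.
have v0 : v%:Z != 0 by rewrite eqz_nat -lt0n prime_gt0.
have hve : (v%:Z ^+ e %| qnormz a b x0 x1 x2 x3)%Z.
  by apply: dvdz_trans hv; rewrite exprD dvdz_mulr.
have /and4P[/dvdzP[y0 d0] /dvdzP[y1 d1] /dvdzP[y2 d2] /dvdzP[y3 d3]] := h _ _ _ _ hve.
have : (v%:Z ^+ (e + 2 * k) %| qnormz a b y0 y1 y2 y3)%Z.
  have v20 : v%:Z ^+ 2 != 0 by rewrite expf_neq0.
  rewrite -(dvdz_mul2l v20); move: hv; rewrite d0 d1 d2 d3.
  have -> : (e + 2 * k.+1 = 2 + (e + 2 * k))%N by lia.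
  by rewrite exprD; congr (_ %| _)%Z; rewrite /qnormz; ring.
move=> /IHk /and4P[h0 h1 h2 h3]; rewrite /all_dvd d0 d1 d2 d3 exprSr.
by apply/and4P; split; apply: dvdz_mul.
Qed.

Lemma squarefree_ndvd (v : nat) (d : int) : squarefreez d -> prime v -> ~~ (v ^ 2 %| `|d|)%N.
Proof.
move=> [_ sqf] v_pr; apply/negP => h; have := sqf v%:Z.
rewrite dvdzE abszX /= => /(_ h); have := prime_gt1 v_pr; lia.
Qed.

Lemma local_square_unit (v : nat) (d : int) : squarefreez d -> prime v ->
  local_square v d -> ~~ (v %| `|d|)%N.
Proof.
move=> sqf v_pr; apply: contraL => vd.
have h : odd (logn v `|d|).
  have -> // : logn v `|d| = 1%N.
  have d0 : (0 < `|d|)%N by rewrite absz_gt0; have [] := sqf.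
  apply/eqP; rewrite eqn_leq; have := squarefree_ndvd sqf v_pr.
  rewrite pfactor_dvdn // -leqNgt => ->.
  by rewrite -pfactor_dvdn // expn1.
by rewrite /local_square /sq_class h; case: ifP.
Qed.

Lemma legendreE (m : int) (l : nat) : prime l ->
  legendre m l = if (l %| m)%Z then 0 else if nonres l m then -1 else 1.
Proof.
move=> l_pr; rewrite /legendre; case: ifP => // _.
have -> : [exists x : 'I_l, (x%:Z ^+ 2 == m %[mod l])%Z] = ~~ nonres l m; last by case: (nonres l m).
rewrite negbK; apply/existsP/existsP => [[x hx]|[y hy]].
  exists (x%:Z%:~R : 'F_l); move: hx.
  have -> : (x%:Z%:~R ^+ 2 : 'F_l) = (x%:Z ^+ 2)%:~R by rewrite rmorphXn.
  by rewrite eqz_mod_dvd dvdzE -subr_eq0 -rmorphB intr_Fp_eq0.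
have yl : (y < l)%N by rewrite -{2}(Fp_cast l_pr); exact: ltn_ord.
exists (Ordinal yl) => /=; rewrite eqz_mod_dvd dvdzE /= -intr_Fp_eq0 // intrB.
by rewrite rmorphXn /= -pmulrn natr_Zp subr_eq0.
Qed.

(** At odd [v] the possible factor 4 of the discriminant is the square of a unit. *)
Lemma local_squareE (v : nat) (d : int) : squarefreez d -> prime v ->
  local_square v d = if (v == 2)%N then (d == 1 %[mod 8])%Z else legendre (quad_disc d) v == 1.
Proof.
move=> sqf v_pr.
have [v2|v2] := eqVneq v 2%N.
  rewrite v2; apply/idP/eqP => [h|h].
    have d2 := local_square_unit sqf (isT : prime 2) h; move: h.
    rewrite /local_square sq_class_odd // !xpair_eqE eqxx /= ; rewrite !eqbF_neg.
    move=> /andP[h4]; rewrite negb_or => /andP[h3 h5].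
    move: h4 h3 h5 d2; rewrite -[(2 %| `|d|)%N]/((2 %| d)%Z); clear; lia.
  have d2 : ~~ (2 %| `|d|)%N by rewrite -[(2 %| `|d|)%N]/((2 %| d)%Z); clear -h; lia.
  rewrite /local_square sq_class_odd // !xpair_eqE eqxx /=; clear -h; lia.
have v_odd := odd_prime_neq2 v_pr v2.
have disc_res : ~~ (v %| `|d|)%N -> nonres v (quad_disc d) = nonres v d.
  move=> vd; rewrite /quad_disc; case: ifP => // _.
  rewrite (_ : 4 = 2 ^+ 2) // nonresM ?nonres_sqr //.
  by rewrite abszX Euclid_dvdX //= dvdn_prime2 // negb_and v2.
have disc_dvd : (v %| quad_disc d)%Z = (v %| d)%Z.
  rewrite /quad_disc; case: ifP => // _; rewrite !dvdzE abszM Euclid_dvdM //.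
  by rewrite -[`|4|%N]/(2 ^ 2)%N Euclid_dvdX //= dvdn_prime2 // (negbTE v2).
have legE : (legendre (quad_disc d) v == 1) = ~~ (v %| `|d|)%N && ~~ nonres v (quad_disc d).
  by rewrite legendreE // disc_dvd dvdzE; case: ifP => //; case: ifP.
rewrite legE; apply/idP/andP => [h|[vd]].
  have vd := local_square_unit sqf v_pr h; rewrite disc_res //; split=> //.
  by move: h; rewrite /local_square sq_class_unit // !xpair_eqE eqxx andbT /= => /eqP ->.
by rewrite disc_res // /local_square sq_class_unit // => /negbTE ->.
Qed.

Lemma hensel_odd (v : nat) (d : int) : prime v -> odd v -> ~~ (v %| d)%Z -> ~~ nonres v d ->
  forall N, exists2 r : int, (v%:Z ^+ N.+1 %| r ^+ 2 - d)%Z & ~~ (v %| r)%Z.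
Proof.
move=> v_pr v_odd vd d_res; elim=> [|N [r hr vr]].
  have [t ht] := sqrt_mod_prime v_pr d_res; exists t; first by rewrite expr1.
  apply: contra vd => vt; rewrite -(subKr (t ^+ 2) d); apply: rpredB => //.
  by rewrite expr2 dvdz_mulr.
have /dvdzP[c def_c] := hr.
have cop : coprimez v (2 * r).
  rewrite coprimezE prime_coprime // abszM Euclid_dvdM // negb_or -dvdzE vr andbT.
  by rewrite dvdzE /= dvdn_prime2 //; apply: contraTneq v_odd => ->.
have [[a b] e] := coprimezP _ _ cop; rewrite /= in e.
(* Newton's correction: [b] inverts [2 * r] modulo [v], and [c] is the quotient of the error by the
   current modulus. *)
exists (r - b * c * v%:Z ^+ N.+1).
  have -> : (r - b * c * v%:Z ^+ N.+1) ^+ 2 - d =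
    (r ^+ 2 - d) - (b * (2 * r)) * c * v%:Z ^+ N.+1 + (b * c) ^+ 2 * (v%:Z ^+ N.+1 * v%:Z ^+ N.+1) by ring.
  have -> : b * (2 * r) = 1 - a * v by rewrite -[X in X - _]e; ring.
  rewrite def_c.
  have -> : c * v%:Z ^+ N.+1 - (1 - a * v) * c * v%:Z ^+ N.+1 + (b * c) ^+ 2 * (v%:Z ^+ N.+1 * v%:Z ^+ N.+1)
    = v%:Z ^+ N.+2 * (a * c + (b * c) ^+ 2 * v%:Z ^+ N) by rewrite !exprS; ring.
  exact: dvdz_mulr.
apply: contra vr => h; rewrite -(subrK (b * c * v%:Z ^+ N.+1) r).
by apply: rpredD => //; rewrite exprS dvdz_mull // dvdz_mulr.
Qed.

Lemma hensel_two (d : int) : (d == 1 %[mod 8])%Z ->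
  forall N, exists2 r : int, (2 ^+ (N + 3) %| r ^+ 2 - d)%Z & ~~ (2 %| r)%Z.
Proof.
move=> d1; elim=> [|N [r hr r2]].
  exists 1 => //; have -> : 2 ^+ (0 + 3) = 8 :> int by [].
  rewrite expr1n -eqz_mod_dvd.
  by rewrite eq_sym.
have /dvdzP[c def_c] := hr.
have [c2|c2] := boolP (2 %| c)%Z.
  by exists r => //; rewrite def_c addSn exprS dvdz_mul.
(* The factor 2 of the derivative makes the correction one power smaller than the modulus. The new
   quotient is [c + r + 2 * 2 ^+ N], even because [c] and [r] are odd. *)
exists (r + 2 ^+ (N + 2)).
  have -> : (r + 2 ^+ (N + 2)) ^+ 2 - d = (r ^+ 2 - d) + r * (2 * 2 ^+ (N + 2)) + 2 ^+ (N + 2) * 2 ^+ (N + 2) by ring.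
  rewrite def_c -exprS -[(N + 2).+1]addnS.
  have -> : c * 2 ^+ (N + 3) + r * 2 ^+ (N + 3) + 2 ^+ (N + 2) * 2 ^+ (N + 2) =
     2 ^+ (N + 3) * (c + r + 2 * 2 ^+ N) :> int by rewrite !exprD; ring.
  have cr : (2 %| c + r)%Z by move: c2 r2; clear; lia.
  by rewrite addSn exprS mulrC dvdz_mul //; apply: rpredD => //; apply: dvdz_mulr.
apply: contra r2 => h; rewrite -(addrK (2 ^+ (N + 2)) r); apply: rpredB => //.
by rewrite addn2 exprS dvdz_mulr.
Qed.

Lemma hensel (v : nat) (d : int) : squarefreez d -> prime v -> local_square v d ->
  forall N, exists2 r : int, (v%:Z ^+ N %| r ^+ 2 - d)%Z & ~~ (v %| r)%Z.
Proof.
move=> sqf v_pr h N; have vd := local_square_unit sqf v_pr h.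
have [v2|v2] := eqVneq v 2%N.
  rewrite v2 in h *; have := h; rewrite local_squareE //= => d1.
  have [r hr r2] := hensel_two d1 N; exists r => //; apply: dvdz_trans hr.
  by rewrite exprD dvdz_mulr.
have d_res : ~~ nonres v d.
  by move: h; rewrite /local_square sq_class_unit // !xpair_eqE eqxx andbT /= => /eqP ->.
have [r hr r2] := hensel_odd v_pr (odd_prime_neq2 v_pr v2) vd d_res N; exists r => //.
by apply: dvdz_trans hr; rewrite exprS dvdz_mull.
Qed.

(** * Biquadratic fields *)

Lemma squarefree_nonsquare (d : int) : squarefreez d -> d <> 1 -> forall t : int, t ^+ 2 <> d.
Proof.
move=> [_ sqf] d1 t td; apply: d1; have : `|t| = 1 by apply: sqf; rewrite td.
by rewrite -td -(@real_normK _ t) ?num_real // => ->.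
Qed.

(** Valuations at most 1 with even sum are equal, so the absolute values agree; a square product
    makes the signs agree. *)
Lemma squarefree_mul_nonsquare (d1 d2 : int) : squarefreez d1 -> squarefreez d2 -> d1 <> d2 ->
  forall t : int, t ^+ 2 <> d1 * d2.
Proof.
move=> sqf1 sqf2 d12 t td; apply: d12.
have [d10 _] := sqf1; have [d20 _] := sqf2.
have t0 : t != 0.
  by apply: contraTneq isT => t0; move/eqP: td;
    rewrite t0 expr0n /= eq_sym mulf_eq0 (negbTE d10) (negbTE d20).
have abs_eq : `|d1|%N = `|d2|%N.
  apply: eqn_from_log; rewrite ?absz_gt0 // => v; have [v_pr|v_pr] := boolP (prime v); last first.
    by rewrite [LHS]lognE [RHS]lognE (negbTE v_pr).
  have le1 d : squarefreez d -> (logn v `|d| <= 1)%N.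
    move=> sqf; have d0 : (0 < `|d|)%N by rewrite absz_gt0; have [] := sqf.
    by have := squarefree_ndvd sqf v_pr; rewrite pfactor_dvdn // -leqNgt.
  have := congr1 (fun z : int => odd (logn v `|z|)) td.
  rewrite abszX abszM lognX lognM ?absz_gt0 // oddM /= oddD.
  have := le1 _ sqf1; have := le1 _ sqf2.
  by case: (logn v _) => [|[|?]] // _; case: (logn v _) => [|[|?]].
have : 0 < d1 * d2 by rewrite -td exprn_even_gt0.
by move: abs_eq; clear; nia.
Qed.

Lemma nonsquare_ratio (d u w : int) : (forall t : int, t ^+ 2 <> d) -> u ^+ 2 = d * w ^+ 2 -> w = 0.
Proof.
move=> nsq e; apply/eqP; apply/negPn/negP => w0.
have : (`|w| ^ 2 %| `|u| ^ 2)%N by rewrite -!abszX -dvdzE e dvdz_mull.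
rewrite dvdn_pexp2r // -dvdzE => /dvdzP[q def_u].
apply: (nsq q); apply: (mulIf (expf_neq0 2 w0)).
by rewrite -exprMn -def_u.
Qed.

Section Biquadratic.
Variables (d1 d2 : int) (K : fieldExtType rat) (s1 s2 : K).
Hypotheses (sqf1 : squarefreez d1) (sqf2 : squarefreez d2).
Hypotheses (d12 : d1 <> d2) (d1_1 : d1 <> 1) (d2_1 : d2 <> 1).
Hypothesis hK : is_biquadratic d1 d2 s1 s2.

Let e1 : s1 ^+ 2 = d1%:~R. Proof. by case: hK. Qed.
Let e2 : s2 ^+ 2 = d2%:~R. Proof. by case: hK. Qed.

Lemma intr_ext_eq0 (z : int) : z%:~R = 0 :> K -> z = 0.
Proof.
rewrite -(rmorph_int (in_alg K)) => /eqP; rewrite fmorph_eq0 intr_eq0.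
by move/eqP.
Qed.

Definition biquad_lin (a b c e : int) : K :=
  a%:~R + b%:~R * s1 + c%:~R * s2 + e%:~R * (s1 * s2).

Lemma quadratic_free (a b : int) : a%:~R + b%:~R * s1 = 0 -> a = 0 /\ b = 0.
Proof.
move=> h; have : a ^+ 2 = d1 * b ^+ 2.
  apply/eqP; rewrite -subr_eq0; apply/eqP/intr_ext_eq0.
  rewrite intrB intrM !rmorphXn /= -e1.
  transitivity ((a%:~R + b%:~R * s1) * (a%:~R - b%:~R * s1)); first by ring.
  by rewrite h mul0r.
move=> /(nonsquare_ratio (squarefree_nonsquare sqf1 d1_1)) b0; split=> //.
by move: h; rewrite b0 mul0r addr0 => /intr_ext_eq0.
Qed.

(** For alpha = a + b s1 and beta = c + e s1 the relation gives alpha^2 = d2 beta^2. Norms to Q then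
    satisfy N(alpha) = d2 N(beta) up to sign: plus leads to [a ^+ 2 = d2 * c ^+ 2], minus to
    [a ^+ 2 = d1 * d2 * e ^+ 2], and neither [d2] nor [d1 * d2] is a square. *)
Lemma biquad_free (a b c e : int) : biquad_lin a b c e = 0 -> [/\ a = 0, b = 0, c = 0 & e = 0].
Proof.
move=> h.
have [h1 h2] : a ^+ 2 + d1 * b ^+ 2 - d2 * (c ^+ 2 + d1 * e ^+ 2) = 0 /\
    2 * (a * b - d2 * c * e) = 0.
  apply: quadratic_free.
  rewrite !(intrB, intrD, intrM, rmorphXn) /= -e1 -e2.
  transitivity (biquad_lin a b c e *
    (a%:~R + b%:~R * s1 - s2 * (c%:~R + e%:~R * s1))); last by rewrite h mul0r.
  by rewrite /biquad_lin; ring.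
have h3 : a * b = d2 * c * e by move/eqP: h2; rewrite mulf_eq0 /= subr_eq0 => /eqP.
have [d10 _] := sqf1; have [d20 _] := sqf2.
have nsq1 := squarefree_nonsquare sqf1 d1_1.
have nsq2 := squarefree_nonsquare sqf2 d2_1.
have nsq12 := squarefree_mul_nonsquare sqf1 sqf2 d12.
have h4 : (a ^+ 2 - d1 * b ^+ 2) ^+ 2 = (d2 * (c ^+ 2 - d1 * e ^+ 2)) ^+ 2.
  transitivity ((a ^+ 2 + d1 * b ^+ 2) ^+ 2 - 4 * d1 * (a * b) ^+ 2); first by ring.
  have -> : a ^+ 2 + d1 * b ^+ 2 = d2 * (c ^+ 2 + d1 * e ^+ 2) by apply/eqP; rewrite -subr_eq0 h1.
  by rewrite h3; ring.
have cancel2 : injective ( *%R (2 : int)) by exact: mulfI.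
move/eqP: h4; rewrite eqf_sqr => /orP[] /eqP h4.
  have a2 : a ^+ 2 = d2 * c ^+ 2.
    apply: cancel2; transitivity ((a ^+ 2 + d1 * b ^+ 2 - d2 * (c ^+ 2 + d1 * e ^+ 2)) +
      ((a ^+ 2 - d1 * b ^+ 2) - d2 * (c ^+ 2 - d1 * e ^+ 2)) + 2 * (d2 * c ^+ 2)); first by ring.
    by rewrite h1 h4 subrr !add0r.
  have c0 := nonsquare_ratio nsq2 a2.
  have a0 : a = 0 by move/eqP: a2; rewrite c0 expr0n mulr0 sqrf_eq0 => /eqP.
  have b2 : b ^+ 2 = d2 * e ^+ 2.
    apply: (mulfI d10); move: h1; rewrite a0 c0 !expr0n /= => /eqP.
    by rewrite !add0r subr_eq0 => /eqP ->; ring.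
  have e0 := nonsquare_ratio nsq2 b2.
  by move/eqP: b2; rewrite e0 expr0n mulr0 sqrf_eq0 => /eqP ->.
have a2 : a ^+ 2 = d1 * d2 * e ^+ 2.
  apply: cancel2; transitivity ((a ^+ 2 + d1 * b ^+ 2 - d2 * (c ^+ 2 + d1 * e ^+ 2)) +
    ((a ^+ 2 - d1 * b ^+ 2) + d2 * (c ^+ 2 - d1 * e ^+ 2)) + 2 * (d1 * d2 * e ^+ 2)); first by ring.
  by rewrite h1 h4 addNr !add0r.
have e0 := nonsquare_ratio nsq12 a2.
have a0 : a = 0 by move/eqP: a2; rewrite e0 expr0n mulr0 sqrf_eq0 => /eqP.
have b2 : (d1 * b) ^+ 2 = d1 * d2 * c ^+ 2.
  have : d1 * b ^+ 2 = d2 * c ^+ 2.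
    move: h1; rewrite a0 e0 !expr0n /= => /eqP.
    by rewrite mulr0 !add0r addr0 subr_eq0 => /eqP.
  by move=> hb; transitivity (d1 * (d1 * b ^+ 2)); [ring | rewrite hb; ring].
have c0 := nonsquare_ratio nsq12 b2.
move/eqP: b2; rewrite c0 expr0n mulr0 sqrf_eq0 mulf_eq0 (negbTE d10) => /eqP ->.
by [].
Qed.

(** The span of the four products contains 1 and is stable under multiplication by 1, [s1] and [s2],
    hence contains the algebra they generate. *)
Lemma biquad_span (x : K) : exists a b c e : rat,
  x = a%:A + b *: s1 + c *: s2 + e *: (s1 * s2).
Proof.
pose V : {vspace K} := span [:: 1; s1; s2; s1 * s2].
have VP y : y \in V <-> exists a b c e : rat, y = a%:A + b *: s1 + c *: s2 + e *: (s1 * s2).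
  split.
    rewrite /V !span_cons span_nil addv0.
    move=> /memv_addP[_ /vlineP[a ->] [_ /memv_addP[_ /vlineP[b ->]
      [_ /memv_addP[_ /vlineP[c ->] [_ /vlineP[e ->] ->]] ->]] ->]].
    by exists a, b, c, e; rewrite -!addrA.
  move=> [a [b [c [e ->]]]]; rewrite !memvD // memvZ // memv_span // !inE eqxx ?orbT //.
suff : (fullv <= V)%VS by move/subvP/(_ x (memvf _))/VP.
have [_ _ <-] := hK; apply: agenv_sub_modl.
  apply/subvP => y /vlineP[k ->]; apply/VP.
  by exists k, 0, 0, 0; rewrite !scale0r !addr0.
apply/prodvP => y z; rewrite !span_cons span_nil addv0.
move=> /memv_addP[_ /vlineP[a ->] [_ /memv_addP[_ /vlineP[b ->] [_ /vlineP[c ->] ->]] ->]].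
move=> /VP[a' [b' [c' [e' ->]]]]; apply/VP.
exists (a * a' + b * b' * d1%:~R + c * c' * d2%:~R), (a * b' + b * a' + c * e' * d2%:~R),
  (a * c' + c * a' + b * e' * d1%:~R), (a * e' + b * c' + c * b').
have algE k u : k *: u = in_alg K k * u by rewrite mulr_algl.
rewrite !algE !(rmorphD, rmorphM) !(rmorph_int (in_alg K)) -e1 -e2.
by ring.
Qed.

Lemma biquad_clear (x : K) : exists2 D : int, D != 0 &
  exists a b c e : int, D%:~R * x = biquad_lin a b c e.
Proof.
have clear1 (k : rat) : exists2 D : int, D != 0 & exists n : int, D%:~R * k = n%:~R.
  exists (denq k); first exact: denq_neq0.
  by exists (numq k); rewrite -{2}[k]divq_num_den mulrCA divff ?mulr1 // intr_eq0 denq_neq0.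
have [a [b [c [e ->]]]] := biquad_span x.
have [Da Da0 [na ha]] := clear1 a; have [Db Db0 [nb hb]] := clear1 b.
have [Dc Dc0 [nc hc]] := clear1 c; have [De De0 [ne he]] := clear1 e.
exists (Da * Db * Dc * De); first by rewrite !mulf_neq0.
exists (Db * Dc * De * na), (Da * Dc * De * nb), (Da * Db * De * nc), (Da * Db * Dc * ne).
have algE k u : k *: u = in_alg K k * u by rewrite mulr_algl.
have hK' D k n : D%:~R * k = n%:~R :> rat -> n%:~R = D%:~R * in_alg K k :> K.
  by move=> h; rewrite -(rmorph_int (in_alg K) n) -h rmorphM /= -(rmorph_int (in_alg K) D).
rewrite /biquad_lin !algE !intrM (hK' _ _ _ ha) (hK' _ _ _ hb) (hK' _ _ _ hc) (hK' _ _ _ he).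
by ring.
Qed.

End Biquadratic.

(* [(a, b, c, e)] stands for a + b s1 + c s2 + e s1 s2, where s1 and s2 are the
   square roots of d1 and d2. *)
Definition biquad_coef : Type := int * int * int * int.

Definition biquad_eval (r1 r2 : int) (X : biquad_coef) : int :=
  let: (a, b, c, e) := X in a + b * r1 + c * r2 + e * (r1 * r2).

Definition biquad_sqr (d1 d2 : int) (X : biquad_coef) : biquad_coef :=
  let: (a, b, c, e) := X in
  (a ^+ 2 + d1 * b ^+ 2 + d2 * c ^+ 2 + d1 * d2 * e ^+ 2,
   2 * (a * b + d2 * c * e), 2 * (a * c + d1 * b * e), 2 * (a * e + b * c)).

Definition biquad_zero : biquad_coef := (0, 0, 0, 0).

Definition biquad_qnorm (d1 d2 p q : int) (X0 X1 X2 X3 : biquad_coef) : biquad_coef :=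
  let: (a0, b0, c0, e0) := biquad_sqr d1 d2 X0 in
  let: (a1, b1, c1, e1) := biquad_sqr d1 d2 X1 in
  let: (a2, b2, c2, e2) := biquad_sqr d1 d2 X2 in
  let: (a3, b3, c3, e3) := biquad_sqr d1 d2 X3 in
  (a0 - p * a1 - q * a2 + p * q * a3, b0 - p * b1 - q * b2 + p * q * b3,
   c0 - p * c1 - q * c2 + p * q * c3, e0 - p * e1 - q * e2 + p * q * e3).

(** Modulo [m], evaluation is the ring homomorphism sending the two square roots to [r1] and
    [r2]. *)
Lemma biquad_eval_sqr (d1 d2 r1 r2 m : int) X : (m %| r1 ^+ 2 - d1)%Z -> (m %| r2 ^+ 2 - d2)%Z ->
  (m %| biquad_eval r1 r2 X ^+ 2 - biquad_eval r1 r2 (biquad_sqr d1 d2 X))%Z.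
Proof.
move: X => [[[a b] c] e] h1 h2 /=.
have -> : (a + b * r1 + c * r2 + e * (r1 * r2)) ^+ 2 -
   (a ^+ 2 + d1 * b ^+ 2 + d2 * c ^+ 2 + d1 * d2 * e ^+ 2 + 2 * (a * b + d2 * c * e) * r1 +
      2 * (a * c + d1 * b * e) * r2 + 2 * (a * e + b * c) * (r1 * r2)) =
   (r1 ^+ 2 - d1) * (b ^+ 2 + e ^+ 2 * r2 ^+ 2 + 2 * b * e * r2) +
   (r2 ^+ 2 - d2) * (c ^+ 2 + d1 * e ^+ 2 + 2 * c * e * r1) by ring.
by apply: rpredD; apply: dvdz_mulr.
Qed.

Lemma biquad_eval_qnorm (d1 d2 r1 r2 m p q : int) X0 X1 X2 X3 :
  (m %| r1 ^+ 2 - d1)%Z -> (m %| r2 ^+ 2 - d2)%Z ->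
  biquad_qnorm d1 d2 p q X0 X1 X2 X3 = biquad_zero ->
  (m %| qnormz p q (biquad_eval r1 r2 X0) (biquad_eval r1 r2 X1)
     (biquad_eval r1 r2 X2) (biquad_eval r1 r2 X3))%Z.
Proof.
move=> h1 h2 h.
have h' : biquad_eval r1 r2 (biquad_qnorm d1 d2 p q X0 X1 X2 X3) = 0.
  by rewrite h /= !mul0r !addr0.
pose S X : int := biquad_eval r1 r2 X ^+ 2 - biquad_eval r1 r2 (biquad_sqr d1 d2 X).
have -> : qnormz p q (biquad_eval r1 r2 X0) (biquad_eval r1 r2 X1)
     (biquad_eval r1 r2 X2) (biquad_eval r1 r2 X3) = S X0 - p * S X1 - q * S X2 + p * q * S X3.
  rewrite -[RHS]addr0 -h' /S /biquad_qnorm /qnormz.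
  move: (biquad_eval _ _ X0) (biquad_eval _ _ X1) (biquad_eval _ _ X2) (biquad_eval _ _ X3).
  move=> y0 y1 y2 y3.
  case: (biquad_sqr d1 d2 X0) => [[[? ?] ?] ?]; case: (biquad_sqr d1 d2 X1) => [[[? ?] ?] ?].
  case: (biquad_sqr d1 d2 X2) => [[[? ?] ?] ?]; case: (biquad_sqr d1 d2 X3) => [[[? ?] ?] ?].
  by rewrite /biquad_eval; ring.
have hS X : (m %| S X)%Z by exact: biquad_eval_sqr.
by repeat first [exact: hS | apply: rpredB | apply: rpredD | apply: dvdz_mull].
Qed.

Lemma all_powers_dvd (v : nat) (n : int) : prime v -> (forall k, (v%:Z ^+ k %| n)%Z) -> n = 0.
Proof.
move=> v_pr h; apply/eqP; apply: contraT => n0.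
have := h `|n|%N; rewrite dvdzE abszX /= => /dvdn_leq.
by rewrite absz_gt0 n0 => /(_ isT); rewrite leqNgt ltn_expl ?prime_gt1.
Qed.

(* Averaging over the signs of r1 and r2 isolates each coefficient. *)
Lemma coef_eq0 (v : nat) (X : biquad_coef) : prime v ->
  (forall k, exists r1 r2 : int, [/\ ~~ (v %| r1)%Z, ~~ (v %| r2)%Z &
    forall t1 t2 : bool, (v%:Z ^+ k %| biquad_eval ((-1) ^+ t1 * r1) ((-1) ^+ t2 * r2) X)%Z]) ->
  X = biquad_zero.
Proof.
move: X => [[[a b] c] e] v_pr h.
suff E : [/\ 4 * a = 0, 4 * b = 0, 4 * c = 0 & 4 * e = 0].
  by move: E => [/eqP + /eqP + /eqP + /eqP]; rewrite !mulf_eq0 /= => /eqP -> /eqP -> /eqP -> /eqP ->.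
have key k : all_dvd (v%:Z ^+ k) (4 * a) (4 * b) (4 * c) (4 * e).
  have [r1 [r2 [vr1 vr2 hr]]] := h k.
  pose P (x y : int) : int := a + b * x + c * y + e * (x * y).
  have h1 : (v%:Z ^+ k %| P r1 r2)%Z by have := hr false false; rewrite /= !mul1r.
  have h2 : (v%:Z ^+ k %| P r1 (- r2))%Z by have := hr false true; rewrite /= mul1r mulN1r.
  have h3 : (v%:Z ^+ k %| P (- r1) r2)%Z by have := hr true false; rewrite /= mul1r mulN1r.
  have h4 : (v%:Z ^+ k %| P (- r1) (- r2))%Z by have := hr true true; rewrite /= !mulN1r.
  (* The approximate roots are units at [v], so they cancel; the factor 4 stays, which is harmless
     as all powers of [v] are available. *)
  have cop (r x : int) : ~~ (v %| r)%Z -> (v%:Z ^+ k %| x * r)%Z -> (v%:Z ^+ k %| x)%Z.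
    move=> vr; rewrite Gauss_dvdzl // coprimezXl // coprimezE prime_coprime //.
  apply/and4P; split.
  - have -> : 4 * a = P r1 r2 + P r1 (- r2) + P (- r1) r2 + P (- r1) (- r2) by rewrite /P; ring.
    by repeat first [assumption | apply: rpredD].
  - apply: (cop r1) => //.
    have -> : 4 * b * r1 = P r1 r2 + P r1 (- r2) - P (- r1) r2 - P (- r1) (- r2) by rewrite /P; ring.
    by repeat first [assumption | apply: rpredB | apply: rpredD].
  - apply: (cop r2) => //.
    have -> : 4 * c * r2 = P r1 r2 - P r1 (- r2) + P (- r1) r2 - P (- r1) (- r2) by rewrite /P; ring.
    by repeat first [assumption | apply: rpredB | apply: rpredD].
  - apply: (cop r1) => //; apply: (cop r2) => //.
    have -> : 4 * e * r1 * r2 = P r1 r2 - P r1 (- r2) - P (- r1) r2 + P (- r1) (- r2) by rewrite /P; ring.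
    by repeat first [assumption | apply: rpredB | apply: rpredD].
by split; apply: (all_powers_dvd v_pr) => k; have /and4P[] := key k.
Qed.

Section LocalToGlobal.
Variables (d1 d2 : int) (K : fieldExtType rat) (s1 s2 : K).
Hypotheses (sqf1 : squarefreez d1) (sqf2 : squarefreez d2).
Hypotheses (d12 : d1 <> d2) (d1_1 : d1 <> 1) (d2_1 : d2 <> 1).
Hypothesis hK : is_biquadratic d1 d2 s1 s2.

Definition biquad_val (X : biquad_coef) : K :=
  let: (a, b, c, e) := X in biquad_lin s1 s2 a b c e.

Lemma biquad_val_eq0 X : biquad_val X = 0 -> X = biquad_zero.
Proof.
move: X => [[[a b] c] e] /(biquad_free sqf1 sqf2 d12 d1_1 d2_1 hK).
by move=> [-> -> -> ->].
Qed.

Lemma biquad_val_sqr X : biquad_val X ^+ 2 = biquad_val (biquad_sqr d1 d2 X).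
Proof.
have [e1 e2 _] := hK; move: X => [[[a b] c] e].
rewrite /biquad_val /biquad_sqr /biquad_lin !(intrD, intrM, rmorphXn) /= -e1 -e2.
by ring.
Qed.

Lemma biquad_val_qnorm (p q : int) X0 X1 X2 X3 :
  qnorm (p%:~R : K) q%:~R (biquad_val X0) (biquad_val X1) (biquad_val X2) (biquad_val X3) =
  biquad_val (biquad_qnorm d1 d2 p q X0 X1 X2 X3).
Proof.
rewrite /qnorm !biquad_val_sqr /biquad_qnorm.
case: (biquad_sqr d1 d2 X0) => [[[? ?] ?] ?]; case: (biquad_sqr d1 d2 X1) => [[[? ?] ?] ?].
case: (biquad_sqr d1 d2 X2) => [[[? ?] ?] ?]; case: (biquad_sqr d1 d2 X3) => [[[? ?] ?] ?].
by rewrite /biquad_val /biquad_lin !(intrB, intrD, intrM); ring.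
Qed.

Lemma biquad_clear1 (D : int) (x : K) : exists2 D' : int, D' != 0 &
  exists X, D'%:~R * x = biquad_val X.
Proof.
have [D' D'0 [a [b [c [e h]]]]] := biquad_clear hK x.
by exists D' => //; exists (a, b, c, e).
Qed.

Lemma biquad_val_scale (D : int) X : exists Y, D%:~R * biquad_val X = biquad_val Y.
Proof.
move: X => [[[a b] c] e]; exists (D * a, D * b, D * c, D * e).
by rewrite /= /biquad_lin !intrM; ring.
Qed.

Lemma biquad_clear4 (x0 x1 x2 x3 : K) : exists2 D : int, D != 0 & exists X0 X1 X2 X3,
  [/\ D%:~R * x0 = biquad_val X0, D%:~R * x1 = biquad_val X1,
      D%:~R * x2 = biquad_val X2 & D%:~R * x3 = biquad_val X3].
Proof.
have [D0 D00 [Y0 h0]] := biquad_clear1 1 x0; have [D1 D10 [Y1 h1]] := biquad_clear1 1 x1.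
have [D2 D20 [Y2 h2]] := biquad_clear1 1 x2; have [D3 D30 [Y3 h3]] := biquad_clear1 1 x3.
have [X0 e0] := biquad_val_scale (D1 * D2 * D3) Y0.
have [X1 e1] := biquad_val_scale (D0 * D2 * D3) Y1.
have [X2 e2] := biquad_val_scale (D0 * D1 * D3) Y2.
have [X3 e3] := biquad_val_scale (D0 * D1 * D2) Y3.
exists (D0 * D1 * D2 * D3); first by rewrite !mulf_neq0.
exists X0, X1, X2, X3; rewrite -e0 -e1 -e2 -e3 -h0 -h1 -h2 -h3 !intrM.
by split; ring.
Qed.

Lemma locally_anisotropic_division (v : nat) (p q : int) : prime v ->
  locally_anisotropic v p q -> local_square v d1 -> local_square v d2 ->
  division_ring (quaternion (p%:~R : K) q%:~R).
Proof.
move=> v_pr aniso sq1 sq2; apply/division_quaternionP => x0 x1 x2 x3 n0.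
have [D D0 [X0 [X1 [X2 [X3 [h0 h1 h2 h3]]]]]] := biquad_clear4 x0 x1 x2 x3.
have DK : D%:~R != 0 :> K by apply: contraNneq D0 => /intr_ext_eq0 ->.
have N0 : biquad_qnorm d1 d2 p q X0 X1 X2 X3 = biquad_zero.
  apply: biquad_val_eq0; rewrite -biquad_val_qnorm -h0 -h1 -h2 -h3.
  transitivity (D%:~R ^+ 2 * qnorm (p%:~R : K) q%:~R x0 x1 x2 x3).
    by rewrite /qnorm; ring.
  by rewrite n0 mulr0.
have [e he] := aniso_power v_pr aniso.
have key k : exists r1 r2 : int, [/\ ~~ (v %| r1)%Z, ~~ (v %| r2)%Z &
    forall t1 t2 : bool, all_dvd (v%:Z ^+ k)
     (biquad_eval ((-1) ^+ t1 * r1) ((-1) ^+ t2 * r2) X0)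
     (biquad_eval ((-1) ^+ t1 * r1) ((-1) ^+ t2 * r2) X1)
     (biquad_eval ((-1) ^+ t1 * r1) ((-1) ^+ t2 * r2) X2)
     (biquad_eval ((-1) ^+ t1 * r1) ((-1) ^+ t2 * r2) X3)].
  have [r1 hr1 vr1] := hensel sqf1 v_pr sq1 (e + 2 * k).
  have [r2 hr2 vr2] := hensel sqf2 v_pr sq2 (e + 2 * k).
  exists r1, r2; split=> // t1 t2; apply: he.
  by apply: biquad_eval_qnorm N0; rewrite exprMn sqrr_sign mul1r.
have zero x X : D%:~R * x = biquad_val X -> X = biquad_zero -> x = 0.
  move=> + X0'; rewrite X0' /= /biquad_lin !mul0r !addr0 => /eqP.
  by rewrite mulf_eq0 (negbTE DK) => /eqP.
split; [apply: zero h0 _|apply: zero h1 _|apply: zero h2 _|apply: zero h3 _];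
  apply: (coef_eq0 v_pr) => k; have [r1 [r2 [vr1 vr2 hr]]] := key k;
  by exists r1, r2; split=> // t1 t2; have /and4P[] := hr t1 t2.
Qed.

End LocalToGlobal.

(** * The local criterion *)

Lemma local_squareM v a b : prime v -> a != 0 -> b != 0 ->
  local_square v (a * b) = (sq_class v a == sq_class v b).
Proof.
move=> v_pr a0 b0; rewrite /local_square sq_classM //.
by case: (sq_class v a) (sq_class v b) => [[[] []] []] [[[] []] []].
Qed.

(** Ramification occurs only at 2, p and q. If these are distinct, the product formula, with trivial
    real place, rules out all three at once. *)
Lemma hilbert_two_places p q : prime p -> prime q -> exists u w : nat,
  forall v, prime v -> hilbert v p q -> (v == u) || (v == w).
Proof.
move=> p_pr q_pr.
have supp v : prime v -> hilbert v p q -> v \in [:: 2; p; q]%N.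
  move=> v_pr; rewrite !inE; apply: contraLR; rewrite !negb_or => /and3P[v2 vp vq].
  by rewrite hilbert_unit ?prime_ndvd.
have [p2|p2] := eqVneq p 2%N.
  by exists p, q => v v_pr /(supp v v_pr); rewrite p2 !inE orbA orbb.
have [q2|q2] := eqVneq q 2%N.
  by exists p, q => v v_pr /(supp v v_pr); rewrite q2 !inE; case: eqP; rewrite ?orbT.
have [pq|pq] := eqVneq p q.
  by exists 2%N, p => v v_pr /(supp v v_pr); rewrite -pq !inE orbb.
pose N := (p + q + 3)%N.
have : hilbert_total N p q = false.
  apply: hilbert_product; rewrite ?eqz_nat -?lt0n ?prime_gt0 //=; rewrite /N; lia.
rewrite /hilbert_total /hilbert_inf /= (@big_xor_support _ _ [:: 2; p; q]%N).
- rewrite !big_cons big_nil addbF.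
  case h2: (hilbert 2 p q).
    case hp: (hilbert p p q) => /= hq.
      by exists 2%N, p => v v_pr hv; have := supp v v_pr hv; rewrite !inE => /or3P[] h; rewrite ?h ?orbT //;
        move: hv hq; rewrite (eqP h) => ->.
    exists 2%N, q => v v_pr hv; have := supp v v_pr hv; rewrite !inE => /or3P[] h; rewrite ?h ?orbT //.
    by move: hv; rewrite (eqP h) hp.
  move=> _; exists p, q => v v_pr hv; have := supp v v_pr hv; rewrite !inE => /or3P[] h; rewrite ?h ?orbT //.
  by move: hv; rewrite (eqP h) h2.
- by rewrite /= !inE negb_or eq_sym p2 eq_sym q2 pq.
- by rewrite /= p_pr q_pr /N; lia.
- by move=> v v_pr; apply: contraNF => /(supp v v_pr).
Qed.

Section Criterion.
Variables (d1 d2 : int) (K : fieldExtType rat) (s1 s2 : K) (p q : nat).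
Hypotheses (sqf1 : squarefreez d1) (sqf2 : squarefreez d2).
Hypotheses (d12 : d1 <> d2) (d1_1 : d1 <> 1) (d2_1 : d2 <> 1).
Hypothesis hK : is_biquadratic d1 d2 s1 s2.
Hypotheses (p_pr : prime p) (q_pr : prime q).

(* At a ramified v where d1 and d2 are not both squares, at most one of d1, d2,
   d1 d2 is a square; two such places leave one of the three nonsquare at both. *)
Theorem division_iff_local : division_ring (quaternion (p%:R : K) q%:R) <->
  exists v, [/\ prime v, hilbert v p q, local_square v d1 & local_square v d2].
Proof.
rewrite !pmulrn; split=> [div|[v [v_pr v_ram v1 v2]]]; last first.
  have aniso := hilbert_aniso v_pr p_pr q_pr v_ram.
  exact: (locally_anisotropic_division sqf1 sqf2 d12 d1_1 d2_1 hK v_pr aniso v1 v2).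
have [d10 _] := sqf1; have [d20 _] := sqf2; have [e1 e2 _] := hK.
have d0 : d1 * d2 != 0 by rewrite mulf_neq0.
have e12 : (s1 * s2) ^+ 2 = (d1 * d2)%:~R by rewrite exprMn e1 e2 intrM.
have inj0 (z : int) : z%:~R = 0 :> K -> z = 0 by exact: intr_ext_eq0.
have p_gt0 : 0 < p%:Z by rewrite ltz_nat prime_gt0.
have q0 : q%:Z != 0 by rewrite eqz_nat -lt0n prime_gt0.
pose bad v d := [&& prime v, hilbert v p q & local_square v d].
have [u [w places]] := hilbert_two_places p_pr q_pr.
have good (s : K) (d : int) : s ^+ 2 = d%:~R -> d != 0 -> ~~ bad u d -> ~~ bad w d -> False.
  move=> sd nz bu bw; apply: (locally_split_not_division inj0 sd p_gt0 q0 nz _ div) => v v_pr v_ram.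
  have : ~~ bad v d by have /orP[] := places v v_pr v_ram => /eqP ->.
  by rewrite /bad v_pr v_ram.
(* The three square classes sum to zero, so two local squares force the third. *)
have lsqM v : prime v -> [|| ~~ local_square v d1, ~~ local_square v d2 | local_square v (d1 * d2)] &&
   [|| ~~ local_square v d1, ~~ local_square v (d1 * d2) | local_square v d2] &&
   [|| ~~ local_square v d2, ~~ local_square v (d1 * d2) | local_square v d1].
  move=> v_pr; rewrite local_squareM // /local_square.
  by case: (sq_class v d1) (sq_class v d2) => [[[] []] []] [[[] []] []].
have one_bad v : ~~ (bad v d1 && bad v d2) ->
  [|| ~~ bad v d1 && ~~ bad v d2, ~~ bad v d1 && ~~ bad v (d1 * d2) |
    ~~ bad v d2 && ~~ bad v (d1 * d2)].
  rewrite /bad; case v_pr: (prime v) => //; case v_ram: (hilbert v p q) => //=.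
  by have := lsqM v v_pr; do 3 case: (local_square v _).
have place v : bad v d1 && bad v d2 ->
    exists v, [/\ prime v, hilbert v p q, local_square v d1 & local_square v d2].
  by move=> /andP[/and3P[v_pr v_ram v1] /and3P[_ _ v2]]; exists v.
have [/place //|nu] := boolP (bad u d1 && bad u d2).
have [/place //|nw] := boolP (bad w d1 && bad w d2).
exfalso; have := one_bad u nu; have := one_bad w nw; move: nu nw => _ _.
have := (good _ _ e1 d10, good _ _ e2 d20, good _ _ e12 d0).
case: (bad u d1) (bad w d1) (bad u d2) (bad w d2) (bad u (d1 * d2)) (bad w (d1 * d2))
  => [] [] [] [] [] [] [[h1 h2] h3] //=;
  solve [by move=> *; apply: h1 | by move=> *; apply: h2 | by move=> *; apply: h3].
Qed.

End Criterion.

(** * From ramified primes to the explicit congruence conditions *)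

Section Conditions.
Variables (d1 d2 : int).
Hypotheses (sqf1 : squarefreez d1) (sqf2 : squarefreez d2).

Let both_squares (v : nat) : bool := local_square v d1 && local_square v d2.

Let both_disc_residuesP l : prime l -> odd l -> reflect (both_disc_residues d1 d2 l) (both_squares l).
Proof.
move=> l_pr l_odd; have l2 : (l == 2)%N = false by apply: contraTF l_odd => /eqP ->.
rewrite /both_squares !local_squareE // l2.
by apply: (iffP andP) => [[/eqP ? /eqP ?]|[-> ->]].
Qed.

Let both_1_mod_8P : reflect (both_1_mod_8 d1 d2) (both_squares 2).
Proof.
rewrite /both_squares !local_squareE //=.
by apply: (iffP andP) => [[/eqP ? /eqP ?]|[-> ->]].
Qed.

Let local_division (p q : nat) : Prop :=
  exists v, [/\ prime v, hilbert v p q, local_square v d1 & local_square v d2].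

Let local_divisionP p q : prime p -> prime q ->
  reflect (local_division p q)
    (has (fun v => hilbert v p q && both_squares v) [:: 2; p; q]%N).
Proof.
move=> p_pr q_pr; apply: (iffP hasP) => [[v v_in /and3P[v_ram v1 v2]]|[v [v_pr v_ram v1 v2]]].
  by exists v; split=> //; move: v_in; rewrite !inE => /or3P[] /eqP ->.
exists v; last by rewrite /both_squares v_ram v1.
move: v_ram; rewrite !inE; apply: contraLR; rewrite !negb_or => /and3P[v2' vp vq].
by rewrite hilbert_unit ?prime_ndvd.
Qed.

Lemma conditions_two p : prime p -> odd p -> local_division p 2 <-> conditions d1 d2 p 2.
Proof.
move=> p_pr p_odd; have p2 : p != 2%N by apply: contraTneq p_odd => ->.
have hp : hilbert p p 2 = (p %% 8 \in [:: 3; 5])%N.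
  rewrite /hilbert sq_class_self // sq_class_unit ?prime_ndvd // /class_pairing (negbTE p2) /=.
  by rewrite nonres2.
have h2 : hilbert 2 p 2 = (p %% 8 \in [:: 3; 5])%N.
  rewrite /hilbert sq_class_self // odd_classE // /class_pairing /=.
  by rewrite andbF andbT.
split.
  move=> /(local_divisionP p_pr (isT : prime 2)); rewrite /= hp h2 orbF orbCA orbb -andb_orr.
  rewrite !inE => /andP[p8 pL]; apply: Or32; split=> //.
    by move: p8 => /orP[] /eqP ->; [left | right].
  by case/orP: pL => [/(both_disc_residuesP p_pr p_odd)|/both_1_mod_8P]; [left | right].
move=> [[[_ //]]|[_ p8 pL]|[_ //]].
apply/(local_divisionP p_pr (isT : prime 2)); rewrite /= hp h2 orbF orbCA orbb -andb_orr !inE.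
apply/andP; split; first by case: p8 => ->.
by case: pL => [/(both_disc_residuesP p_pr p_odd) ->|/both_1_mod_8P ->]; rewrite ?orbT.
Qed.

(** Only condition (3) can hold, and the symbol of p over itself is 0: this is the case that
    distinguishes [<> 1] from [= -1] there. *)
Lemma conditions_self p : prime p -> odd p -> local_division p p <-> conditions d1 d2 p p.
Proof.
move=> p_pr p_odd; have p2 : p != 2%N by apply: contraTneq p_odd => ->.
have hp : hilbert p p p = (p %% 4 == 3)%N.
  by rewrite /hilbert sq_class_self // /class_pairing (negbTE p2) /= !addbF.
have h2 : hilbert 2 p p = (p %% 4 == 3)%N.
  by rewrite /hilbert odd_classE // /class_pairing /= !addbF andbb ?andbF ?addbF.
have leg : legendre p p = 0 by rewrite /legendre dvdzz.
split.
  move=> /(local_divisionP p_pr p_pr); rewrite /= hp h2 orbF orbb -andb_orr.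
  move=> /andP[/eqP p4 pL]; apply: Or33; split=> //; left; rewrite leg; split=> //.
  by case/orP: pL => [/both_1_mod_8P|/(both_disc_residuesP p_pr p_odd)]; [right | left].
move=> [[[_ _ //]]|[p2' _ _]|[_ _ p4 _ pL]]; first by rewrite p2' in p2.
apply/(local_divisionP p_pr p_pr); rewrite /= hp h2 orbF orbb -andb_orr p4 /=.
by case: pL => -[_ [/(both_disc_residuesP p_pr p_odd)|/both_1_mod_8P] ->]; rewrite ?orbT.
Qed.

Lemma hilbert_odd_primes p q : prime p -> prime q -> odd p -> odd q -> p != q ->
  [/\ hilbert p p q = nonres p q, hilbert q p q = nonres q p &
      hilbert 2 p q = (p %% 4 == 3)%N && (q %% 4 == 3)%N].
Proof.
move=> p_pr q_pr p_odd q_odd pq.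
have p2 : p != 2%N by apply: contraTneq p_odd => ->.
have q2 : q != 2%N by apply: contraTneq q_odd => ->.
split; rewrite /hilbert.
- rewrite sq_class_self // sq_class_unit ?prime_ndvd // /class_pairing (negbTE p2) //.
- rewrite sq_class_self // sq_class_unit ?prime_ndvd // 1?eq_sym // /class_pairing (negbTE q2) /=.
  by rewrite andbT addbF.
- by rewrite !odd_classE // /class_pairing /= !andbF !addbF.
Qed.

Lemma legendre_nonres p q : prime p -> prime q -> p != q ->
  legendre q p = if nonres p q then -1 else 1.
Proof.
by move=> p_pr q_pr pq; rewrite legendreE // dvdzE /= dvdn_prime2 // (negbTE pq).
Qed.

(** If p and q are both 3 modulo 4, the algebra ramifies at 2 and, by reciprocity, at exactly one of
    p and q, giving (3). Otherwise 2 is unramified and the symbols at p and q coincide, giving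
    (1). *)
Lemma local_division_conditions p q : prime p -> prime q -> odd p -> odd q -> p != q ->
  local_division p q -> conditions d1 d2 p q.
Proof.
move=> p_pr q_pr p_odd q_odd pq; have qp : q != p by rewrite eq_sym.
have [hp hq h2] := hilbert_odd_primes p_pr q_pr p_odd q_odd pq.
have := quadratic_reciprocity p_pr q_pr p_odd q_odd pq.
have leg_q := legendre_nonres p_pr q_pr pq; have leg_p := legendre_nonres q_pr p_pr qp.
move=> qr /(local_divisionP p_pr q_pr); rewrite /= h2 hp hq orbF.
have [/andP[/eqP p4 /eqP q4]|pq4] := boolP ((p %% 4 == 3) && (q %% 4 == 3))%N.
  move: qr; rewrite p4 q4 /= => qr pqL; apply: Or33; split=> //; rewrite leg_p leg_q.
  move: qr pqL; case: (nonres p q); case: (nonres q p) => //= _; rewrite ?orbF.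
    by case/orP=> [/both_1_mod_8P|/(both_disc_residuesP p_pr p_odd)]; left; split=> //; [right | left].
  by case/orP=> [/both_1_mod_8P|/(both_disc_residuesP q_pr q_odd)]; right; split=> //; [right | left].
rewrite (negbTE pq4) in qr; rewrite /= -(addbK (nonres q p) (nonres p q)) qr /= -andb_orr.
move=> /andP[q_res pL]; apply: Or31; split; first by split=> //; apply/eqP.
split; first by rewrite leg_p q_res.
  move: pq4; rewrite negb_and => /orP[] h; [left | right].
    by move: p_odd h; clear; lia.
  by move: q_odd h; clear; lia.
by case/orP: pL => [/(both_disc_residuesP p_pr p_odd)|/(both_disc_residuesP q_pr q_odd)]; [left | right].
Qed.

Lemma conditions_local_division p q : prime p -> prime q -> odd p -> odd q -> p != q ->
  conditions d1 d2 p q -> local_division p q.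
Proof.
move=> p_pr q_pr p_odd q_odd pq; have qp : q != p by rewrite eq_sym.
have [hp hq h2] := hilbert_odd_primes p_pr q_pr p_odd q_odd pq.
have qr := quadratic_reciprocity p_pr q_pr p_odd q_odd pq.
have leg_q := legendre_nonres p_pr q_pr pq; have leg_p := legendre_nonres q_pr p_pr qp.
move=> h; apply/(local_divisionP p_pr q_pr); rewrite /= h2 hp hq orbF.
case: h => [[_ [h p4 pL]]|[q2 _ _]|[_ _ p4 q4 pL]].
- have q_res : nonres q p by move: h; rewrite leg_p; case: (nonres q p).
  have h4 : (p %% 4 == 3)%N && (q %% 4 == 3)%N = false.
    by case: p4 => ->; rewrite ?andbF.
  move: qr; rewrite h4 q_res addbT => /negbFE ->.
  by case: pL => [/(both_disc_residuesP p_pr p_odd) ->|/(both_disc_residuesP q_pr q_odd) ->]; rewrite ?orbT.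
- by rewrite q2 in q_odd.
rewrite p4 q4 /=; case: pL => -[leg]; rewrite ?leg_p ?leg_q in leg.
  have -> : nonres p q by case: (nonres p q) leg.
  by case=> [/(both_disc_residuesP p_pr p_odd)|/both_1_mod_8P] ->; rewrite ?orbT.
have -> : nonres q p by case: (nonres q p) leg.
by case=> [/(both_disc_residuesP q_pr q_odd)|/both_1_mod_8P] ->; rewrite ?orbT.
Qed.

Lemma not_conditions_two q : odd q -> ~ conditions d1 d2 2 q.
Proof. by move=> q_odd [[[]]|[q2]|[]] //; rewrite q2 in q_odd. Qed.

Lemma local_division_iff p q : prime p -> prime q ->
  local_division p q <-> conditions d1 d2 p q \/ conditions d1 d2 q p.
Proof.
move=> p_pr q_pr.
have swap a b : local_division a b -> local_division b a.
  by move=> [v [? h ? ?]]; exists v; split=> //; rewrite hilbertC.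
have [p_odd|p_even] := boolP (odd p); have [q_odd|q_even] := boolP (odd q).
- have [pq|pq] := eqVneq p q.
    by rewrite -pq conditions_self //; split; [left | case].
  split=> [h|[]]; first by left; apply: local_division_conditions.
    exact: conditions_local_division.
  by move=> h; apply/swap/conditions_local_division; rewrite // eq_sym.
- have q2 : q = 2%N by apply/eqP; apply: contraR q_even => /(odd_prime_neq2 q_pr).
  rewrite q2 conditions_two //; split; [by left | by case=> // /(not_conditions_two p_odd)].
- have p2 : p = 2%N by apply/eqP; apply: contraR p_even => /(odd_prime_neq2 p_pr).
  rewrite p2; split=> [/swap|]; first by rewrite conditions_two //; right.
  by case=> [/(not_conditions_two q_odd)//|]; rewrite -conditions_two // => /swap.
have -> : p = 2%N by apply/eqP; apply: contraR p_even => /(odd_prime_neq2 p_pr).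
have -> : q = 2%N by apply/eqP; apply: contraR q_even => /(odd_prime_neq2 q_pr).
have h22 : hilbert 2 2 2 = false by rewrite /hilbert sq_class_self.
split; last by case=> -[[[]]|[_ []]|[]].
move=> /(local_divisionP (isT : prime 2) (isT : prime 2))/hasP[v].
by rewrite !inE => v2; have -> : v = 2%N by [case/or3P: v2 => /eqP]; rewrite h22.
Qed.

End Conditions.

Theorem theorem4p6 (d1 d2 : int)
    (hd1 : squarefreez d1) (hd2 : squarefreez d2)
    (hd12 : d1 <> d2) (hd1_1 : d1 <> 1) (hd2_1 : d2 <> 1)
    (K : fieldExtType rat) (s1 s2 : K) (hK : is_biquadratic d1 d2 s1 s2)
    (p q : nat) (hp : prime p) (hq : prime q) :
  division_ring (quaternion (p%:R : K) (q%:R : K)) <->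
  (conditions d1 d2 p q \/ conditions d1 d2 q p).
Proof.
rewrite -local_division_iff //.
exact: (division_iff_local hd1 hd2 hd12 hd1_1 hd2_1 hK hp hq).
Qed.
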